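(* Let $n \geq 2$. Suppose the compact set $K \subset \mathbb{R}^n$ has the same $(n-2)$-capacity as a closed ball $B \subset \mathbb{R}^n$ centered at the origin, $\mathrm{Cap}_{n-2}(K)=\mathrm{Cap}_{n-2}(B)>0$, and write $\mu$ and $\nu$ for the $(n-2)$-equilibrium measures of $K$ and $B$ respectively. (i) If $q>0$, or else if $q<-(n-2)$ and the origin is a regular point of $K$, then $$\int_K |x|^q \, d\mu \geq \int_B |x|^q \, d\nu .$$ (ii) (The case $q \to 0$) $$\int_K \log |x| \, d\mu \geq \int_B \log |x| \, d\nu .$$ (iii) If $-(n-2) \leq q < 0$ then the inequality is reversed: $$\int_K |x|^q \, d\mu \leq \int_B |x|^q \, d\nu .$$ (iv) (Equality statements) In part (i), equality holds if and only if $K$ contains the sphere $\partial B$ and $K \setminus B$ has inner $(n-2)$-capacity zero; the same is true for part (ii) when $n \geq 3$, and for part (iii) when $-(n-2) < q < 0$. For part (ii) with $n=2$, and for part (iii) with $n \geq 3$ and $q=-(n-2)$, equality holds if and only if the origin is a regular point of $K$.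
   Context: For a compact set $K \subset \mathbb{R}^n$, the logarithmic energy is $V_{log}(K)=\inf_\mu \int_K\int_K \log\frac{1}{|x-y|}\,d\mu(x)d\mu(y)$ and, for $p>0$, the Riesz $p$-energy is $V_p(K)=\inf_\mu \int_K\int_K \frac{1}{|x-y|^p}\,d\mu(x)d\mu(y)$, where the infimum is over all Borel probability measures $\mu$ on $K$ (the energy of the empty set is $+\infty$). The infimum is attained, and when the energy is finite the minimizing measure is unique; it is called the logarithmic equilibrium measure (also called the $0$-equilibrium measure), respectively the $p$-equilibrium measure, of $K$. The capacity is $\mathrm{Cap}_p(K)=V_p(K)^{-1/p}$ for $p>0$ and $\mathrm{Cap}_0(K)=\exp(-V_{log}(K))$ for $p=0$ (logarithmic capacity); it is positive if and only if the corresponding energy is finite. A set $Z$ has inner $p$-capacity zero if $\mathrm{Cap}_p(Z')=0$ for every compact $Z'\subset Z$. A regular point of $K$ is a point at which the equilibrium potential of $K$ equals the energy of $K$. Thus the origin is a regular point of $K$ if $\int_K |x|^{-(n-2)}\,d\mu = V_{n-2}(K)$ when $n\ge 3$, and if $\int_K \log\frac{1}{|x|}\,d\mu = V_{log}(K)$ when $n=2$. In part (i) with $q<-(n-2)$ the left-hand moment is allowed to equal $+\infty$. *)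

(* Defs.v *)
From mathcomp Require Import all_boot all_order all_algebra.
From mathcomp Require Import all_classical all_reals all_analysis.
Import Order.TTheory GRing.Theory Num.Theory numFieldNormedType.Exports.

Set Implicit Arguments.
Unset Strict Implicit.
Unset Printing Implicit Defensive.

Local Open Scope classical_set_scope.
Local Open Scope ring_scope.

(* The library norm on 'rV[R]_n is the sup norm, which induces the same
   topology, hence the same Borel and compact sets. *)
Definition enorm {R : realType} {n : nat} (x : 'rV[R]_n) : R :=
  Num.sqrt (\sum_(i < n) x ord0 i ^+ 2).

Notation borel_probability R n :=
  (probability (g_sigma_algebraType (@open 'rV[R]_n)) R).

Definition eball {R : realType} (n : nat) (r : R) : set 'rV[R]_n :=
  [set x | enorm x <= r].

Definition boundary {T : topologicalType} (A : set T) : set T :=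
  closure A `\` interior A.

(* x ^ q on [0, +oo] with 0 ^ q = +oo and +oo ^ q = 0 for q < 0; the library's
   poweR has 0 `^ q = 0 and +oo `^ q = +oo there. *)
Definition epow {R : realType} (x : \bar R) (q : R) : \bar R :=
  if q < 0 then ((x `^ (- q))^-1)%E else (x `^ q)%E.

(* At t = 0 both branches are +oo, since 0^-1 = +oo in \bar R. *)
Definition riesz_kernel {R : realType} (p t : R) : \bar R :=
  if p == 0 then lne (t%:E^-1)%E else epow t%:E (- p).

Definition potential {R : realType} {n : nat} (p : R) (K : set 'rV[R]_n)
    (mu : borel_probability R n) (x : 'rV[R]_n) : \bar R :=
  (\int[mu]_(y in K) riesz_kernel p (enorm (x - y)))%E.

Definition measure_energy {R : realType} {n : nat} (p : R) (K : set 'rV[R]_n)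
    (mu : borel_probability R n) : \bar R :=
  (\int[mu]_(x in K) potential p K mu x)%E.

(* A Borel probability measure on K is a Borel probability measure on R^n
   giving mass 1 to K. *)
Definition energy {R : realType} {n : nat} (p : R) (K : set 'rV[R]_n) : \bar R :=
  ereal_inf [set measure_energy p K mu
            | mu in [set mu : borel_probability R n | mu K = 1%E]].

Definition equilibrium_measure {R : realType} {n : nat} (p : R)
    (K : set 'rV[R]_n) (mu : borel_probability R n) : Prop :=
  mu K = 1%E /\ measure_energy p K mu = energy p K.

Definition capacity {R : realType} {n : nat} (p : R) (K : set 'rV[R]_n)
    : \bar R :=
  if p == 0 then expeR (- energy p K)%E else epow (energy p K) (- p^-1).

Definition inner_capacity_zero {R : realType} {n : nat} (p : R)
    (Z : set 'rV[R]_n) : Prop :=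
  forall Z' : set 'rV[R]_n, compact Z' -> Z' `<=` Z -> capacity p Z' = 0%E.

(* mu stands for the equilibrium measure of K. *)
Definition regular_point {R : realType} {n : nat} (p : R) (K : set 'rV[R]_n)
    (mu : borel_probability R n) (x : 'rV[R]_n) : Prop :=
  potential p K mu x = energy p K.

Definition moment {R : realType} {n : nat} (q : R) (K : set 'rV[R]_n)
    (mu : borel_probability R n) : \bar R :=
  (\int[mu]_(x in K) epow (enorm x)%:E q)%E.

(* lne 0 = -oo, unlike ln 0 = 0. *)
Definition log_moment {R : realType} {n : nat} (K : set 'rV[R]_n)
    (mu : borel_probability R n) : \bar R :=
  (\int[mu]_(x in K) lne (enorm x)%:E)%E.

(* Main.v *)
(* Idea.  Newton's kernel [1 / |x| ^ (n - 2)] (or [- log |x|]) is superharmonic and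
   conditionally positive definite.  Positive definiteness comes from writing the
   kernel as a mixture of Gaussians [exp (- a ^ 2 |x - y| ^ 2)], whose mutual
   energies expand into squares of Gaussian moments; it makes the equilibrium
   measure unique.  The variational inequality gives that the equilibrium
   potential equals the energy almost everywhere on [K], and the maximum
   principle extends the upper bound to the origin: the [mu]-mean of the
   kernel at [|x|] is at most the energy, with equality iff the origin is regular.
   For the ball, uniqueness makes [nu] invariant under reflections, and Newton's
   theorem on spherical shells shows that [nu] lives on the sphere [|x| = r] and
   that the energy is the kernel at [r].  As a function of the kernel,
   [|x| ^ q] (and [log |x|]) is convex or concave, so its tangent at [|x| = r]
   yields the inequalities; equality forces [|x| = r] [mu]-almost everywhere,
   that is [mu = nu] by uniqueness.

   Throughout, the kernel is made nonnegative by subtracting its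
   value at a distance [D] larger than all distances involved. *)
Require Import Defs.
From mathcomp Require Import all_boot all_order all_algebra.
From mathcomp Require Import all_classical all_reals all_analysis.
From mathcomp Require Import measurable_realfun ring lra.
Import Order.TTheory GRing.Theory Num.Theory numFieldNormedType.Exports.
Set Implicit Arguments.
Unset Strict Implicit.
Unset Printing Implicit Defensive.
Local Open Scope classical_set_scope.
Local Open Scope ring_scope.

(** * The Euclidean norm and Newton's kernel *)

Section euclidean_norm.
Context {R : realType} {n : nat}.
Implicit Types x y z : 'rV[R]_n.

(** The potential of [mu] is controlled only almost everywhere on [K], while the origin may lie off
    [K] or in the exceptional null set, and a potential may be infinite or discontinuous. The
    maximum principle is therefore proved for truncated potentials, which are Lipschitz, with second
    differences in place of a Laplacian: those of Newton's kernel are O([h ^+ 3]), negligible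
    against the [h ^+ 2] produced by a small multiple of the squared norm. An Egorov-type set
    carries nearly all the mass and bounds the truncation error on itself; homogeneity of the kernel
    spreads this bound to a neighborhood of the set, and away from the set the truncated potential
    is harmonic.

    Surface measure is never constructed: rescaling the reflection-invariant minimizer of the ball
    to a sphere gives an invariant measure there, and invariance is all that Newton's theorem on
    shells uses.

    With [K] and the ball inside radius [M], the maximum principle is run in radius [3 * M]; hence
    the choice [D = 4 * M], which no distance involved exceeds. *)

Definition dot x y : R := \sum_(i < n) x ord0 i * y ord0 i.

Lemma dotC x y : dot x y = dot y x.
Proof. by apply: eq_bigr => i _; rewrite mulrC. Qed.

Lemma dotDl x y z : dot (x + y) z = dot x z + dot y z.
Proof. by rewrite -big_split/=; apply: eq_bigr => i _; rewrite mxE mulrDl. Qed.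

Lemma dotZl a x y : dot (a *: x) y = a * dot x y.
Proof. by rewrite mulr_sumr; apply: eq_bigr => i _; rewrite mxE mulrA. Qed.

Lemma dotNl x y : dot (- x) y = - dot x y.
Proof. by rewrite -scaleN1r dotZl mulN1r. Qed.

Lemma dotDr x y z : dot z (x + y) = dot z x + dot z y.
Proof. by rewrite dotC dotDl !(dotC _ z). Qed.

Lemma dotZr a x y : dot x (a *: y) = a * dot x y.
Proof. by rewrite dotC dotZl dotC. Qed.

Lemma dotNr x y : dot x (- y) = - dot x y.
Proof. by rewrite dotC dotNl dotC. Qed.

Lemma dot_ge0 x : 0 <= dot x x.
Proof. by apply: sumr_ge0 => i _; rewrite -expr2 sqr_ge0. Qed.

Lemma enormE x : enorm x = Num.sqrt (dot x x).
Proof. by congr Num.sqrt; apply: eq_bigr => i _; rewrite expr2. Qed.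

Lemma enorm_ge0 x : 0 <= enorm x.
Proof. exact: sqrtr_ge0. Qed.

Lemma sqr_enorm x : enorm x ^+ 2 = dot x x.
Proof. by rewrite enormE sqr_sqrtr// dot_ge0. Qed.

Lemma coord_le_enorm x i : `|x ord0 i| <= enorm x.
Proof.
rewrite -(@ler_pXn2r _ 2) ?nnegrE ?enorm_ge0// sqr_enorm real_normK ?num_real//.
rewrite /dot (bigD1 i)//= -expr2 lerDl.
by apply: sumr_ge0 => j _; rewrite -expr2 sqr_ge0.
Qed.

Lemma enorm_eq0 x : enorm x = 0 -> x = 0.
Proof.
move=> x0; apply/rowP => i; rewrite mxE; apply/eqP.
by rewrite -normr_le0 -x0 coord_le_enorm.
Qed.

Lemma enorm0 : enorm (0 : 'rV[R]_n) = 0.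
Proof. by rewrite enormE -(scale0r 0) dotZl mul0r sqrtr0. Qed.

Lemma enormZ a x : enorm (a *: x) = `|a| * enorm x.
Proof.
by rewrite !enormE dotZl dotZr mulrA -expr2 sqrtrM ?sqr_ge0// sqrtr_sqr.
Qed.

Lemma enormN x : enorm (- x) = enorm x.
Proof. by rewrite -scaleN1r enormZ normrN1 mul1r. Qed.

Lemma enormB x y : enorm (x - y) = enorm (y - x).
Proof. by rewrite -enormN opprB. Qed.

Lemma dot_le_enorm x y : dot x y <= enorm x * enorm y.
Proof.
have := mulr_ge0 (enorm_ge0 x) (enorm_ge0 y).
rewrite le_eqVlt => /orP[/eqP/esym/eqP|xy0].
  rewrite mulf_eq0 => /orP[] /eqP /[dup] /enorm_eq0 -> ->.
    by rewrite mul0r -(scale0r 0) dotZl mul0r.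
  by rewrite mulr0 -(scale0r 0) dotZr mul0r.
(* The expansion is [2 * enorm x * enorm y] times the difference of the two sides of
   Cauchy-Schwarz. *)
have := dot_ge0 (enorm y *: x - enorm x *: y).
rewrite dotDl !dotDr !dotNl !dotNr !dotZl !dotZr -!sqr_enorm (dotC y x) => H.
rewrite -subr_ge0 -(pmulr_rge0 _ xy0).
set a := enorm x in H *; set b := enorm y in H *; set d := dot x y in H *.
nra.
Qed.

Lemma ler_enormD x y : enorm (x + y) <= enorm x + enorm y.
Proof.
rewrite -(@ler_pXn2r _ 2) ?nnegrE ?addr_ge0 ?enorm_ge0//.
rewrite sqr_enorm dotDl !dotDr (dotC y x) sqrrD !sqr_enorm mulr2n.
by have := dot_le_enorm x y; lra.
Qed.

Lemma ler_enorm_dist x y z : enorm (x - z) <= enorm (x - y) + enorm (y - z).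
Proof. by rewrite (le_trans _ (ler_enormD _ _))// addrA subrK. Qed.

Lemma continuous_enorm : continuous (@enorm R n).
Proof.
move=> x; apply: (@continuous_comp _ _ _ (fun x : 'rV[R]_n => \sum_(i < n) x ord0 i ^+ 2) Num.sqrt).
  apply: (@continuous_big R _ _ _ predT (@add_continuous _) _ _
    (fun i (x : 'rV[R]_n) => x ord0 i ^+ 2)) => i _ {}x.
  exact: (cvg_comp _ _ (@coord_continuous _ _ _ _ _ _) (@exprn_continuous _ _ _)).
exact: sqrt_continuous.
Qed.

Lemma continuous_enormB x : continuous (fun y => enorm (x - y)).
Proof.
move=> y; apply: continuous_comp; last exact: continuous_enorm.
by apply: continuousB; [exact: cst_continuous|].
Qed.

Lemma closed_eball (r : R) : closed (@eball R n r).
Proof.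
rewrite (_ : eball r = @enorm R n @^-1` [set t | t <= r])//.
apply: preimage_closed; first by move=> x _; exact: continuous_enorm.
exact: closed_le.
Qed.

Lemma compact_eball (r : R) : compact (@eball R n r).
Proof.
apply: bounded_closed_compact; last exact: closed_eball.
exists r; split; first exact: num_real.
move=> M rM x /= xr; rewrite [leLHS]/Num.norm/= mx_normrE.
have M0 : 0 <= M by rewrite (le_trans (enorm_ge0 x))// (le_trans xr)// ltW.
apply/bigmax_leP; split => // -[i j] _ /=; rewrite (ord1 i).
by rewrite (le_trans (coord_le_enorm _ _))// (le_trans xr)// ltW.
Qed.

Lemma enorm_delta (i : 'I_n) : enorm (delta_mx ord0 i : 'rV[R]_n) = 1.
Proof.
rewrite /enorm (bigD1 i)//= mxE !eqxx expr1n big1 ?addr0 ?sqrtr1// => j ji.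
by rewrite mxE eqxx (negbTE ji)/= expr0n.
Qed.

Lemma dot_delta x (i : 'I_n) : dot x (delta_mx ord0 i) = x ord0 i.
Proof.
rewrite /dot (bigD1 i)//= mxE !eqxx mulr1 big1 ?addr0// => j ji.
by rewrite mxE eqxx (negbTE ji)/= mulr0.
Qed.

End euclidean_norm.

Section newton_kernel.
Context {R : realType}.
Implicit Types (p : nat) (t s u : R).

Definition newton p t : R := if p == 0 then - ln t else (t ^+ p)^-1.

Lemma newton_nincr p s t : 0 < s -> s <= t -> newton p t <= newton p s.
Proof.
move=> s0 st; have t0 := lt_le_trans s0 st; rewrite /newton; case: eqP => _.
  by rewrite lerN2 ler_ln.
by rewrite lef_pV2 ?posrE ?exprn_gt0// lerXn2r// nnegrE ltW.
Qed.

Lemma newton_decr p s t : 0 < s -> s < t -> newton p t < newton p s.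
Proof.
move=> s0 st; have t0 := lt_trans s0 st; rewrite /newton; case: eqP => [_|/eqP p0].
  by rewrite ltrN2 ltr_ln.
by rewrite ltf_pV2 ?posrE ?exprn_gt0// ltrXn2r// ltW.
Qed.

Lemma bernoulli_le1 p t : 0 <= t <= 1 -> 1 - p%:R * (1 - t) <= t ^+ p.
Proof.
move=> /andP[t0 t1]; elim: p => [|p ih]; first by rewrite mul0r subr0 expr0.
rewrite exprS -natr1.
have := ler_wpM2l t0 ih.
have : 0 <= p%:R * (1 - t) ^+ 2 :> R by rewrite mulr_ge0// sqr_ge0.
nra.
Qed.

(** The absolute value of the derivative of [newton p] at [d], its steepest slope on [[d, +oo[];
    [maxn p 1] covers the logarithm. *)
Definition newton_lip p (d : R) : R := (maxn p 1)%:R / d ^+ p.+1.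

Lemma newton_lip_ge0 p d : 0 < d -> 0 <= newton_lip p d.
Proof. by move=> d0; rewrite divr_ge0// exprn_ge0// ltW. Qed.

Lemma newton_lipschitz p d s t : 0 < d -> d <= s -> s <= t ->
  newton p s - newton p t <= newton_lip p d * (t - s).
Proof.
move=> d0 ds st; have s0 := lt_le_trans d0 ds; have t0 := lt_le_trans s0 st.
rewrite /newton /newton_lip; case: eqP => [->|/eqP p0].
  rewrite expr1 opprK addrC -ln_div ?posrE//.
  have -> : t / s = 1 + (t - s) / s by rewrite mulrBl divff ?gt_eqF// addrCA subrr addr0.
  rewrite (le_trans (le_ln1Dx _))//.
    by rewrite (lt_le_trans _ (divr_ge0 _ _))// ?subr_ge0// ltW.
  by rewrite mulrC ler_wpM2r ?subr_ge0// mul1r lef_pV2.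
have -> : maxn p 1 = p by apply/maxn_idPl; rewrite lt0n.
have st1 : 0 <= s / t <= 1.
  by rewrite divr_ge0 ?ler_pdivrMr ?mul1r//= ltW.
have := bernoulli_le1 p st1.
have -> : 1 - s / t = (t - s) / t by rewrite mulrBl divff ?gt_eqF.
rewrite expr_div_n lerBlDl -lerBlDr => B.
have -> : (s ^+ p)^-1 - (t ^+ p)^-1 = (s ^+ p)^-1 * (1 - s ^+ p / t ^+ p).
  by rewrite mulrBr mulr1 mulrA mulVf ?mul1r// expf_neq0// gt_eqF.
rewrite (@le_trans _ _ ((s ^+ p)^-1 * (p%:R * ((t - s) / t))))//.
  by rewrite ler_wpM2l// invr_ge0 exprn_ge0// ltW.
rewrite exprSr invfM.
have -> : p%:R * ((d ^+ p)^-1 / d) * (t - s) = (d ^+ p)^-1 * (p%:R * ((t - s) / d)).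
  by ring.
apply: ler_pM.
- by rewrite invr_ge0 exprn_ge0// ltW.
- by rewrite mulr_ge0// divr_ge0 ?subr_ge0// ltW.
- by rewrite lef_pV2 ?posrE ?exprn_gt0// lerXn2r// nnegrE ltW.
- rewrite ler_wpM2l// ler_wpM2l ?subr_ge0// lef_pV2 ?posrE//.
  exact: le_trans st.
Qed.

(** Taking differences cancels the constant that rescaling adds to a logarithm, so [p = 0] behaves
    as a homogeneous kernel of degree 0. *)
Lemma newton_scale p s t : 0 < s -> 0 < t ->
  newton p (t / 3) - newton p (s / 3) = 3 ^+ p * (newton p t - newton p s).
Proof.
move=> s0 t0; rewrite /newton; case: eqP => [->|_].
  by rewrite expr0 mul1r !ln_div ?posrE//; lra.
rewrite !expr_div_n !invfM !invrK; ring.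
Qed.

Lemma newton_unbounded p (A : R) : exists2 d, 0 < d &
  forall t, 0 < t -> t <= d -> A <= newton p t.
Proof.
(* Chosen for the logarithm. It also serves [p > 0], since [ln t^-1 < t^-1 <= t^-1 ^+ p] for
   [t <= 1]. *)
exists (expR (- `|A|)); first exact: expR_gt0.
move=> t t0 tA; rewrite (@le_trans _ _ `|A|) ?ler_norm//.
have tlnA : `|A| <= - ln t.
  by rewrite lerNr -ler_expR lnK ?posrE.
rewrite /newton; case: eqP => // /eqP p0.
rewrite (le_trans tlnA)// -(@lnV _ t) ?posrE//.
have tV0 : 0 < t^-1 by rewrite invr_gt0.
rewrite (le_trans (ltW (ln_sublinear tV0)))// -exprVn.
rewrite ler_eXnr ?lt0n// invr_ge1 ?unitfE ?gt_eqF// (le_trans tA)//.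
Qed.

End newton_kernel.

(** * Second-order expansions of Newton's kernel *)

Section second_order_expansions.
Context {R : realType}.
Implicit Types (p : nat) (t s u : R).

(* [f u = 1 + a * u + b * u ^+ 2 + O(u ^+ 3)] *)
Definition expansion2 (f : R -> R) (a b : R) := exists2 C, 0 <= C &
  forall u, `|u| <= 2^-1 -> `|f u - (1 + a * u + b * u ^+ 2)| <= C * `|u| ^+ 3.

Lemma expansion2M f g a b a' b' : expansion2 f a b -> expansion2 g a' b' ->
  expansion2 (fun u => f u * g u) (a + a') (b + b' + a * a').
Proof.
move=> [C C0 fC] [D D0 gD].
pose P := 1 + `|a| + `|b|; pose Q := 1 + `|a'| + `|b'|.
have P0 : 0 <= P by rewrite !addr_ge0.
have Q0 : 0 <= Q by rewrite !addr_ge0.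
have bnd (x y u : R) : `|u| <= 2^-1 -> `|1 + x * u + y * u ^+ 2| <= 1 + `|x| + `|y|.
  move=> u2; have u1 : `|u| <= 1 by lra.
  rewrite (le_trans (ler_normD _ _))// lerD//.
    by rewrite (le_trans (ler_normD _ _))// normr1 lerD// normrM ler_piMr.
  by rewrite normrM normrX ler_piMr// exprn_ile1.
exists (P * D + Q * C + C * D + `|a * b' + b * a'| + `|b * b'|).
  by rewrite !addr_ge0// mulr_ge0.
move=> u u2; have u1 : `|u| <= 1 by lra.
have := fC _ u2; have := gD _ u2.
have := bnd a b _ u2; have := bnd a' b' _ u2; rewrite -/P -/Q.
set p := 1 + a * u + _; set q := 1 + a' * u + _ => qQ pP.
set e := f u - p; set e' := g u - q => eD eC.
have -> : f u * g u - (1 + (a + a') * u + (b + b' + a * a') * u ^+ 2) =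
    p * e' + q * e + e * e' + (a * b' + b * a') * u ^+ 3 + b * b' * u ^+ 4.
  rewrite /e /e' /p /q; ring.
have u3 : 0 <= `|u| ^+ 3 by rewrite exprn_ge0.
have u31 : `|u| ^+ 3 <= 1 by rewrite exprn_ile1.
rewrite [leRHS](_ : _ = P * D * `|u| ^+ 3 + Q * C * `|u| ^+ 3 + C * D * `|u| ^+ 3 +
  `|a * b' + b * a'| * `|u| ^+ 3 + `|b * b'| * `|u| ^+ 3); last by ring.
apply: (le_trans (ler_normD _ _)); apply: lerD.
apply: (le_trans (ler_normD _ _)); apply: lerD.
apply: (le_trans (ler_normD _ _)); apply: lerD.
apply: (le_trans (ler_normD _ _)); apply: lerD.
- by rewrite normrM -mulrA ler_pM.
- by rewrite normrM -mulrA ler_pM.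
- rewrite normrM -mulrA ler_pM// (le_trans eC)//.
  by rewrite -[leRHS]mulr1 ler_wpM2l.
- by rewrite normrM normrX.
- by rewrite normrM normrX ler_wpM2l// (exprS _ 3) ler_piMl.
Qed.

Lemma expansion2_rsqrt :
  expansion2 (fun u => (Num.sqrt (1 + u))^-1) (- 2^-1) (3 / 8).
Proof.
exists 10 => // u; rewrite ler_norml => /andP[u1 u2].
set w := Num.sqrt _.
have w2 : w ^+ 2 = 1 + u by rewrite sqr_sqrtr//; lra.
have w0 : 0 <= w by exact: sqrtr_ge0.
have wl : 2^-1 <= w by rewrite leNgt; apply/negP => ?; nra.
have wu : w <= 2 by rewrite leNgt; apply/negP => ?; nra.
have uE : u = (w - 1) * (w + 1) by rewrite -subr_sqr expr1n w2; lra.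
have wn0 : w != 0 by rewrite gt_eqF//; lra.
(* As a rational function of [w] the error is divisible by the cube of [1 - w], which is at most [u]
   in absolute value because [u = (w - 1) * (w + 1)]. *)
have -> : w^-1 - (1 + - 2^-1 * u + 3 / 8 * u ^+ 2) =
    (1 - w) ^+ 3 * ((3 * w ^+ 2 + 9 * w + 8) / (8 * w)).
  by rewrite uE; field.
rewrite normrM [leRHS]mulrC; apply: ler_pM => //.
- rewrite normrX lerXn2r ?nnegrE// distrC uE normrM ler_peMr//.
  by rewrite ger0_norm; lra.
- rewrite ger0_norm; last by rewrite divr_ge0//; nra.
  rewrite ler_pdivrMr; nra.
Qed.

Lemma expansion2_rsqrtX p :
  expansion2 (fun u => (Num.sqrt (1 + u))^-1 ^+ p)
    (- (p%:R / 2)) (p%:R * (p%:R + 2) / 8).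
Proof.
elim: p => [|p ih].
  exists 0 => // u _; rewrite mul0r expr0 mul0r mul0r oppr0 !mul0r !addr0.
  by rewrite subrr normr0.
have [C C0 H] := expansion2M expansion2_rsqrt ih.
exists C => // u /H; rewrite -exprS -(natr1 p).
have -> : - 2^-1 - p%:R / 2 = - ((p%:R + 1) / 2) :> R by field.
by have -> : 3 / 8 + p%:R * (p%:R + 2) / 8 + - 2^-1 * - (p%:R / 2) =
  (p%:R + 1) * (p%:R + 1 + 2) / 8 :> R by field.
Qed.

Lemma expansion2_ln :
  expansion2 (fun u => 1 - ln (1 + u) / 2) (- 2^-1) (4^-1).
Proof.
exists 1 => // u; rewrite ler_norml => /andP[u1 u2].
(* [F (1 + u) - F 1] is the Taylor remainder [ln (1 + u) - u + u ^+ 2 / 2]. The derivative of [F] is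
   already quadratic in [y - 1], so the mean value theorem yields a cubic bound. *)
pose F (y : R) := ln y + (y ^+ 2 / 2 - 2 * y).
have dF (y : R) : 2^-1 <= y -> is_derive y 1 F ((y - 1) ^+ 2 / y).
  move=> y2; have y0 : 0 < y by lra.
  have D := is_derive1_ln y0.
  apply: is_derive_eq; rewrite /GRing.scale/=.
  by field; rewrite gt_eqF.
have bnd (y : R) : 2^-1 <= y -> 0 <= (y - 1) ^+ 2 / y <= 2 * (y - 1) ^+ 2.
  move=> y2; have y0 : 0 < y by lra.
  rewrite divr_ge0 ?sqr_ge0 ?(ltW y0)//= ler_pdivrMr//.
  by have := sqr_ge0 (y - 1); nra.
have mvt (x y : R) : 2^-1 <= x -> x < y ->
    exists2 c, x <= c <= y & F y - F x = (c - 1) ^+ 2 / c * (y - x).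
  move=> x2 xy; have [//|||c] := @MVT R F (fun y => (y - 1) ^+ 2 / y) x y.
  - by move=> z; rewrite in_itv/= => /andP[? ?]; apply: dF; lra.
  - apply: derivable_within_continuous => z; rewrite in_itv/= => /andP[? ?].
    by have [] : is_derive z 1 F ((z - 1) ^+ 2 / z) by apply: dF; lra.
  - by rewrite in_itv/= => /andP[? ?] H; exists c => //; apply/andP; split; apply/ltW.
have main : `|F (1 + u) - F 1| <= 2 * `|u| ^+ 3.
  have [u0|u0|<-] := ltgtP 0 u; last by rewrite addr0 subrr !normr0 expr0n mulr0.
  - have [||c /andP[c0 cu] ->] := mvt 1 (1 + u); [lra|lra|].
    have /andP[b0 b1] := bnd c ltac:(lra).
    rewrite (addrC 1) addrK normrM (ger0_norm b0) (exprSr _ 2) mulrA ler_wpM2r//.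
    rewrite (le_trans b1)// ler_wpM2l// (gtr0_norm u0) lerXn2r ?nnegrE; lra.
  - have [||c /andP[c0 cu]] := mvt (1 + u) 1; [lra|lra|].
    have /andP[b0 b1] := bnd c ltac:(lra).
    rewrite distrC => ->.
    rewrite opprD addrA subrr sub0r normrM (ger0_norm b0) (exprSr _ 2) mulrA normrN.
    rewrite ler_wpM2r// (le_trans b1)// ler_wpM2l// (ltr0_norm u0).
    by rewrite -[leLHS]sqrrN lerXn2r ?nnegrE; lra.
have -> : 1 - ln (1 + u) / 2 - (1 + - 2^-1 * u + 4^-1 * u ^+ 2) =
    - ((F (1 + u) - F 1) / 2).
  by rewrite /F ln1; field.
by rewrite normrN normrM (ger0_norm (_ : 0 <= 2^-1))//; lra.
Qed.

(** Rescaling the argument multiplies a power but only shifts the logarithm; this amplitude lets one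
    expansion serve both. *)
Definition newton_amp p t : R := if p == 0 then 1 else newton p t.

Lemma newton_amp_ge0 p t : 0 < t -> 0 <= newton_amp p t.
Proof.
move=> t0; rewrite /newton_amp/newton; case: eqP => // _.
by rewrite invr_ge0 exprn_ge0// ltW.
Qed.

Lemma newton_amp_nincr p s t : 0 < s -> s <= t -> newton_amp p t <= newton_amp p s.
Proof.
by move=> s0 st; rewrite /newton_amp; case: eqP => // _; exact: newton_nincr.
Qed.

Lemma newton_expansion p : exists2 g : R -> R,
  forall t u, 0 < t -> -1 < u ->
    newton p (t * Num.sqrt (1 + u)) = newton p t + newton_amp p t * (g u - 1) &
  expansion2 g (- ((maxn p 1)%:R / 2)) ((maxn p 1)%:R * (p%:R + 2) / 8).
Proof.
rewrite /newton /newton_amp; case: eqP => [->|/eqP p0].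
  exists (fun u => 1 - ln (1 + u) / 2).
    move=> t u t0 u1; have u0 : 0 < 1 + u by lra.
    have su0 : 0 < Num.sqrt (1 + u) by rewrite sqrtr_gt0.
    rewrite lnM ?posrE//.
    have -> : ln (1 + u) = ln (Num.sqrt (1 + u)) *+ 2.
      by rewrite -lnXn// sqr_sqrtr// ltW.
    by rewrite mulr2n; lra.
  have [C C0 H] := expansion2_ln; exists C => // u /H.
  have -> : (maxn 0 1)%:R * (0%:R + 2) / 8 = 4^-1 :> R by rewrite add0r mul1r; lra.
  by have -> : (maxn 0 1)%:R / 2 = 2^-1 :> R by rewrite /= mul1r.
have -> : maxn p 1 = p by apply/maxn_idPl; rewrite lt0n.
exists (fun u => (Num.sqrt (1 + u))^-1 ^+ p); last exact: expansion2_rsqrtX.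
move=> t u t0 u1; have u0 : 0 < 1 + u by lra.
by rewrite exprMn invfM exprVn /newton (negbTE p0); ring.
Qed.

End second_order_expansions.

Section continuity.
Context {R : realType} {T : topologicalType}.
Implicit Types f g : T -> R.

Lemma continuous_addr f g : continuous f -> continuous g ->
  continuous (fun x => f x + g x).
Proof. by move=> cf cg x; apply: cvgD; [exact: cf|exact: cg]. Qed.

Lemma continuous_oppr f : continuous f -> continuous (fun x => - f x).
Proof. by move=> cf x; apply: cvgN; exact: cf. Qed.

Lemma continuous_mulr f g : continuous f -> continuous g ->
  continuous (fun x => f x * g x).
Proof. by move=> cf cg x; apply: cvgM; [exact: cf|exact: cg]. Qed.

End continuity.

(** * A maximum principle by second differences, and harmonicity of the kernel *)

Section maximum_principle.
Context {R : realType} {n : nat}.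
Implicit Types (x z : 'rV[R]_n) (f : 'rV[R]_n -> R).

Local Notation e i := (delta_mx ord0 i : 'rV[R]_n).

Definition second_diff f x (h : R) : R :=
  \sum_(i < n) (f (x + h *: e i) + f (x - h *: e i) - 2 * f x).

Lemma second_diff_sqr x h :
  second_diff (fun x => enorm x ^+ 2) x h = 2 * n%:R * h ^+ 2.
Proof.
rewrite /second_diff (eq_bigr (fun=> 2 * h ^+ 2)) => [|i _].
  by rewrite sumr_const card_ord -[_ *+ n]mulr_natr; ring.
rewrite !sqr_enorm !dotDl !dotDr !dotNl !dotNr !dotZl !dotZr (dotC _ x) dot_delta.
by rewrite -!sqr_enorm enorm_delta; ring.
Qed.

(** A stand-in for a nonnegative Laplacian at [x] that asks for no differentiability: the lower
    limit of [second_diff f x h / h ^+ 2] is nonnegative. *)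
Definition asymp_subharmonic f x := forall eps, 0 < eps ->
  exists2 d, 0 < d & forall h, 0 < h -> h < d -> - eps * h ^+ 2 <= second_diff f x h.

(** Adding [eps * enorm x ^+ 2] makes small second differences strictly positive, which is
    impossible at an interior maximum. Subharmonicity is asked only where [c < f x], so points where
    the bound is known by other means are exempt. *)
Lemma maximum_principle f r c : (0 < n)%N -> continuous f ->
  (forall x, enorm x = r -> f x <= c) ->
  (forall x, enorm x < r -> c < f x -> asymp_subharmonic f x) ->
  forall x, enorm x <= r -> f x <= c.
Proof.
move=> n0 cf fr fs x0 x0r; rewrite leNgt; apply/negP => cfx0.
have r0 : 0 <= r by exact: le_trans (enorm_ge0 x0) x0r.
(* Keeps [eps * r ^+ 2] below [f x0 - c], so that [f] still exceeds [c] where the perturbed function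
   is maximal. *)
pose eps := (f x0 - c) / (2 * (r ^+ 2 + 1)).
have r21 : 0 < 2 * (r ^+ 2 + 1) by rewrite mulr_gt0// ltr_wpDl// sqr_ge0.
have eps0 : 0 < eps by rewrite divr_gt0// subr_gt0.
have epsr : eps * r ^+ 2 < f x0 - c.
  rewrite /eps mulrAC ltr_pdivrMr// ltr_pM2l ?subr_gt0//.
  by have := sqr_ge0 r; lra.
pose g x := f x + eps * enorm x ^+ 2.
have cg : continuous g.
  apply: continuous_addr => //.
  apply: continuous_mulr; first exact: cst_continuous.
  move=> x; apply: (@continuous_comp _ _ _ (@enorm R n) (fun t => t ^+ 2)).
    exact: continuous_enorm.
  exact: exprn_continuous.
have [||x xr gx] := EVT_max_rV (f := g) (A := eball r) _ (@compact_eball _ _ r) _.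
- by exists x0.
- exact: continuous_subspaceT.
rewrite inE /eball/= in xr.
have g0 : f x0 <= g x.
  by rewrite (le_trans _ (gx x0 _)) ?inE// lerDl mulr_ge0 ?exprn_ge0 ?enorm_ge0// ltW.
have cfx : c < f x.
  have : eps * enorm x ^+ 2 <= eps * r ^+ 2.
    by rewrite ler_wpM2l ?lerXn2r ?nnegrE ?enorm_ge0// ltW.
  by rewrite /g in g0; lra.
have xltr : enorm x < r.
  rewrite lt_neqAle xr andbT; apply/eqP => /fr; rewrite leNgt => /negP; exact.
have [d d0 fd] := fs _ xltr cfx _ eps0.
pose h := Num.min (d / 2) ((r - enorm x) / 2).
have h0 : 0 < h by rewrite lt_min !divr_gt0// subr_gt0.
have hd : h < d by rewrite gt_min; apply/orP; left; lra.
have hr : h <= r - enorm x.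
  by rewrite ge_min; apply/orP; right; lra.
have := fd _ h0 hd.
have : second_diff g x h <= 0.
  rewrite /second_diff -oppr_ge0 -sumrN sumr_ge0// => i _; rewrite oppr_ge0.
  have step (s : R) : `|s| = h -> g (x + s *: e i) <= g x.
    move=> sh; apply: gx; rewrite inE/=; rewrite /eball/=.
    by rewrite (le_trans (ler_enormD _ _))// enormZ enorm_delta mulr1 sh; lra.
  have := step h (gtr0_norm h0); have := step (- h); rewrite normrN gtr0_norm// scaleNr.
  by move=> /(_ erefl); lra.
have -> : second_diff g x h = second_diff f x h + eps * (2 * n%:R * h ^+ 2).
  rewrite -(second_diff_sqr x) /second_diff mulr_sumr -big_split/=.
  by apply: eq_bigr => i _; rewrite /g; ring.
have : 0 < eps * h ^+ 2 by rewrite mulr_gt0// exprn_gt0.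
have : 1 <= n%:R :> R by rewrite ler1n.
nra.
Qed.

(** Harmonicity in discrete form. Each shifted norm is [t * Num.sqrt (1 + u)]; after summing over
    the axes the [h ^+ 2] terms are a multiple of [n * a + 4 * b], which vanishes exactly because
    [p = n - 2]. The condition [6 * h <= d] keeps [u] in the range of the expansion. *)
Lemma newton_second_diff (d : R) : (1 < n)%N -> 0 < d ->
  exists2 C, 0 <= C & forall z h, d <= enorm z -> 0 < h -> 6 * h <= d ->
    `|second_diff (fun z => newton (n - 2) (enorm z)) z h| <= C * h ^+ 3.
Proof.
move=> n1 d0; set p := (n - 2)%N.
have [g gE [C C0 gC]] := @newton_expansion R p.
set a := - _ in gC; set b := (_ * _ / 8) in gC.
have b0 : 0 <= b by rewrite divr_ge0// mulr_ge0// addr_ge0.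
(* The first summand absorbs the leftover [h ^+ 4] terms. In the second, 54 is [2 * 3 ^ 3]: two
   signs, and the cube of the bound [3 * h / t] on [u]. *)
exists (newton_amp p d * ((2 * n%:R * b + 54 * n%:R * C) / d ^+ 3)).
  have d3 : 0 <= d ^+ 3 by rewrite exprn_ge0// ltW.
  apply: mulr_ge0; first exact: newton_amp_ge0.
  by apply: divr_ge0 => //; apply: addr_ge0; rewrite !mulr_ge0.
move=> z h dz h0 hd; set t := enorm z in dz *.
have t0 : 0 < t by exact: lt_le_trans dz.
pose u i s : R := (2 * s * z ord0 i + h ^+ 2) / t ^+ 2.
have ub i s : `|s| = h -> `|u i s| <= 3 * h / t.
  move=> sh; rewrite /u normrM (ger0_norm (_ : 0 <= (t ^+ 2)^-1)); last first.
    by rewrite invr_ge0 sqr_ge0.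
  rewrite ler_pdivrMr ?exprn_gt0// expr2 mulrA divfK ?gt_eqF//.
  rewrite (le_trans (ler_normD _ _))// (ger0_norm (sqr_ge0 h)).
  rewrite !normrM sh (ger0_norm (_ : 0 <= 2))//.
  have := coord_le_enorm z i; rewrite -/t => zt.
  have : h ^+ 2 <= h * t by rewrite expr2 ler_wpM2l; lra.
  have : h * `|z ord0 i| <= h * t by rewrite ler_wpM2l//; lra.
  lra.
have u2 i s : `|s| = h -> `|u i s| <= 2^-1.
  move=> /(ub i) /le_trans; apply; rewrite ler_pdivrMr//; lra.
have enE i s : `|s| = h -> enorm (z + s *: e i) = t * Num.sqrt (1 + u i s).
  move=> sh; rewrite enormE dotDl !dotDr !dotZl !dotZr (dotC _ z) dot_delta.
  rewrite -!sqr_enorm enorm_delta -/t.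
  rewrite -(gtr0_norm t0) -[in RHS]sqrtr_sqr -sqrtrM ?sqr_ge0// (gtr0_norm t0).
  have sh2 : s ^+ 2 = h ^+ 2 by rewrite -sh real_normK ?num_real.
  congr Num.sqrt; rewrite /u -sh2.
  by field; rewrite gt_eqF.
have u1 i s : `|s| = h -> -1 < u i s.
  by move=> /(u2 i); rewrite ler_norml => /andP[? _]; lra.
have hN : `|- h| = h by rewrite normrN gtr0_norm.
have hP : `|h| = h by rewrite gtr0_norm.
have -> : second_diff (fun z => newton p (enorm z)) z h =
    newton_amp p t * \sum_(i < n) (g (u i h) - 1 + (g (u i (- h)) - 1)).
  rewrite /second_diff mulr_sumr; apply: eq_bigr => i _.
  by rewrite -scaleNr !enE// !gE ?u1//; ring.
pose q (v : R) := g v - (1 + a * v + b * v ^+ 2).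
have -> : \sum_(i < n) (g (u i h) - 1 + (g (u i (- h)) - 1)) =
    2 * n%:R * b * (h ^+ 4 / t ^+ 4) + \sum_(i < n) (q (u i h) + q (u i (- h))).
  have E1 : \sum_(i < n) (a * (2 * h ^+ 2 / t ^+ 2)
      + b * (8 * h ^+ 2 / t ^+ 4 * z ord0 i ^+ 2 + 2 * h ^+ 4 / t ^+ 4)) =
      2 * n%:R * b * (h ^+ 4 / t ^+ 4).
    rewrite (eq_bigr (fun i => (a * (2 * h ^+ 2 / t ^+ 2) + b * (2 * h ^+ 4 / t ^+ 4))
        + b * (8 * h ^+ 2 / t ^+ 4) * z ord0 i ^+ 2)); last by move=> i _; ring.
    rewrite big_split/= -mulr_sumr sumr_const card_ord -[_ *+ n]mulr_natr.
    have -> : \sum_(i < n) z ord0 i ^+ 2 = t ^+ 2.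
      by rewrite sqr_enorm; apply: eq_bigr => i _; rewrite expr2.
    have -> : n%:R = p%:R + 2 :> R by rewrite /p natrB// subrK.
    rewrite /a /b; move: (maxn p 1)%:R (p%:R : R) => P P'.
    by field; rewrite gt_eqF.
  rewrite -E1 -big_split/=; apply: eq_bigr => i _.
  by rewrite /q /u; field; rewrite gt_eqF.
rewrite normrM ger0_norm ?newton_amp_ge0// -[leRHS]mulrA ler_pM// ?newton_amp_ge0//.
  exact: newton_amp_nincr.
have h3 : h ^+ 3 / t ^+ 3 <= h ^+ 3 / d ^+ 3.
  by rewrite ler_wpM2l ?exprn_ge0 ?(ltW h0)// lef_pV2 ?posrE ?exprn_gt0// lerXn2r// nnegrE ltW.
rewrite [leRHS](_ : _ = 2 * n%:R * b * (h ^+ 3 / d ^+ 3) +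
  54 * n%:R * C * (h ^+ 3 / d ^+ 3)); last by ring.
rewrite (le_trans (ler_normD _ _))// lerD//.
  have c0 : 0 <= 2 * n%:R * b by rewrite !mulr_ge0.
  rewrite normrM (ger0_norm c0) ler_wpM2l//.
  rewrite ger0_norm ?divr_ge0 ?exprn_ge0 ?(ltW h0) ?(ltW t0)//.
  rewrite (le_trans _ h3)// exprSr (exprSr t 3) invfM.
  rewrite (_ : _ * _ = h ^+ 3 / t ^+ 3 * (h / t)); last by ring.
  rewrite ler_piMr ?divr_ge0 ?exprn_ge0 ?(ltW h0) ?(ltW t0)// ler_pdivrMr//; lra.
rewrite (le_trans (ler_norm_sum _ _ _))//.
rewrite (@le_trans _ _ (\sum_(i < n) 2 * C * (3 * h / t) ^+ 3))//.
  apply: ler_sum => i _; rewrite (le_trans (ler_normD _ _))//.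
  have qb s : `|s| = h -> `|q (u i s)| <= C * (3 * h / t) ^+ 3.
    move=> sh; rewrite (le_trans (gC _ (u2 i _ sh)))// ler_wpM2l// lerXn2r ?nnegrE//.
      by rewrite divr_ge0 ?mulr_ge0 ?ltW.
    exact: ub.
  by have := qb _ hN; have := qb _ hP; lra.
rewrite sumr_const card_ord -[_ *+ n]mulr_natr !exprMn exprVn.
have -> : 2 * C * (3 ^+ 3 * h ^+ 3 / t ^+ 3) * n%:R = (54 * n%:R * C) * (h ^+ 3 / t ^+ 3) by ring.
by rewrite ler_wpM2l// !mulr_ge0.
Qed.

End maximum_principle.

(** * Borel structure and the truncated kernel *)

Section borel_row_vectors.
Context {R : realType} {n : nat}.
Local Notation T := (g_sigma_algebraType (@open 'rV[R]_n)).

Definition open_box (q : 'I_n -> R) (e : R) : set 'rV[R]_n :=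
  [set y | forall i, q i - e < y ord0 i < q i + e].

Lemma open_bigcup_box (O : set 'rV[R]_n) : open O ->
  exists D : set ({ffun 'I_n -> rat} * nat),
    O = \bigcup_(qk in D) open_box (fun i => ratr (qk.1 i)) (qk.2.+1%:R^-1).
Proof.
move=> oO.
exists [set qk : {ffun 'I_n -> rat} * nat |
  open_box (fun i => ratr (qk.1 i)) (qk.2.+1%:R^-1) `<=` O].
apply/seteqP; split => [x Ox|x [qk /= H]]; last exact: H.
have /nbhs_ballP[e/= e0 xe] : nbhs x O by exact: open_nbhs_nbhs.
have e2 : 0 < e / 2 by rewrite divr_gt0.
have [k] := near_infty_natSinv_lt (PosNum e2); move=> _ /(_ k (leqnn k))/= ke.
pose d : R := k.+1%:R^-1.
have d0 : 0 < d by rewrite invr_gt0.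
have /all_sig[q qP] (i : 'I_n) : {q : rat | x ord0 i - d < ratr q < x ord0 i + d}.
  apply: cid; have [|q] := @rat_in_itvoo R (x ord0 i - d) (x ord0 i + d).
    by rewrite ltrBlDr -addrA ltrDl addr_gt0.
  by rewrite in_itv/=; exists q.
exists ([ffun i => q i], k) => /=.
  move=> y /= yq; apply: xe; split => //= a i; rewrite (ord1 a).
  have := yq i; rewrite ffunE -/d => /andP[y1 y2].
  have /andP[q1 q2] := qP i.
  by rewrite /ball/= ltr_norml; move: ke; rewrite -/d; lra.
move=> i; rewrite ffunE -/d; have /andP[q1 q2] := qP i.
by apply/andP; split; lra.
Qed.

Lemma open_measurable_rV (O : set T) : open (O : set 'rV[R]_n) -> measurable O.
Proof. by move=> oO; exact: sub_sigma_algebra. Qed.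

Lemma closed_measurable_rV (F : set T) : closed (F : set 'rV[R]_n) -> measurable F.
Proof.
move=> /closed_openC cF; rewrite -(setCK F); apply: measurableC.
exact: open_measurable_rV.
Qed.

Lemma compact_measurable_rV (F : set T) : compact (F : set 'rV[R]_n) -> measurable F.
Proof.
move=> cF; apply: closed_measurable_rV.
by apply: compact_closed => //; exact: norm_hausdorff.
Qed.

Lemma continuous_measurable_rV (f : T -> R) : continuous (f : 'rV[R]_n -> R) ->
  measurable_fun setT f.
Proof.
move=> /continuousP cf; apply: (measurability _ (RGenOpens.measurableE R)).
move=> _ [_ [a [b ->] <-]]; rewrite setTI; apply: open_measurable_rV.
exact/cf/interval_open.
Qed.

Lemma measurable_coord (i : 'I_n) : measurable_fun setT (fun x : T => (x : 'rV[R]_n) ord0 i).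
Proof. by apply: continuous_measurable_rV; exact: coord_continuous. Qed.

(** The coordinates generate the Borel structure because an open set is a countable union of boxes
    with rational data. *)
Lemma measurable_rVP d (X : measurableType d) (f : X -> T) :
  (forall i, measurable_fun setT (fun x => (f x : 'rV[R]_n) ord0 i)) ->
  measurable_fun setT f.
Proof.
move=> mf; apply: (@measurability _ _ X T setT f (@open 'rV[R]_n)) => //.
move=> _ [U oU <-]; rewrite setTI.
have [D ->] := open_bigcup_box oU.
rewrite preimage_bigcup bigcup_mkcond.
apply: countable_bigcupT_measurable => // qk.
case: ifPn => // _.
rewrite (_ : _ @^-1` _ = \bigcap_(i in [set: 'I_n])
    ((fun x => (f x : 'rV[R]_n) ord0 i) @^-1`
      `]ratr (qk.1 i) - qk.2.+1%:R^-1, ratr (qk.1 i) + qk.2.+1%:R^-1[%classic)); last first.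
  apply/seteqP; split => [x /= H i _|x H i]; first by rewrite /= in_itv/=; exact: H.
  by have := H i I; rewrite /= in_itv.
apply: fin_bigcap_measurable; first exact: finite_finset.
by move=> i _; rewrite -[X in measurable X]setTI; apply: mf => //; exact: measurable_itv.
Qed.

Lemma measurable_enorm_comp d (X : measurableType d) (f : X -> 'rV[R]_n) :
  (forall i, measurable_fun setT (fun x => f x ord0 i)) ->
  measurable_fun setT (fun x => enorm (f x)).
Proof.
move=> mf; rewrite /enorm.
apply: (measurableT_comp (f := @Num.sqrt R)).
  by apply: continuous_measurable_fun; exact: sqrt_continuous.
by apply: measurable_sum => i; exact: measurable_funX.
Qed.

Lemma measurable_enorm : measurable_fun setT (fun x : T => enorm (x : 'rV[R]_n)).
Proof. by apply: measurable_enorm_comp => i; exact: measurable_coord. Qed.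

Lemma measurable_dist (x : 'rV[R]_n) :
  measurable_fun setT (fun y : T => enorm (x - (y : 'rV[R]_n))).
Proof. by apply: continuous_measurable_rV; exact: continuous_enormB. Qed.

Lemma measurable_dist2 :
  measurable_fun setT (fun z : T * T => enorm ((z.1 : 'rV[R]_n) - (z.2 : 'rV[R]_n))).
Proof.
apply: measurable_enorm_comp => i.
rewrite (_ : (fun _ => _) = (fun z : T * T => (z.1 : 'rV[R]_n) ord0 i - (z.2 : 'rV[R]_n) ord0 i)); last first.
  by apply/funext => z; rewrite !mxE.
apply: measurable_funB.
  exact: (measurableT_comp (measurable_coord i) measurable_fst).
exact: (measurableT_comp (measurable_coord i) measurable_snd).
Qed.

End borel_row_vectors.

Section clamped_kernel.
Context {R : realType}.
Variables (p : nat) (D : R).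
Hypothesis D0 : 0 < D.
Implicit Types (s t : R) (i j : nat).

(** The ratio 3 is 1 + 2: moving a center by at most two radii at most triples every distance not
    below one radius, and one step of the sequence compensates for the tripling. *)
Definition radius j : R := D / 3 ^+ j.

Lemma radius_gt0 j : 0 < radius j.
Proof. by rewrite divr_gt0// exprn_gt0. Qed.

Lemma radius_le j : radius j <= D.
Proof. by rewrite ler_pdivrMr ?exprn_gt0// ler_peMr ?(ltW D0)// exprn_ege1// ler1n. Qed.

Lemma radiusS j : radius j.+1 = radius j / 3.
Proof. by rewrite /radius exprSr invfM mulrA. Qed.

Lemma radius_nincr i j : (i <= j)%N -> radius j <= radius i.
Proof.
move=> ij; rewrite ler_wpM2l ?(ltW D0)// lef_pV2 ?posrE ?exprn_gt0//.
by rewrite ler_weXn2l// ler1n.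
Qed.

Lemma radius_cvg d : 0 < d -> exists N, forall j, (N <= j)%N -> radius j <= d.
Proof.
move=> d0; have dD : 0 < d / D by rewrite divr_gt0.
have [N] := near_infty_natSinv_lt (PosNum dD); move=> _ /(_ N (leqnn N))/= Nd.
exists N => j Nj; rewrite (le_trans (radius_nincr Nj))// /radius mulrC.
rewrite -ler_pdivlMr// (le_trans _ (ltW Nd))//.
rewrite lef_pV2 ?posrE ?exprn_gt0// -natrX ler_nat.
exact: ltn_expl.
Qed.

Definition clamp j t := Num.min D (Num.max t (radius j)).

Lemma clamp_ge j t : radius j <= clamp j t.
Proof. by rewrite le_min radius_le le_max lexx orbT. Qed.

Lemma clamp_gt0 j t : 0 < clamp j t.
Proof. exact: lt_le_trans (radius_gt0 j) (clamp_ge j t). Qed.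

Lemma clamp_le j t : clamp j t <= D.
Proof. by rewrite ge_min lexx. Qed.

Lemma clamp_nd j s t : s <= t -> clamp j s <= clamp j t.
Proof. by move=> st; rewrite le_min2// le_max2. Qed.

Definition kapt j t := newton p (clamp j t) - newton p D.

(** Capping the distance at [D] makes the kernel nonnegative on the whole space, so Tonelli applies
    freely; on sets of diameter at most [D] the cap is inactive. The value for [t <= 0] is set by
    hand, since [ln 0] and [0^-1] are 0 in [R]. *)
Definition kap t : \bar R :=
  if t <= 0 then +oo%E else (newton p (Num.min D t) - newton p D)%:E.

Lemma kapt_ge0 j t : 0 <= kapt j t.
Proof. by rewrite subr_ge0 newton_nincr ?clamp_gt0// clamp_le. Qed.

Lemma kapt_nincr j s t : s <= t -> kapt j t <= kapt j s.
Proof. by move=> st; rewrite lerB// newton_nincr ?clamp_gt0// clamp_nd. Qed.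

Lemma kapt_nd i j t : (i <= j)%N -> kapt i t <= kapt j t.
Proof.
move=> ij; rewrite lerB// newton_nincr ?clamp_gt0// le_min2// le_max2//.
exact: radius_nincr.
Qed.

Lemma kaptE j t : radius j <= t -> t <= D -> kapt j t = newton p t - newton p D.
Proof. by move=> jt tD; rewrite /kapt /clamp (max_idPl jt) (min_idPr tD). Qed.

Lemma kapE t : 0 < t -> t <= D -> kap t = (newton p t - newton p D)%:E.
Proof. by move=> t0 tD; rewrite /kap leNgt t0/= (min_idPr tD). Qed.

Lemma kap_kapt j t : radius j <= t -> kap t = (kapt j t)%:E.
Proof.
move=> jt; have t0 := lt_le_trans (radius_gt0 j) jt.
by rewrite /kap leNgt t0/= /kapt /clamp (max_idPl jt).
Qed.

Lemma kap_ge0 t : (0 <= kap t)%E.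
Proof.
rewrite /kap; case: ifPn => //; rewrite -ltNge => t0.
by rewrite lee_fin subr_ge0 newton_nincr ?ge_min ?lexx// lt_min D0.
Qed.

Lemma kapt_le_kap j t : ((kapt j t)%:E <= kap t)%E.
Proof.
rewrite /kap; case: ifPn => [_|]; first exact: leey.
rewrite -ltNge => t0; rewrite lee_fin lerB// newton_nincr ?lt_min ?D0//.
by rewrite le_min2// le_max lexx.
Qed.

Lemma kap_nincr s t : s <= t -> (kap t <= kap s)%E.
Proof.
move=> st; rewrite {2}/kap; case: ifPn => [_|]; first exact: leey.
rewrite -ltNge => s0; have t0 := lt_le_trans s0 st.
rewrite /kap [t <= 0]leNgt t0/= lee_fin lerB// newton_nincr ?lt_min ?D0//.
by rewrite le_min2.
Qed.

Lemma kapt_lipschitz j s t :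
  `|kapt j s - kapt j t| <= newton_lip p (radius j) * `|s - t|.
Proof.
wlog st : s t / s <= t.
  move=> H; have [/H//|/ltW/H] := leP s t.
  by rewrite distrC [X in _ <= _ * X]distrC.
rewrite ger0_norm ?subr_ge0 ?kapt_nincr// distrC ger0_norm ?subr_ge0//.
rewrite /kapt opprB addrA subrK.
rewrite (le_trans (newton_lipschitz p (radius_gt0 j) (clamp_ge j s) (clamp_nd j st)))//.
rewrite ler_wpM2l ?newton_lip_ge0 ?radius_gt0//.
rewrite /clamp; set r := radius j.
have [] := leP s r; have [] := leP t r; have [] := leP D r; have [] := leP D s; have [] := leP D t; lra.
Qed.

Lemma kapt_cvg t : (kapt j t)%:E @[j --> \oo] --> kap t.
Proof.
have [t0|t0] := leP t 0.
  rewrite /kap t0; apply/cvgeyPge => A.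
  have [d d0 dA] := newton_unbounded p (A + newton p D).
  have [N dN] := radius_cvg d0.
  exists N => // j /= Nj; rewrite lee_fin lerBrDr.
  have -> : clamp j t = radius j.
    by rewrite /clamp (max_idPr (le_trans t0 (ltW (radius_gt0 j)))) (min_idPr (radius_le j)).
  by apply: dA; [exact: radius_gt0|exact: dN].
have [N dN] := radius_cvg t0.
apply: cvg_near_cst; exists N => // j /= Nj; apply/eqP.
by rewrite -(kap_kapt (dN _ Nj)).
Qed.

Lemma continuous_kapt j : continuous (kapt j).
Proof.
move=> t; apply/cvgrPdist_lt => e e0.
set L := newton_lip p (radius j).
have L0 : 0 <= L by rewrite newton_lip_ge0 ?radius_gt0.
near=> s; rewrite (le_lt_trans (kapt_lipschitz _ _ _))// -/L.
rewrite (@le_lt_trans _ _ ((L + 1) * `|t - s|))//.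
  by rewrite ler_wpM2r// lerDl.
rewrite mulrC -ltr_pdivlMr; last by rewrite ltr_wpDl.
near: s; apply: cvgr_dist_lt; last by rewrite divr_gt0// ltr_wpDl.
exact: cvg_id.
Unshelve. all: by end_near. Qed.

Lemma measurable_kapt j : measurable_fun setT (kapt j).
Proof. by apply: continuous_measurable_fun; exact: continuous_kapt. Qed.

Lemma measurable_kap : measurable_fun setT kap.
Proof.
apply: (@emeasurable_fun_cvg _ _ _ _ (fun j t => (kapt j t)%:E)) => //.
  by move=> j; apply/measurable_EFinP; exact: measurable_kapt.
by move=> t _; exact: kapt_cvg.
Qed.

(* By homogeneity of the kernel; it transfers uniform convergence of truncated
   potentials on a set to its neighborhood. *)
Lemma kapt_scale i j t t' : (j <= i)%N -> t' <= 3 * Num.max t (radius i.+1) ->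
  kapt i.+1 t - kapt j.+1 t <= 3 ^+ p * (kapt i t' - kapt j t').
Proof.
move=> ji tt'.
have [tj|tj] := leP (radius j.+1) t.
  have -> : kapt i.+1 t - kapt j.+1 t = 0.
    have it : radius i.+1 <= t by rewrite (le_trans _ tj)// radius_nincr.
    by apply/eqP; rewrite subr_eq0 -eqe -!kap_kapt.
  by rewrite mulr_ge0 ?exprn_ge0// subr_ge0 kapt_nd.
pose c i := Num.max t' (radius i).
have c0 i' : 0 < c i' by rewrite lt_max radius_gt0 orbT.
rewrite (@le_trans _ _ (newton p (c i / 3) - newton p (c j / 3)))//; last first.
  rewrite newton_scale// ler_wpM2l ?exprn_ge0//.
  rewrite /kapt opprB addrA subrK /clamp.
  have [t'D|t'D] := leP t' D.
    by rewrite !(min_idPr _)// ge_max t'D radius_le.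
  have cE k : Num.max t' (radius k) = t'.
    by apply/max_idPl; rewrite (le_trans (radius_le _))// ltW.
  by rewrite /c !cE !subrr.
rewrite /kapt opprB addrA subrK /clamp.
rewrite (max_idPr (ltW tj)) (min_idPr (radius_le _)).
have m : Num.max t (radius i.+1) <= radius j.+1.
  by rewrite ge_max (ltW tj) radius_nincr.
rewrite (min_idPr (le_trans m (radius_le _))).
rewrite lerB//.
  apply: newton_nincr; first by rewrite divr_gt0.
  rewrite ler_pdivrMr// mulrC ge_max tt'/=.
  have : radius i.+1 <= Num.max t (radius i.+1) by rewrite le_max lexx orbT.
  by rewrite radiusS; lra.
rewrite newton_nincr ?radius_gt0// radiusS ler_wpM2r ?invr_ge0//.
by rewrite /c le_max lexx orbT.
Qed.

End clamped_kernel.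

(** * Mutual energies and minimizers *)

Section integration.
Local Open Scope ereal_scope.
Context d (T : measurableType d) (R : realType).
Implicit Types (m : {measure set T -> \bar R}) (mu la : probability T R).

Lemma ge0_integral_mrestr m (A : set T) (mA : measurable A) (f : T -> \bar R) :
  measurable_fun setT f -> (forall x, 0 <= f x) ->
  \int[mrestr m mA]_x f x = \int[m]_(x in A) f x.
Proof.
move=> mf f0.
rewrite -(setUv A) ge0_integral_setU//=; [|exact: measurableC|exact: measurable_funTS|]; last first.
  by rewrite disj_set2E setICr.
rewrite (eq_measure_integral m)/=; last first.
  by move=> B mB BA; rewrite /mrestr setIidl.
rewrite [X in _ + X = _](_ : _ = 0) ?adde0//.
rewrite (eq_measure_integral mzero) ?integral_measure_zero//= => B mB BA.
rewrite /mrestr /mzero (_ : B `&` A = set0) ?measure0//.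
by apply/disjoints_subset.
Qed.

Lemma ge0_integral_mnormalize m mu (f : T -> \bar R) :
  0 < m setT -> m setT < +oo ->
  measurable_fun setT f -> (forall x, 0 <= f x) ->
  \int[mnormalize m mu]_x f x = ((fine (m setT))^-1)%:E * \int[m]_x f x.
Proof.
move=> m0 moo mf f0.
have c0 : (0 <= (fine (m setT))^-1)%R by rewrite invr_ge0 fine_ge0.
rewrite -(ge0_integral_mscale m measurableT (NngNum c0))//.
apply: eq_measure_integral => A mA _.
by rewrite /= /mnormalize/= gt_eqF// lt_eqF//= /mscale/= muleC.
Qed.

Lemma prob_full_setC mu (A : set T) : measurable A -> mu A = 1 -> mu (~` A) = 0.
Proof. by move=> mA A1; rewrite probability_setC// A1 subee. Qed.

Lemma prob_full_ae mu (A : set T) : measurable A -> mu A = 1 -> {ae mu, forall x, A x}.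
Proof.
by move=> mA A1; exists (~` A); split => //; [exact: measurableC|exact: prob_full_setC].
Qed.

Lemma ae_prob_full mu (A : set T) : measurable A -> {ae mu, forall x, A x} -> mu A = 1.
Proof.
move=> mA [N [mN N0 AN]].
have : mu (~` A) = 0 by apply: subset_measure0 N0 => //; exact: measurableC.
rewrite probability_setC// => /eqP; rewrite sube_eq ?fin_num_measure//.
by rewrite add0e => /eqP.
Qed.

Lemma integral_prob_full mu (A : set T) (f : T -> \bar R) :
  measurable A -> mu A = 1 -> measurable_fun setT f ->
  \int[mu]_(x in A) f x = \int[mu]_x f x.
Proof.
move=> mA A1 mf; have A0 := prob_full_setC mA A1.
have aux (g : T -> \bar R) : measurable_fun setT g -> (forall x, 0 <= g x) ->
    \int[mu]_(x in A) g x = \int[mu]_x g x.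
  move=> mg g0; rewrite [RHS](ge0_negligible_integral (N := ~` A))//.
    by rewrite setTD setCK.
  exact: measurableC.
by rewrite integralE [RHS]integralE !aux//; [exact: measurable_funeneg|exact: measurable_funepos].
Qed.

Lemma prob_integral_cst mu (c : \bar R) : \int[mu]_x c = c.
Proof.
by have := integral_cst mu measurableT c; rewrite [X in _ * X]probability_setT mule1.
Qed.

Lemma prob_integrable_cst mu (c : R) : mu.-integrable setT (fun=> c%:E).
Proof.
apply/integrableP; split => //.
by rewrite (eq_integral (fun=> `|c|%:E))// prob_integral_cst ltry.
Qed.

(** An infinite integral of [g] is allowed: the negative part of the sum is bounded by the absolute
    value of [c], so no indeterminate difference appears. This converts between the shifted kernel
    and the Riesz kernel. *)
Lemma ge0_prob_integralD_cst mu (g : T -> \bar R) (c : R) :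
  measurable_fun setT g -> (forall x, 0 <= g x) ->
  \int[mu]_x (g x + c%:E) = \int[mu]_x g x + c%:E.
Proof.
move=> mg g0; have ig0 : 0 <= \int[mu]_x g x by exact: integral_ge0.
have [goo|] := eqVneq (\int[mu]_x g x) +oo; last first.
  rewrite -ltey => goo; rewrite integralD//; last exact: prob_integrable_cst.
    by rewrite prob_integral_cst.
  by apply/integrableP; split => //; under eq_integral do rewrite gee0_abs//.
rewrite goo addye//; set h := fun x => _.
have mh : measurable_fun setT h by exact: emeasurable_funD.
have hn x : h^\- x <= `|c|%:E.
  rewrite funenegE ge_max lee_fin normr_ge0 andbT /h.
  rewrite leeNl (@le_trans _ _ (0 + c%:E))//; last exact: leeD2r.
  by rewrite add0e -EFinN lee_fin lerNl ler_normr lexx orbT.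
have ihn : \int[mu]_x h^\- x <= `|c|%:E.
  rewrite -[leRHS](prob_integral_cst mu); apply: ge0_le_integral => //.
  exact: measurable_funeneg.
have ihp : \int[mu]_x h^\+ x = +oo.
  have : \int[mu]_x g x <= \int[mu]_x (h^\+ x + `|c|%:E).
    apply: ge0_le_integral => //.
      by apply: emeasurable_funD => //; exact: measurable_funepos.
    move=> x _; rewrite funeposE /h.
    have -> : g x = g x + c%:E - c%:E by rewrite addeK.
    rewrite leeD//; first by rewrite addeK// le_max lexx.
    by rewrite -EFinN lee_fin ler_normr lexx orbT.
  rewrite goo leye_eq ge0_integralD//; last exact: measurable_funepos.
  rewrite prob_integral_cst => /eqP.
  by case: (\int[mu]_x h^\+ x).
rewrite integralE ihp addye//.
by rewrite -ltNye lteNr; exact: le_lt_trans ihn (ltry _).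
Qed.

(** The device behind the equality cases below: an almost everywhere nonnegative integrable
    difference with nonpositive integral vanishes almost everywhere. *)
Lemma ae_eq_of_le m (D : set T) (f g : T -> \bar R) : measurable D ->
  m.-integrable D f -> m.-integrable D g ->
  {ae m, forall x, D x -> f x <= g x} ->
  \int[m]_(x in D) g x <= \int[m]_(x in D) f x ->
  {ae m, forall x, D x -> f x = g x}.
Proof.
move=> mD fi gi fg gf.
have mf := measurable_int _ fi; have mg := measurable_int _ gi.
have mh : measurable_fun D (g \- f) by exact: emeasurable_funB.
have h0 : \int[m]_(x in D) `|(g \- f) x| = 0.
  apply/eqP; rewrite eq_le integral_ge0// andbT.
  rewrite (_ : \int[m]_(x in D) _ = \int[m]_(x in D) (g \- f) x).
    by rewrite integralB// leeBlDr ?add0e//; exact: integrable_fin_num.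
  apply: ae_eq_integral => //; first exact: measurableT_comp.
  have := integrable_ae mD fi; apply: filterS2 fg => x + + Dx => /(_ Dx) H /(_ Dx) fx.
  by rewrite gee0_abs// sube_ge0// fx.
have := integrable_ae mD fi; have /ae_eq_integral_abs := h0 => /(_ mD mh).
apply: filterS2 => x + + Dx => /(_ Dx)/= H /(_ Dx) fx.
by rewrite -(subeK (g x) fx) H add0e.
Qed.

(** With weights 1 and [c] before normalization, the energy of the mixture is a quadratic polynomial
    in [c] divided by [(1 + c) ^+ 2]. *)
Lemma mixture_ex mu la (c : R) : (0 <= c)%R -> exists rho : probability T R,
  (forall A, rho A = (mu A + c%:E * la A) * ((1 + c)^-1)%:E) /\
  (forall f : T -> \bar R, measurable_fun setT f -> (forall x, 0 <= f x) ->
    \int[rho]_x f x = ((1 + c)^-1)%:E * (\int[mu]_x f x + c%:E * \int[la]_x f x)).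
Proof.
move=> c0; have c1 : (0 < 1 + c)%R by rewrite ltr_pwDl.
pose cla : {measure set T -> \bar R} := mscale (NngNum c0) la.
pose m : {measure set T -> \bar R} := measure_add mu cla.
have mE A : m A = mu A + c%:E * la A by exact: measure_addE.
have mT : m setT = (1 + c)%:E by rewrite mE !probability_setT mule1.
exists (mnormalize m mu); split => [A|f mf f0].
  by rewrite /= /mnormalize mT gt_eqF ?lte_fin// lt_eqF ?ltry//= mE.
rewrite ge0_integral_mnormalize ?mT ?lte_fin ?ltry//=.
by rewrite ge0_integral_measure_add// ge0_integral_mscale.
Qed.

Lemma conditional_ex mu (A : set T) : measurable A -> 0 < mu A ->
  exists la : probability T R,
  (forall B, la B = mu (B `&` A) * ((fine (mu A))^-1)%:E) /\
  (forall f : T -> \bar R, measurable_fun setT f -> (forall x, 0 <= f x) ->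
    \int[la]_x f x = ((fine (mu A))^-1)%:E * \int[mu]_(x in A) f x).
Proof.
move=> mA A0; pose m : {measure set T -> \bar R} := mrestr mu mA.
have mE B : m B = mu (B `&` A) by [].
have mT : m setT = mu A by rewrite mE setTI.
have Aoo : mu A < +oo by rewrite (le_lt_trans (probability_le1 mu mA))// ltry.
exists (mnormalize m mu); split => [B|f mf f0].
  by rewrite /= /mnormalize mT gt_eqF// lt_eqF//= mE.
by rewrite ge0_integral_mnormalize ?mT// ge0_integral_mrestr.
Qed.

Lemma prob_full_sub mu (A B : set T) : measurable A -> measurable B ->
  A `<=` B -> mu A = 1 -> mu B = 1.
Proof.
move=> mA mB AB A1; apply/eqP; rewrite eq_le probability_le1//= -A1.
by rewrite le_measure ?inE.
Qed.

Lemma prob_full_setIr mu (A K : set T) : measurable A -> measurable K -> mu K = 1 ->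
  mu (K `&` A) = mu A.
Proof.
move=> mA mK K1; rewrite -[in RHS](setIT A) -(setUv K) setIUr setIC.
rewrite measureU0//; [exact: measurableI|by apply: measurableI => //; exact: measurableC|].
apply: subset_measure0 (prob_full_setC mK K1) => //.
- by apply: measurableI => //; exact: measurableC.
- exact: measurableC.
Qed.

End integration.

Section energies.
Local Open Scope ereal_scope.
Context {R : realType} {n : nat}.
Local Notation T := (g_sigma_algebraType (@open 'rV[R]_n)).
Variables (p : nat) (D : R).
Hypothesis D0 : (0 < D)%R.
Implicit Types (m l : {sigma_finite_measure set T -> \bar R}) (mu la : borel_probability R n).

Definition pot (m : {measure set T -> \bar R}) (x : 'rV[R]_n) : \bar R :=
  \int[m]_y kap p D (enorm (x - (y : 'rV[R]_n))).

Definition mutual (m l : {measure set T -> \bar R}) : \bar R := \int[l]_x pot m x.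

Lemma measurable_kap_dist x :
  measurable_fun setT (fun y : T => kap p D (enorm (x - (y : 'rV[R]_n)))).
Proof. exact: (measurableT_comp (measurable_kap p D0) (measurable_dist x)). Qed.

Lemma measurable_kap_dist2 : measurable_fun setT
  (fun z : T * T => kap p D (enorm ((z.1 : 'rV[R]_n) - (z.2 : 'rV[R]_n)))).
Proof. exact: (measurableT_comp (measurable_kap p D0) measurable_dist2). Qed.

Lemma pot_ge0 m x : 0 <= pot m x.
Proof. by apply: integral_ge0 => y _; exact: kap_ge0. Qed.

Lemma measurable_pot m : measurable_fun setT (pot m : T -> \bar R).
Proof.
apply: (@measurable_fun_fubini_tonelli_F _ _ T T R m _ measurable_kap_dist2).
by move=> z; exact: kap_ge0.
Qed.

Lemma mutual_ge0 m l : 0 <= mutual m l.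
Proof. by apply: integral_ge0 => y _; exact: pot_ge0. Qed.

Lemma mutualC m l : mutual m l = mutual l m.
Proof.
rewrite /mutual /pot.
rewrite (@fubini_tonelli _ _ T T R l m _ measurable_kap_dist2).
  by apply: eq_integral => x _; apply: eq_integral => y _; rewrite enormB.
by move=> z; exact: kap_ge0.
Qed.

End energies.

Section minimizers.
Local Open Scope ereal_scope.
Context {R : realType} {n : nat}.
Local Notation T := (g_sigma_algebraType (@open 'rV[R]_n)).
Variables (p : nat) (D : R).
Hypothesis D0 : (0 < D)%R.
Implicit Types (mu la : borel_probability R n) (K : set 'rV[R]_n).

Local Notation mutual := (mutual p D).
Local Notation pot := (pot p D).

Definition minimizer K mu := mu K = 1 /\
  forall rho : borel_probability R n, rho K = 1 -> mutual mu mu <= mutual rho rho.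

Lemma fin_num_mutual mu la : mutual mu la < +oo -> mutual mu la \is a fin_num.
Proof. by move=> ?; rewrite ge0_fin_numE// mutual_ge0. Qed.

(* The derivative of the energy at [mu] along the segment to [la] is
   nonnegative. *)
Lemma minimizer_mutual_ge K mu la : minimizer K mu ->
  la K = 1 -> mutual la la < +oo -> mutual mu mu < +oo ->
  mutual mu mu <= mutual mu la.
Proof.
move=> [muK muP] laK laoo muoo.
have [->|] := eqVneq (mutual mu la) +oo; first exact: leey.
rewrite -ltey => mloo.
set a := fine (mutual mu mu); set b := fine (mutual mu la).
set I := fine (mutual la la).
have aE : mutual mu mu = a%:E by rewrite fineK// fin_num_mutual.
have bE : mutual mu la = b%:E by rewrite fineK// fin_num_mutual.
have b'E : mutual la mu = b%:E by rewrite mutualC// bE.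
have IE : mutual la la = I%:E by rewrite fineK// fin_num_mutual.
have mp mm : measurable_fun setT (pot (mm : borel_probability R n) : T -> \bar R).
  exact: measurable_pot.
have p0 (mm : borel_probability R n) x : 0 <= pot mm x by exact: pot_ge0.
have key (c : R) : (0 <= c -> a * (1 + c) ^+ 2 <= a + 2 * c * b + c ^+ 2 * I)%R.
  move=> c0; have c1 : (0 < 1 + c)%R by rewrite ltr_pwDl.
  have [rho [rhoE rhoI]] := mixture_ex mu la c0.
  have rhoK : rho K = 1.
    by rewrite rhoE muK laK mule1 -EFinD -EFinM divff// gt_eqF.
  have := muP _ rhoK.
  have potE x : pot rho x = ((1 + c)^-1)%:E * (pot mu x + c%:E * pot la x).
    rewrite /pot rhoI//; first exact: measurable_kap_dist.
    by move=> y; exact: kap_ge0.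
  have k0 : (0 <= (1 + c)^-1)%R by rewrite invr_ge0 ltW.
  have intE (m : borel_probability R n) : \int[m]_x pot rho x =
      ((1 + c)^-1)%:E * (mutual mu m + c%:E * mutual la m).
    rewrite (eq_integral (fun x : T => ((1 + c)^-1)%:E * (pot mu x + c%:E * pot la x))); last first.
      by move=> x _; exact: potE.
    rewrite ge0_integralZl_EFin//; last 2 first.
    - by move=> x _; rewrite adde_ge0 ?mule_ge0 ?p0.
    - by apply: emeasurable_funD => //; exact: measurable_funeM.
    rewrite ge0_integralD//; last 2 first.
    - by move=> x _; rewrite mule_ge0 ?p0.
    - exact: measurable_funeM.
    by rewrite ge0_integralZl_EFin.
  rewrite {2}/mutual rhoI//.
  rewrite !intE aE bE b'E IE -!(EFinM, EFinD) lee_fin.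
  rewrite mulrCA -mulrDr mulrA -invfM -expr2 mulrC ler_pdivlMr ?exprn_gt0//.
  by move=> /le_trans; apply; rewrite le_eqVlt; apply/orP; left; apply/eqP; ring.
rewrite aE bE lee_fin leNgt; apply/negP => ba.
have ba0 : (0 < a - b)%R by rewrite subr_gt0.
(* For [c > 0], [key] says [2 * (a - b) <= c * (I - a)]; this [c] makes the right-hand side at most
   [a - b], a contradiction. *)
pose c := ((a - b) / (`|I - a| + 1))%R.
have I0 : (0 < `|I - a| + 1)%R by rewrite ltr_wpDl.
have c0 : (0 < c)%R by rewrite divr_gt0.
have := key _ (ltW c0).
have : (c * (I - a) <= a - b)%R.
  rewrite /c mulrAC ler_pdivrMr// ler_wpM2l// ?(ltW ba0)//.
  by rewrite (le_trans (ler_norm _))// lerDl.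
nra.
Qed.

(** If the potential were below the energy on a set [A] of positive mass, [mu] conditioned on [A]
    would violate the variational inequality; it has finite energy because its density with respect
    to [mu] is bounded. So the potential is at least the energy almost everywhere, and its mean is
    the energy. *)
Lemma minimizer_pot_ae K mu : measurable (K : set T) -> minimizer K mu ->
  mutual mu mu < +oo -> {ae mu, forall x, setT x -> pot mu x = mutual mu mu}.
Proof.
move=> mK muP muoo; have [muK _] := muP.
set V := fine (mutual mu mu).
have VE : mutual mu mu = V%:E by rewrite fineK// fin_num_mutual.
have mp mm : measurable_fun setT (pot (mm : borel_probability R n) : T -> \bar R).
  exact: measurable_pot.
have p0 (mm : borel_probability R n) x : 0 <= pot mm x by exact: pot_ge0.
have ip : mu.-integrable setT (pot mu : T -> \bar R).
  apply/integrableP; split => //.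
  under eq_integral do rewrite gee0_abs//.
  exact: muoo.
pose A : set T := [set x | pot mu x < V%:E].
have mA : measurable A.
  by rewrite -[A]setTI; apply: emeasurable_fun_infty_o.
have A0 : mu A = 0.
  apply/eqP; rewrite -[_ == _]negbK; apply/negP => An0.
  have Agt0 : 0 < mu A by rewrite lt0e An0/=.
  have Aoo : mu A < +oo by rewrite (le_lt_trans (probability_le1 mu mA))// ltry.
  have r0 : (0 < fine (mu A))%R by rewrite fine_gt0// Agt0.
  have r0' : (0 <= (fine (mu A))^-1)%R by rewrite invr_ge0 ltW.
  have AE : mu A = (fine (mu A))%:E by rewrite fineK// ge0_fin_numE.
  have [la [laE laI]] := conditional_ex mA Agt0.
  have laK : la K = 1.
    by rewrite laE prob_full_setIr// AE -EFinM divff// gt_eqF.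
  have potle x : pot la x <= ((fine (mu A))^-1)%:E * pot mu x.
    rewrite /pot laI//; last 2 first.
    - exact: measurable_kap_dist.
    - by move=> y; exact: kap_ge0.
    rewrite lee_wpmul2l// ge0_subset_integral//; first exact: measurable_kap_dist.
    by move=> y _; exact: kap_ge0.
  have lamu : mutual mu la <= ((fine (mu A))^-1)%:E * mutual mu mu.
    by rewrite {1}/mutual laI// lee_wpmul2l// ge0_subset_integral.
  have laoo : mutual la la < +oo.
    rewrite (@le_lt_trans _ _ (((fine (mu A))^-1)%:E * mutual mu la))//.
      rewrite /mutual -ge0_integralZl_EFin//; apply: ge0_le_integral => //.
      exact: measurable_funeM.
    rewrite (@le_lt_trans _ _ (((fine (mu A))^-1)%:E * (((fine (mu A))^-1)%:E * mutual mu mu)))//.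
      by rewrite lee_wpmul2l.
    by rewrite VE -!EFinM ltry.
  have := minimizer_mutual_ge muP laK laoo muoo.
  rewrite {2}/mutual laI// VE -lee_pdivrMl ?invr_gt0// invrK muleC -AE => Vint.
  have := @ae_eq_of_le _ _ _ mu A (pot mu) (fun=> V%:E) mA _ _ _ _.
  have iA : mu.-integrable A (pot mu : T -> \bar R) by exact: integrableS ip.
  have iV : mu.-integrable A (fun=> V%:E : \bar R).
    by apply: integrableS (prob_integrable_cst mu V).
  move=> /(_ iA iV); case.
  - by apply: aeW => x /= /ltW.
  - by rewrite integral_cst.
  move=> N [mN N0 AN].
  have : A `<=` N by move=> x Ax; apply: AN => /= /(_ Ax) xV; move: Ax; rewrite /A/= xV ltxx.
  move=> AsN; have : mu A <= 0 by rewrite -N0 le_measure ?inE.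
  by rewrite leNgt Agt0.
suff : {ae mu, forall x, setT x -> V%:E = pot mu x}.
  case=> N [mN N0 NH]; exists N; split => //; apply: subset_trans NH => x /=.
  by apply: contra_not => /(_ Logic.I) <- _; rewrite VE.
apply: ae_eq_of_le => //; first exact: prob_integrable_cst.
  exists A; split => // x /=; rewrite /A/=; apply: contra_notP => /negP.
  by rewrite -leNgt => ? _.
by rewrite prob_integral_cst -VE.
Qed.

End minimizers.

(** * Positive definiteness and uniqueness *)

Section gaussian_mixture.
Context {R : realType}.
Local Notation leb := (@lebesgue_measure R).
Implicit Types (p : nat) (s t : R).

Definition gauss_moment p s : \bar R :=
  (\int[leb]_(a in `[0%R, +oo[) (a ^+ p.+1 * expR (- (a * s) ^+ 2))%:E)%E.

Lemma gauss_moment_ge0 p s : (0 <= gauss_moment p s)%E.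
Proof.
apply: integral_ge0 => a /=; rewrite in_itv/= andbT => a0.
by rewrite lee_fin mulr_ge0 ?expR_ge0// exprn_ge0.
Qed.

Lemma continuous_gauss_moment_fun p s :
  continuous (fun a : R => a ^+ p.+1 * expR (- (a * s) ^+ 2)).
Proof.
move=> a; apply: cvgM; first exact: exprn_continuous.
apply: (@cvg_comp _ _ _ (fun a : R => - (a * s) ^+ 2) expR _ (nbhs (- (a * s) ^+ 2))); last exact: continuous_expR.
apply: cvgN; apply: (@cvg_comp _ _ _ (fun a : R => a * s) (fun x => x ^+ 2) _ (nbhs (a * s))); last exact: exprn_continuous.
exact: mulrr_continuous.
Qed.

Lemma measurable_gauss_moment_fun p s :
  measurable_fun setT (fun a : R => a ^+ p.+1 * expR (- (a * s) ^+ 2)).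
Proof. by apply: continuous_measurable_fun; exact: continuous_gauss_moment_fun. Qed.

Lemma gauss_moment_scale p s : 0 < s ->
  gauss_moment p 1 = ((s ^+ p.+2)%:E * gauss_moment p s)%E.
Proof.
move=> s0; pose G (a : R) := a ^+ p.+1 * expR (- (a * 1) ^+ 2).
have dF (x : R) : is_derive x 1 ( *%R s) s.
  have -> : ( *%R s : R -> R) = s *: id by [].
  by apply: is_derive_eq; rewrite /GRing.scale/= mulr1.
have F'E : derive1 ( *%R s : R -> R) = cst s.
  by apply/funext => x; rewrite derive1E; have [_ ->] := dF x.
have := @increasing_ge0_integration_by_substitutiony R ( *%R s) G 0.
rewrite mulr0 {1}/G -/(gauss_moment p 1) => ->; last 8 first.
- by move=> x y _ _ xy; rewrite ltr_pM2l.
- by rewrite F'E => x _; exact: cvg_cst.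
- by rewrite F'E; exact: is_cvg_cst.
- by rewrite F'E; exact: is_cvg_cst.
- split; first by move=> x _; have [] := dF x.
  by apply: cvg_at_right_filter; exact: mulrl_continuous.
- apply/cvgryPge => A; exists (A / s); split; first exact: num_real.
  by move=> x /ltW; rewrite ler_pdivrMr// mulrC.
- by apply: continuous_subspaceT; exact: continuous_gauss_moment_fun.
- move=> x; rewrite in_itv/= andbT => x0.
  by rewrite mulr_ge0 ?expR_ge0// exprn_ge0// ltW.
rewrite -ge0_integralZl_EFin//; last 3 first.
- by move=> a; rewrite /= in_itv/= andbT => a0; rewrite lee_fin mulr_ge0 ?expR_ge0// exprn_ge0.
- by apply/measurable_EFinP; apply: measurable_funTS; exact: measurable_gauss_moment_fun.
- by rewrite exprn_ge0// ltW.
apply: eq_integral => a _; rewrite F'E -EFinM; congr EFin; rewrite fctE /= /G/=.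
rewrite (_ : s * a * 1 = a * s); last by ring.
by rewrite exprMn (exprS s p.+1); ring.
Qed.

Lemma gauss_moment_fin p : (gauss_moment p 1 < +oo)%E.
Proof.
(* The factorial comes from a term of the exponential series, [expR 1] from [- a ^+ 2 <= 1 - 2 * a];
   together they leave the integrable factor [expR (- a)]. *)
pose C : R := p.+1`!%:R * expR 1.
have C0 : 0 <= C by rewrite mulr_ge0 ?expR_ge0.
rewrite (@le_lt_trans _ _ (\int[leb]_(a in `[0%R, +oo[) (C * expR (- a))%:E)%E)//.
  apply: ge0_le_integral => //.
  - move=> a; rewrite /= in_itv/= andbT => a0.
    by rewrite lee_fin mulr_ge0 ?expR_ge0// exprn_ge0.
  - by apply/measurable_EFinP; apply: measurable_funTS; exact: measurable_gauss_moment_fun.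
  - apply/measurable_EFinP; apply: measurable_funTS; apply: measurable_funM => //.
    by apply: measurableT_comp => //; exact: measurableT_comp.
  - move=> a; rewrite /= in_itv/= andbT => a0; rewrite lee_fin mulr1.
    have h1 : a ^+ p.+1 <= p.+1`!%:R * expR a.
      rewrite mulrC -ler_pdivrMr ?ltr0n ?fact_gt0//.
      by rewrite (le_trans _ (expR_ge1Dxn p a0))// lerDr.
    have h2 : expR (- a ^+ 2) <= expR 1 * expR (- a) * expR (- a).
      rewrite -!expRD ler_expR -subr_ge0.
      have -> : 1 - a - a - - a ^+ 2 = (a - 1) ^+ 2 by ring.
      exact: sqr_ge0.
    rewrite (le_trans (ler_pM _ _ h1 h2)) ?exprn_ge0 ?expR_ge0//.
    rewrite /C le_eqVlt; apply/orP; left; apply/eqP.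
    rewrite -[RHS]mulr1 -(expRxMexpNx_1 a); ring.
rewrite (@ge0_continuous_FTC2y _ _ (fun a => - (C * expR (- a))) 0 0).
- by rewrite -EFinB ltry.
- by move=> x _; rewrite mulr_ge0 ?expR_ge0.
- apply: continuous_subspaceT => a; apply: cvgM; first exact: cvg_cst.
  apply: (@cvg_comp _ _ _ (fun a : R => - a) expR _ (nbhs (- a))); last exact: continuous_expR.
  exact: oppr_continuous.
- rewrite -[X in _ --> X]oppr0; apply: cvgN; rewrite -[X in _ --> X](mulr0 C).
  by apply: cvgM; [exact: cvg_cst|exact: cvgr_expR].
- by move=> x _.
- apply: cvgN; apply: cvgM; first exact: cvg_cst.
  apply: cvg_at_right_filter.
  apply: (@cvg_comp _ _ _ (fun a : R => - a) expR _ (nbhs (- 0))); last exact: continuous_expR.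
  exact: oppr_continuous.
- move=> x _; rewrite derive1E.
  have D : is_derive x 1 (fun a : R => - (C * expR (- a))) (C * expR (- x)).
    apply: is_derive_eq; rewrite /GRing.scale/=; ring.
  by have [_ ->] := D.
Qed.

Lemma gauss_moment_gt0 p : (0 < gauss_moment p 1)%E.
Proof.
rewrite (@lt_le_trans _ _ (expR (- 2 ^+ 2))%:E)//.
rewrite (@le_trans _ _ (\int[leb]_(a in `[1%R, 2%R]) (expR (- 2 ^+ 2))%:E)%E)//.
  rewrite integral_cst//= lebesgue_measure_itv/= lte_fin ltr1n -EFinB -EFinM.
  by rewrite lee_fin ler_peMr ?expR_ge0//; lra.
rewrite (@le_trans _ _ (\int[leb]_(a in `[1%R, 2%R]) (a ^+ p.+1 * expR (- (a * 1) ^+ 2))%:E)%E)//.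
  apply: ge0_le_integral => //.
  - by apply/measurable_EFinP; apply: measurable_funTS; exact: measurable_gauss_moment_fun.
  - move=> a; rewrite /= in_itv/= => /andP[a1 a2]; rewrite lee_fin mulr1.
    rewrite -[leLHS]mul1r ler_pM ?expR_ge0// ?exprn_ege1//.
    by rewrite ler_expR lerN2 lerXn2r// nnegrE; lra.
apply: ge0_subset_integral => //.
- by apply/measurable_EFinP; apply: measurable_funTS; exact: measurable_gauss_moment_fun.
- move=> a; rewrite /= in_itv/= andbT => a0.
  by rewrite lee_fin mulr_ge0 ?expR_ge0// exprn_ge0.
- by move=> a; rewrite /= !in_itv/= => /andP[a1 a2]; rewrite andbT; lra.
Qed.

(** The power of [a] with exponent [p - 1], as a quotient because it must be [a^-1] for [p = 0].
    Vanishing for [a <= 0] allows integration over the whole line. *)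
Definition mixing_weight p (a : R) : R := if 0 < a then a ^+ p / a else 0.

Lemma mixing_weight_ge0 p a : 0 <= mixing_weight p a.
Proof. by rewrite /mixing_weight; case: ifPn => // a0; rewrite divr_ge0 ?exprn_ge0// ltW. Qed.

Lemma mixing_weight_gt0 p a : 0 < a -> 0 < mixing_weight p a.
Proof. by rewrite /mixing_weight => a0; rewrite a0 divr_gt0// exprn_gt0. Qed.

Lemma measurable_mixing_weight p : measurable_fun setT (mixing_weight p).
Proof.
rewrite (_ : mixing_weight p = (fun a : R => a ^+ p / a : R) \_ `]0%R, +oo[%classic); last first.
  by apply/funext => a; rewrite /mixing_weight patchE mem_setE in_itv/= andbT.
apply/(measurable_restrictT _ _).1 => //; apply: open_continuous_measurable_fun => //.
move=> a; rewrite inE/= in_itv/= andbT => a0.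
by apply: cvgM; [exact: exprn_continuous|apply: cvgV; rewrite ?gt_eqF].
Qed.

Lemma FTC2_is_derive (f F : R -> R) (a b : R) : a < b ->
  {within `[a, b], continuous f} ->
  (forall x, a <= x <= b -> is_derive x 1 F (f x)) ->
  (\int[leb]_(x in `[a, b]) (f x)%:E = (F b - F a)%:E)%E.
Proof.
move=> ab cf dF.
have cF x : a <= x <= b -> {for x, continuous F}.
  move=> /dF [/derivable1_diffP D _]; exact: differentiable_continuous.
rewrite (@continuous_FTC2 _ f F)//.
- split.
  + by move=> x; rewrite in_itv/= => /andP[ax xb]; have [] := dF x; rewrite ?(ltW ax) ?(ltW xb).
  + by apply: cvg_at_right_filter; apply: cF; rewrite lexx ltW.
  + by apply: cvg_at_left_filter; apply: cF; rewrite lexx ltW.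
- move=> x; rewrite in_itv/= => /andP[ax xb]; rewrite derive1E.
  by have [|_ ->] := dF x; rewrite ?(ltW ax) ?(ltW xb).
Qed.

Lemma is_derive_newton p s : 0 < s ->
  is_derive s 1 (newton p) (- ((maxn p 1)%:R / s ^+ p.+1)).
Proof.
move=> s0; have sn0 : s != 0 by rewrite gt_eqF.
rewrite /newton; case: p => [|p].
  have D := is_derive1_ln s0.
  by apply: is_derive_eq; rewrite expr1 mul1r.
have D : is_derive s 1 (fun t : R => t ^+ p.+1) (p.+1%:R * s ^+ p).
  split; first exact: exprn_derivable.
  by rewrite exp_derive /GRing.scale/= mulr1.
have H := @is_deriveV R (fun t : R => t ^+ p.+1) s _ 1 (expf_neq0 p.+1 sn0) D.
apply: (is_derive_eq H); rewrite (maxn_idPl _)// /GRing.scale/=.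
by rewrite (exprS s p.+1) (exprS s p); field; rewrite sn0 expf_neq0.
Qed.

(** The difference of Gaussians is the integral of [2 * s * a ^+ 2 * expR (- (a * s) ^+ 2)] over [s]
    from [t] to [D]. After exchanging integrals, scaling turns the [a]-integral into a multiple of
    [(s ^+ p.+1)^-1], that is, of the derivative of [newton p]. The subtracted Gaussian secures
    convergence at [a = 0] when the weight is [a^-1]. *)
Lemma kap_mixture p (D : R) : 0 < D -> exists2 c : R, 0 < c & forall t, 0 <= t ->
  (c%:E * kap p D t = \int[leb]_a (mixing_weight p a *
    (expR (- (a * Num.min D t) ^+ 2) - expR (- (a * D) ^+ 2)))%:E)%E.
Proof.
move=> D0; pose J := fine (gauss_moment p 1); pose P : R := (maxn p 1)%:R.
have P0 : 0 < P by rewrite ltr0n leq_max orbT.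
have JE : gauss_moment p 1 = J%:E.
  by rewrite fineK// ge0_fin_numE ?gauss_moment_ge0// gauss_moment_fin.
have J0 : 0 < J by rewrite -lte_fin -JE gauss_moment_gt0.
(* [2 * J] is what the [a]-integral leaves, and [P] is the factor in the derivative of
   [newton p]. *)
pose c := 2 * J / P.
have c0 : 0 < c by rewrite divr_gt0// mulr_gt0.
pose X t := (\int[leb]_a (mixing_weight p a *
    (expR (- (a * t) ^+ 2) - expR (- (a * D) ^+ 2)))%:E)%E.
have mgauss t : measurable_fun setT (fun a : R => expR (- (a * t) ^+ 2)).
  apply: measurableT_comp => //; apply: measurableT_comp => //.
  by apply: measurable_funX; exact: measurable_funM.
have mX t : measurable_fun setT (fun a => (mixing_weight p a *
    (expR (- (a * t) ^+ 2) - expR (- (a * D) ^+ 2)))%:E).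
  apply/measurable_EFinP; apply: measurable_funM; first exact: measurable_mixing_weight.
  exact: measurable_funB.
have Xge0 t a : 0 <= t -> t <= D -> (0 <= (mixing_weight p a *
    (expR (- (a * t) ^+ 2) - expR (- (a * D) ^+ 2)))%:E)%E.
  move=> t0 tD; rewrite lee_fin mulr_ge0 ?mixing_weight_ge0// subr_ge0 ler_expR lerN2.
  by rewrite !exprMn ler_wpM2l ?sqr_ge0// lerXn2r// nnegrE ltW.
have main t : 0 < t -> t < D -> (c * (newton p t - newton p D))%:E = X t.
  move=> t0 tD.
  pose h (z : R * R) := (2 * z.2 * (z.1 ^+ p.+1 * expR (- (z.1 * z.2) ^+ 2))
    * \1_(`[0%R, +oo[%classic) z.1 * \1_(`[t, D]%classic) z.2)%:E.
  have mh : measurable_fun setT h.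
    apply/measurable_EFinP; apply: measurable_funM; last first.
      exact: measurableT_comp.
    apply: measurable_funM; last exact: measurableT_comp.
    apply: measurable_funM; first exact: measurable_funM.
    apply: measurable_funM; first exact: measurable_funX.
    apply: measurableT_comp => //; apply: measurableT_comp => //.
    by apply: measurable_funX; exact: measurable_funM.
  have h0 z : (0 <= h z)%E.
    rewrite lee_fin !indicE !mem_setE !in_itv/= andbT.
    case: (leP 0 z.1) => z1; last by rewrite mulr0 mul0r.
    case: (leP t z.2) => z2; last by rewrite mulr0.
    by rewrite !mulr_ge0 ?expR_ge0 ?exprn_ge0// (le_trans (ltW t0)).
  have := @fubini_tonelli _ _ _ _ R leb leb h mh h0.
  have -> : (\int[leb]_a \int[leb]_s h (a, s) = X t)%E.
    apply: eq_integral => a _; rewrite /mixing_weight /h/=; case: ifPn => [a0|].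
      have an0 : a != 0 by rewrite gt_eqF.
      transitivity (\int[leb]_s ((fun s : R => (2 * s * (a ^+ p.+1 * expR (- (a * s) ^+ 2)))%:E)
          \_ `[t, D]%classic) s)%E.
        apply: eq_integral => s _; rewrite patchE !indicE mem_setE mem_setE in_itv/= (ltW a0)/= mulr1.
        by case: ifPn; rewrite ?mulr1 ?mulr0.
      pose F (s : R) := - (a ^+ p / a * expR (- (a * s) ^+ 2)).
      transitivity ((F D - F t)%:E); last by congr EFin; rewrite /F; ring.
      rewrite -integral_mkcond; apply: FTC2_is_derive => //.
      + apply: continuous_subspaceT => s; apply: cvgM.
          by apply: cvgM; [exact: cvg_cst|exact: cvg_id].
        apply: cvgM; first exact: cvg_cst.
        apply: (@cvg_comp _ _ _ (fun s : R => - (a * s) ^+ 2) expR _ (nbhs (- (a * s) ^+ 2))); last exact: continuous_expR.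
        apply: cvgN; apply: (@cvg_comp _ _ _ (fun s : R => a * s) (fun x => x ^+ 2) _ (nbhs (a * s))); last exact: exprn_continuous.
        exact: mulrl_continuous.
      + move=> s _; apply: is_derive_eq; rewrite /GRing.scale/=.
        by rewrite (exprS a p); field.
    rewrite -leNgt => a0; rewrite mul0r integral0_eq// => s _.
    rewrite indicE mem_setE in_itv/= andbT.
    case: (leP 0 a) => a0'; last by rewrite mulr0 mul0r.
    have -> : a = 0 by apply/eqP; rewrite eq_le a0.
    by rewrite exprS !mul0r mulr0 !mul0r.
  move=> ->.
  transitivity (\int[leb]_s ((fun s : R => (2 * J / s ^+ p.+1)%:E) \_ `[t, D]%classic) s)%E;
      last first.
    apply: eq_integral => s _; rewrite patchE mem_setE in_itv/=; case: ifPn => sI; last first.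
      apply/esym; apply: integral0_eq => a _; rewrite /h/= !indicE !mem_setE !in_itv/=.
      by rewrite (negbTE sI) mulr0.
    have s0 : 0 < s by case/andP: sI => ts _; exact: lt_le_trans ts.
    transitivity (\int[leb]_a ((fun a : R => ((2 * s)%:E * (a ^+ p.+1 * expR (- (a * s) ^+ 2))%:E)%E)
          \_ `[0%R, +oo[%classic) a)%E; last first.
      apply: eq_integral => a _; rewrite /h/= patchE !indicE mem_setE mem_setE in_itv/= in_itv/= sI mulr1.
      by rewrite andbT; case: ifPn; rewrite ?mulr1 ?mulr0// EFinM.
    rewrite -integral_mkcond ge0_integralZl_EFin//.
    - have : gauss_moment p s = ((s ^+ p.+2)^-1 * J)%:E.
        rewrite EFinM -JE (gauss_moment_scale p s0) muleA -EFinM mulVf ?mul1e//.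
        by rewrite expf_neq0// gt_eqF.
      rewrite /gauss_moment => ->; rewrite -EFinM; congr EFin.
      by rewrite (exprS s p.+1); field; rewrite ?expf_neq0 ?gt_eqF.
    - move=> a /=; rewrite in_itv/= andbT => a0.
      by rewrite lee_fin mulr_ge0 ?expR_ge0// exprn_ge0.
    - by apply/measurable_EFinP; apply: measurable_funTS; exact: measurable_gauss_moment_fun.
    - by rewrite mulr_ge0// ltW.
  pose F (s : R) := - c * newton p s.
  transitivity ((F D - F t)%:E); first by congr EFin; rewrite /F; ring.
  apply/esym; rewrite -integral_mkcond; apply: FTC2_is_derive => //.
  - apply: derivable_within_continuous => s; rewrite in_itv/= => /andP[ts _].
    have s0 : 0 < s by exact: lt_le_trans ts.
    apply: derivableM => //; apply: derivableV; first by rewrite expf_neq0// gt_eqF.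
    exact: exprn_derivable.
  - move=> s /andP[ts _]; have s0 : 0 < s by exact: lt_le_trans ts.
    have Dn := is_derive_newton p s0.
    apply: is_derive_eq.
    by rewrite /GRing.scale/= /c -/P; field; rewrite ?expf_neq0 ?gt_eqF.
exists c => // t t0; rewrite -/(X (Num.min D t)).
have [Dt|tD] := leP D t.
  rewrite /kap leNgt (lt_le_trans D0 Dt)/= (min_idPl Dt) subrr mule0.
  by rewrite /X integral0_eq// => a _; rewrite subrr mulr0.
move: t0; rewrite le_eqVlt => /orP[/eqP <-|t0]; last first.
  by rewrite kapE// ?(ltW tD)// -EFinM main.
(* At [t = 0] both sides are infinite: the right-hand side dominates its own values at small
   [s > 0], which are unbounded. *)
rewrite /kap lexx gt0_muley ?lte_fin//; apply/esym/eqyP => A A0.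
have [d d0 dA] := newton_unbounded p (A / c + newton p D).
pose s := Num.min d (D / 2).
have s0 : 0 < s by rewrite lt_min d0 divr_gt0.
have sD : s < D by rewrite gt_min; apply/orP; right; lra.
rewrite (@le_trans _ _ (X s))//.
  rewrite -main// lee_fin mulrC -ler_pdivrMr// lerBrDr dA//.
  by rewrite ge_min lexx.
apply: ge0_le_integral => //.
- by move=> a _; apply: Xge0; exact: ltW.
- exact: mX.
- exact: mX.
- move=> a _; rewrite lee_fin ler_wpM2l ?mixing_weight_ge0// lerB// ler_expR lerN2.
  by rewrite mulr0 expr0n sqr_ge0.
Qed.

End gaussian_mixture.

(** * Bounded measurable functions and their integrals *)

Section bounded_functions.
Context d (T : measurableType d) (R : realType).
Variables (S : set T).
Hypothesis mS : measurable S.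
Implicit Types (f g h : T -> R) (mu : probability T R).

Definition bounded_mfun f := measurable_fun setT f /\
  exists C, forall x, S x -> `|f x| <= C.

Lemma bounded_mfun_cst c : bounded_mfun (fun=> c).
Proof. by split => //; exists `|c|. Qed.

Lemma bounded_mfunD f g : bounded_mfun f -> bounded_mfun g ->
  bounded_mfun (fun x => f x + g x).
Proof.
move=> [mf [C fC]] [mg [C' gC]]; split; first exact: measurable_funD.
by exists (C + C') => x Sx; rewrite (le_trans (ler_normD _ _))// lerD ?fC ?gC.
Qed.

Lemma bounded_mfunM f g : bounded_mfun f -> bounded_mfun g ->
  bounded_mfun (fun x => f x * g x).
Proof.
move=> [mf [C fC]] [mg [C' gC]]; split; first exact: measurable_funM.
by exists (C * C') => x Sx; rewrite normrM ler_pM ?fC ?gC.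
Qed.

Lemma bounded_mfun_sum (I : Type) (s : seq I) (F : I -> T -> R) :
  (forall i, bounded_mfun (F i)) -> bounded_mfun (fun x => \sum_(i <- s) F i x).
Proof.
move=> bF; elim: s => [|i s ih].
  by under eq_fun do rewrite big_nil; exact: bounded_mfun_cst.
by under eq_fun do rewrite big_cons; exact: bounded_mfunD.
Qed.

Lemma bounded_mfun_prod (I : Type) (s : seq I) (F : I -> T -> R) :
  (forall i, bounded_mfun (F i)) -> bounded_mfun (fun x => \prod_(i <- s) F i x).
Proof.
move=> bF; elim: s => [|i s ih].
  by under eq_fun do rewrite big_nil; exact: bounded_mfun_cst.
by under eq_fun do rewrite big_cons; exact: bounded_mfunM.
Qed.

Lemma bounded_mfun_integrable mu f : bounded_mfun f -> mu.-integrable S (EFin \o f).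
Proof.
move=> [mf [C fC]].
apply: (@le_integrable _ _ _ mu S mS _ (fun=> C%:E)).
- by apply/measurable_EFinP; exact: measurable_funTS.
- by move=> x Sx /=; rewrite lee_fin (le_trans (fC x Sx))// ler_norm.
- by apply: integrableS (prob_integrable_cst mu C).
Qed.

Lemma bounded_cvg_Rintegral mu (f_ : nat -> T -> R) f C :
  (forall N, measurable_fun setT (f_ N)) ->
  (forall N x, S x -> `|f_ N x| <= C) ->
  (forall x, S x -> f_ N x @[N --> \oo] --> f x) ->
  (\int[mu]_(x in S) f_ N x)%R @[N --> \oo] --> (\int[mu]_(x in S) f x)%R.
Proof.
move=> mf fC cf.
have mfS : measurable_fun S f.
  apply: (@measurable_fun_cvg _ _ _ _ f_) => // N.
  exact: measurable_funTS.
have [|||||fi _ H] := @dominated_convergence _ T R mu S mS (fun N => EFin \o f_ N)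
  (EFin \o f) (fun=> C%:E).
- by move=> N; apply/measurable_EFinP; exact: measurable_funTS.
- exact/measurable_EFinP.
- by apply: aeW => x Sx; apply: cvg_EFin; [exact: nearW|exact: cf].
- by apply: integrableS (prob_integrable_cst mu C).
- by apply: aeW => x N Sx /=; rewrite lee_fin fC.
by apply: fine_cvg; rewrite fineK//; exact: integrable_fin_num.
Qed.

End bounded_functions.

Section bounded_integrals.
Context d (T : measurableType d) (R : realType).
Variables (S : set T) (mu : probability T R).
Hypothesis mS : measurable S.
Implicit Types f g : T -> R.

Lemma bounded_mfun_EFin f : bounded_mfun S f ->
  (\int[mu]_(x in S) (f x)%:E = (\int[mu]_(x in S) f x)%R%:E)%E.
Proof.
move=> bf; rewrite /Rintegral fineK//; apply: integrable_fin_num => //.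
exact: bounded_mfun_integrable.
Qed.

Lemma bounded_Rintegral_le f g : bounded_mfun S f -> bounded_mfun S g ->
  (forall x, S x -> f x <= g x) ->
  (\int[mu]_(x in S) f x)%R <= (\int[mu]_(x in S) g x)%R.
Proof. by move=> bf bg fg; apply: le_Rintegral => //; exact: bounded_mfun_integrable. Qed.

Lemma bounded_RintegralB f g : bounded_mfun S f -> bounded_mfun S g ->
  (\int[mu]_(x in S) (f x - g x))%R =
  (\int[mu]_(x in S) f x)%R - (\int[mu]_(x in S) g x)%R.
Proof. by move=> bf bg; rewrite RintegralB//; exact: bounded_mfun_integrable. Qed.

Lemma bounded_RintegralD f g : bounded_mfun S f -> bounded_mfun S g ->
  (\int[mu]_(x in S) (f x + g x))%R =
  (\int[mu]_(x in S) f x)%R + (\int[mu]_(x in S) g x)%R.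
Proof. by move=> bf bg; rewrite RintegralD//; exact: bounded_mfun_integrable. Qed.

Lemma bounded_RintegralZ c f : bounded_mfun S f ->
  (\int[mu]_(x in S) (c * f x))%R = c * (\int[mu]_(x in S) f x)%R.
Proof. by move=> bf; rewrite RintegralZl//; exact: bounded_mfun_integrable. Qed.

Lemma bounded_mfunZ c f : bounded_mfun S f -> bounded_mfun S (fun x => c * f x).
Proof. by move=> bf; apply: bounded_mfunM => //; exact: bounded_mfun_cst. Qed.

Lemma bounded_mfunB f g : bounded_mfun S f -> bounded_mfun S g ->
  bounded_mfun S (fun x => f x - g x).
Proof.
move=> bf bg; apply: bounded_mfunD => //.
by under eq_fun do rewrite -mulN1r; exact: bounded_mfunZ.
Qed.

Lemma bounded_Rintegral_sum (I : Type) (r : seq I) (F : I -> T -> R) :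
  (forall i, bounded_mfun S (F i)) ->
  (\int[mu]_(x in S) (\sum_(i <- r) F i x))%R =
  \sum_(i <- r) (\int[mu]_(x in S) F i x)%R.
Proof.
move=> bF; elim: r => [|i r ih].
  by rewrite big_nil; under eq_Rintegral do rewrite big_nil; rewrite Rintegral_cst// mul0r.
rewrite big_cons -ih; under eq_Rintegral do rewrite big_cons.
by rewrite bounded_RintegralD//; exact: bounded_mfun_sum.
Qed.

Lemma Rintegral_le_cst f c : bounded_mfun S f -> (forall x, S x -> f x <= c) ->
  (\int[mu]_(x in S) f x)%R <= c * fine (mu S).
Proof.
move=> bf fc; rewrite -Rintegral_cst//; apply: bounded_Rintegral_le => //.
exact: bounded_mfun_cst.
Qed.

Lemma fine_prob_le1 : 0 <= fine (mu S) <= 1.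
Proof.
have F : mu S \is a fin_num by exact: fin_num_measure.
by rewrite -!lee_fin fineK// measure_ge0 probability_le1.
Qed.

Lemma norm_Rintegral_le f c : 0 <= c -> bounded_mfun S f -> (forall x, S x -> `|f x| <= c) ->
  `|(\int[mu]_(x in S) f x)%R| <= c.
Proof.
move=> c0 bf fc; have /andP[m0 m1] := fine_prob_le1.
have cm : c * fine (mu S) <= c by rewrite ler_piMr.
rewrite ler_norml (le_trans (Rintegral_le_cst bf _) cm) => [|x Sx]; last first.
  by rewrite (le_trans (ler_norm _) (fc x Sx)).
rewrite andbT lerNl -mulN1r -bounded_RintegralZ//.
rewrite (le_trans (Rintegral_le_cst (bounded_mfunZ (-1) bf) _) cm)// => x Sx.
by rewrite mulN1r (le_trans _ (fc x Sx))// -normrN ler_norm.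
Qed.

End bounded_integrals.

Section exponential_series.
Context {R : realType}.
Implicit Types t : R.

Definition exp_sum N t : R := \sum_(k < N) t ^+ k * (k`!%:R)^-1.

Lemma exp_sumE N t : exp_sum N t = series (exp_coeff t) N.
Proof. by rewrite /series/= big_mkord. Qed.

Lemma exp_sum_cvg t : exp_sum N t @[N --> \oo] --> expR t.
Proof.
rewrite (_ : (fun N => _) = series (exp_coeff t)).
  exact: is_cvg_series_exp_coeff.
by apply/funext => N; rewrite exp_sumE.
Qed.

Lemma exp_sum_bound N t : `|exp_sum N t| <= expR `|t|.
Proof.
rewrite (@le_trans _ _ (exp_sum N `|t|))//.
  rewrite /exp_sum (le_trans (ler_norm_sum _ _ _))// ler_sum// => k _.
  by rewrite normrM normrX [`|_^-1|]ger0_norm.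
rewrite exp_sumE; apply: nondecreasing_cvgn_le; last exact: is_cvg_series_exp_coeff.
apply: nondecreasing_series => k _ _.
exact: exp_coeff_ge0.
Qed.

End exponential_series.

(** * Polynomial moments determine a probability measure on a ball *)

Section moment_determinacy.
Context {R : realType} {n : nat}.
Local Notation T := (g_sigma_algebraType (@open 'rV[R]_n)).
Variables (M : R).
Local Notation S := (eball M : set T).

Let mS : measurable S.
Proof. by apply: closed_measurable_rV; exact: closed_eball. Qed.

Definition mono (s : seq 'I_n) (x : T) : R := \prod_(i <- s) (x : 'rV[R]_n) ord0 i.

(** Bounded pointwise limits replace uniform approximation: dominated convergence suffices to pass
    moment identities to the limit, and the class reaches every Borel indicator. *)
Inductive poly_closure : (T -> R) -> Prop :=
| pc_cst c : poly_closure (fun=> c)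
| pc_coord i : poly_closure (fun x => (x : 'rV[R]_n) ord0 i)
| pc_add f g : poly_closure f -> poly_closure g -> poly_closure (fun x => f x + g x)
| pc_mul f g : poly_closure f -> poly_closure g -> poly_closure (fun x => f x * g x)
| pc_lim (f_ : nat -> T -> R) (f : T -> R) (C : R) : (forall N, poly_closure (f_ N)) -> measurable_fun setT f ->
    (forall N x, S x -> `|f_ N x| <= C) ->
    (forall x, S x -> f_ N x @[N --> \oo] --> f x) -> poly_closure f.

Lemma bounded_mfun_coord i : bounded_mfun S (fun x : T => (x : 'rV[R]_n) ord0 i).
Proof.
split; first exact: measurable_coord.
by exists M => x xM; exact: le_trans (coord_le_enorm _ _) xM.
Qed.

Lemma bounded_mono s : bounded_mfun S (mono s).
Proof. by apply: bounded_mfun_prod => i; exact: bounded_mfun_coord. Qed.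

Lemma lim_bound (u : nat -> R) l C : (forall N, `|u N| <= C) -> u @ \oo --> l -> `|l| <= C.
Proof.
move=> uC ul.
have nl : `|u N| @[N --> \oo] --> `|l| by apply: cvg_norm.
rewrite -(cvg_lim _ nl)//; apply: limr_le; first by apply/cvg_ex; exists `|l|.
exact: nearW.
Qed.

Lemma poly_closure_bounded f : poly_closure f -> bounded_mfun S f.
Proof.
elim => {f} [c|i|f g _ bf _ bg|f g _ bf _ bg|f_ f C _ bf mf fC cf].
- exact: bounded_mfun_cst.
- exact: bounded_mfun_coord.
- exact: bounded_mfunD.
- exact: bounded_mfunM.
- split => //; exists C => x Sx; apply: lim_bound (cf x Sx) => N; exact: fC.
Qed.

Lemma poly_closure_sum (I : Type) (s : seq I) (F : I -> T -> R) :
  (forall i, poly_closure (F i)) -> poly_closure (fun x => \sum_(i <- s) F i x).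
Proof.
move=> bF; elim: s => [|i s ih].
  by under eq_fun do rewrite big_nil; exact: pc_cst.
by under eq_fun do rewrite big_cons; exact: pc_add.
Qed.

Lemma poly_closure_prod (I : Type) (s : seq I) (F : I -> T -> R) :
  (forall i, poly_closure (F i)) -> poly_closure (fun x => \prod_(i <- s) F i x).
Proof.
move=> bF; elim: s => [|i s ih].
  by under eq_fun do rewrite big_nil; exact: pc_cst.
by under eq_fun do rewrite big_cons; exact: pc_mul.
Qed.

Lemma poly_closureX f k : poly_closure f -> poly_closure (fun x => f x ^+ k).
Proof.
move=> pf; elim: k => [|k ih].
  by under eq_fun do rewrite expr0; exact: pc_cst.
by under eq_fun do rewrite exprS; exact: pc_mul.
Qed.

Lemma poly_closure_exp f : poly_closure f -> poly_closure (fun x => expR (f x)).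
Proof.
move=> pf; have [mf [C fC]] := poly_closure_bounded pf.
apply: (@pc_lim (fun N x => exp_sum N (f x)) _ (expR C)).
- move=> N; rewrite /exp_sum; apply: poly_closure_sum => k.
  by apply: pc_mul; [exact: poly_closureX|exact: pc_cst].
- exact: measurableT_comp.
- move=> N x Sx; rewrite (le_trans (exp_sum_bound _ _))// ler_expR.
  exact: fC.
- by move=> x _; exact: exp_sum_cvg.
Qed.

(** The functions [expR (- expR (N * (N * t + 1)))] tend to 1 for [t < 0] and to 0 for [t >= 0]; the
    added 1 decides the case [t = 0]. A double exponential of this form never leaves the unit
    interval, which gives the uniform bound. *)
Lemma poly_closure_halfspace i c :
  poly_closure (\1_[set x : T | (x : 'rV[R]_n) ord0 i < c]).
Proof.
pose t (x : T) := (x : 'rV[R]_n) ord0 i - c.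
pose u (N : nat) (x : T) := N%:R * (N%:R * t x + 1).
apply: (@pc_lim (fun N x => expR (- expR (u N x))) _ 1).
- move=> N; apply: poly_closure_exp.
  under eq_fun do rewrite -mulN1r; apply: pc_mul; first exact: pc_cst.
  apply: poly_closure_exp; apply: pc_mul; first exact: pc_cst.
  apply: pc_add; last exact: pc_cst; apply: pc_mul; first exact: pc_cst.
  by apply: pc_add; [exact: pc_coord|exact: pc_cst].
- apply: measurable_indic; rewrite -[X in measurable X]setTI.
  rewrite (_ : [set x : T | _] = (fun x : T => (x : 'rV[R]_n) ord0 i) @^-1` `]-oo, c[%classic).
    by apply: measurable_coord => //; exact: measurable_itv.
  by apply/seteqP; split => x /=; rewrite in_itv.
- move=> N x _; rewrite ger0_norm ?expR_ge0//.
- move=> x _; have [tc|tc] := ltP ((x : 'rV[R]_n) ord0 i) c; last first.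
    rewrite indicE memNset; last by move=> /=; rewrite ltNge tc.
    apply: (@squeeze_cvgr _ _ _ _ (cst 0) (fun N : nat => expR (- N%:R))) => //.
    + near=> N; rewrite expR_ge0/= ler_expR lerN2.
      have N0 : 0 <= N%:R :> R by [].
      rewrite (le_trans _ (expR_ge1Dx _))// (@le_trans _ _ (u N x))//; last by rewrite lerDr.
      rewrite /u -[leLHS]mulr1 ler_wpM2l// lerDr mulr_ge0//.
      by rewrite /t subr_ge0.
    + exact: cvg_cst.
    + exact: cvgn_expR.
  rewrite indicE mem_set//.
  apply: (@squeeze_cvgr _ _ _ _ (fun N : nat => 1 - expR (- N%:R)) (cst 1)).
  + have t0 : 0 < 2 / (c - (x : 'rV[R]_n) ord0 i) by rewrite divr_gt0// subr_gt0.
    near=> N; apply/andP; split; last by rewrite expR_le1 oppr_le0 expR_ge0.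
    rewrite (le_trans _ (expR_ge1Dx _))// lerD2l lerN2 ler_expR.
    rewrite /u -mulrN1 ler_wpM2l//.
    have : 2 / (c - (x : 'rV[R]_n) ord0 i) <= N%:R.
      by near: N; exact: nbhs_infty_ger.
    rewrite ler_pdivrMr ?subr_gt0// /t; lra.
  + rewrite -[X in _ --> X]subr0; apply: cvgB; [exact: cvg_cst|exact: cvgn_expR].
  + exact: cvg_cst.
Unshelve. all: by end_near. Qed.

Definition pc_sets : set (set T) :=
  [set B | poly_closure (\1_B : T -> R)].

Lemma sigma_algebra_pc_sets : sigma_algebra setT pc_sets.
Proof.
have C B : pc_sets B -> pc_sets (~` B).
  move=> pB; rewrite /pc_sets/= (_ : \1_(~` B) = fun x => 1 + (-1) * \1_B x).
    by apply: pc_add; [exact: pc_cst|apply: pc_mul => //; exact: pc_cst].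
  apply/funext => x; rewrite !indicE in_setC.
  by case: (x \in B); rewrite /= ?mulr1 ?mulr0 ?addr0 ?subrr.
split.
- rewrite /pc_sets/= (_ : \1_set0 = fun=> 0); first exact: pc_cst.
  by apply/funext => x; rewrite indic0.
- by move=> B pB; rewrite setTD; exact: C.
- move=> F pF; rewrite -[\bigcup_k _]setCK; apply/C; rewrite setC_bigcup.
  rewrite /pc_sets/=.
  have pN N : poly_closure (fun x => \prod_(k < N) \1_(~` F k) x).
    by apply: poly_closure_prod => k; exact/C/pF.
  apply: (@pc_lim (fun N x => \prod_(k < N) \1_(~` F k) x) _ 1) => //.
  + apply: measurable_indic; apply: bigcapT_measurable => k.
    have [mk _] := poly_closure_bounded (pF k).
    apply: measurableC.
    rewrite (_ : F k = (\1_(F k) : T -> R) @^-1` [set 1]).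
      by rewrite -[X in measurable X]setTI; apply: mk => //; exact: measurable_set1.
    apply/seteqP; split => x /=; rewrite indicE.
      by move=> Fx; rewrite mem_set.
    by have [/set_mem//|_ /eqP] := boolP (x \in F k); rewrite eq_sym oner_eq0.
  + move=> N x _; rewrite normr_prod; apply: prodr_ile1 => k _.
    by rewrite normr_ge0/= indicE; case: (_ \in _); rewrite ?normr1 ?normr0.
  + move=> x _; have [xF|xF] := pselect (forall k, (~` F k) x).
      rewrite indicE mem_set//; apply: cvg_near_cst; apply: nearW => N.
      by apply: big1 => k _; rewrite indicE mem_set.
    rewrite indicE memNset; last by move=> /= H; apply: xF => k; exact: H.
    have /existsNP[k nFk] := xF.
    apply: cvg_near_cst; exists k.+1 => // N /= kN.
    rewrite (bigD1 (Ordinal kN))//= indicE memNset ?mul0r//.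
Qed.

(** The sets whose indicator is in the class form a sigma-algebra, products providing the
    intersections. Half-spaces make the coordinates measurable for it, so the identity into the
    Borel structure is measurable. *)
Lemma poly_closure_measurable (B : set T) : measurable B -> poly_closure (\1_B : T -> R).
Proof.
move=> mB.
pose X := g_sigma_algebraType pc_sets.
have mid : measurable_fun setT (idfun : X -> T).
  apply: measurable_rVP => i.
  apply: (measurability _ (RGenInftyO.measurableE R)) => //.
  move=> _ [_ [c ->] <-]; rewrite setTI; apply: sub_sigma_algebra.
  rewrite /pc_sets/=.
  rewrite (_ : _ @^-1` _ = [set x : T | (x : 'rV[R]_n) ord0 i < c]).
    exact: poly_closure_halfspace.
  by apply/seteqP; split => x /=; rewrite in_itv.
have := mid measurableT B mB; rewrite setTI => H.
suff : pc_sets B by [].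
rewrite -(sigma_algebra_id sigma_algebra_pc_sets).
exact: H.
Qed.

(** The weight [expR (w x)] is there because Gaussian energies only yield weighted moments; it is
    undone at the end by the multiplier [expR (- w x)], also in the class. *)
Lemma moment_determinacy (mu la : borel_probability R n) (w : T -> R) :
  mu S = 1%E -> la S = 1%E ->
  poly_closure (fun x => expR (w x)) -> poly_closure (fun x => expR (- w x)) ->
  (forall s, (\int[mu]_(x in S) (expR (w x) * mono s x) =
    \int[la]_(x in S) (expR (w x) * mono s x))%R) ->
  forall B : set T, measurable B -> mu B = la B.
Proof.
move=> muS laS pw pw' mom B mB.
pose Phi f := ((\int[mu]_(x in S) (expR (w x) * f x)) -
  (\int[la]_(x in S) (expR (w x) * f x)))%R.
have bw : bounded_mfun S (fun x => expR (w x)) by exact: poly_closure_bounded.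
have PhiD f g : bounded_mfun S f -> bounded_mfun S g ->
    Phi (fun x => f x + g x) = Phi f + Phi g.
  move=> bf bg.
  have E (m : borel_probability R n) : (\int[m]_(x in S) (expR (w x) * (f x + g x)) =
      (\int[m]_(x in S) (expR (w x) * f x)) + (\int[m]_(x in S) (expR (w x) * g x)))%R.
    rewrite -RintegralD//; last 2 first.
    - by apply: bounded_mfun_integrable => //; exact: bounded_mfunM.
    - by apply: bounded_mfun_integrable => //; exact: bounded_mfunM.
    by apply: eq_Rintegral => x _; rewrite mulrDr.
  by rewrite /Phi !E; ring.
have PhiZ c f : bounded_mfun S f -> Phi (fun x => c * f x) = c * Phi f.
  move=> bf.
  have E (m : borel_probability R n) : (\int[m]_(x in S) (expR (w x) * (c * f x)) =
      c * (\int[m]_(x in S) (expR (w x) * f x)))%R.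
    rewrite -RintegralZl//; last first.
      by apply: bounded_mfun_integrable => //; exact: bounded_mfunM.
    by apply: eq_Rintegral => x _; rewrite mulrCA.
  by rewrite /Phi !E; ring.
(* Quantifying over a multiplier [h] makes the property stable under products: factors are absorbed
   into [h] one at a time. *)
pose P f := forall h, bounded_mfun S h -> (forall s, Phi (fun x => h x * mono s x) = 0) ->
  forall s, Phi (fun x => (f x * h x) * mono s x) = 0.
have main f : poly_closure f -> P f.
  move=> pf; have := poly_closure_bounded.
  elim: pf => {f} [c|i|f g pf Pf pg Pg|f g pf Pf pg Pg|f_ f C pf Pf mf fC cf] bnd h bh h0 s.
  - rewrite (_ : (fun _ => _) = (fun x => c * (h x * mono s x))).
      by rewrite PhiZ ?h0 ?mulr0//; apply: bounded_mfunM => //; exact: bounded_mono.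
    by apply/funext => x; rewrite mulrA.
  - rewrite (_ : (fun _ => _) = (fun x => h x * mono (i :: s) x)); first exact: h0.
    by apply/funext => x; rewrite /mono big_cons; ring.
  - rewrite (_ : (fun _ => _) = (fun x => (f x * h x) * mono s x + (g x * h x) * mono s x)).
      rewrite PhiD ?Pf ?Pg ?addr0//.
      + by do !apply: bounded_mfunM => //; [exact: bnd|exact: bounded_mono].
      + by do !apply: bounded_mfunM => //; [exact: bnd|exact: bounded_mono].
    by apply/funext => x; ring.
  - rewrite (_ : (fun _ => _) = (fun x => (f x * (g x * h x)) * mono s x)).
      apply: Pf => //; first by apply: bounded_mfunM => //; exact: bnd.
      by move=> s'; exact: Pg.
    by apply/funext => x; ring.
  - have bhm : bounded_mfun S (fun x => h x * mono s x).
      by apply: bounded_mfunM => //; exact: bounded_mono.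
    have bwhm : bounded_mfun S (fun x => expR (w x) * (h x * mono s x)) by exact: bounded_mfunM.
    have [mwhm [C' whmC]] := bwhm.
    have E (m : borel_probability R n) :
        (\int[m]_(x in S) (expR (w x) * (f_ N x * h x * mono s x)))%R @[N --> \oo] -->
        (\int[m]_(x in S) (expR (w x) * (f x * h x * mono s x)))%R.
      apply: (@bounded_cvg_Rintegral _ _ _ _ _ _ _ _ (C * C')) => //.
      + move=> N; have [mN _] := bnd _ (pf N).
        rewrite (_ : (fun _ => _) = (fun x => f_ N x * (expR (w x) * (h x * mono s x)))).
          exact: measurable_funM.
        by apply/funext => x; ring.
      + move=> N x Sx.
        rewrite (_ : _ * _ = f_ N x * (expR (w x) * (h x * mono s x))); last by ring.
        by rewrite normrM ler_pM// ?fC ?whmC.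
      + move=> x Sx; apply: cvgM; first exact: cvg_cst.
        by do !(apply: cvgM; last exact: cvg_cst); exact: cf.
    have := cvgB (E mu) (E la); rewrite -/(Phi _) => cP.
    have c0 : (fun N : nat => Phi (fun x => f_ N x * h x * mono s x)) = fun=> 0.
      by apply/funext => N; exact: Pf.
    have {}cP : (fun N : nat => Phi (fun x => f_ N x * h x * mono s x)) @ \oo -->
      Phi (fun x => f x * h x * mono s x) by exact: cP.
    rewrite c0 in cP; have := cvg_lim (@norm_hausdorff R R) cP.
    by rewrite (cvg_lim (@norm_hausdorff R R) (cvg_cst 0)) => <-.
have pB := poly_closure_measurable mB.
have := main _ (pc_mul pB pw') (fun=> 1) (bounded_mfun_cst _ 1) _ [::].
have -> : (forall s, Phi (fun x => 1 * mono s x) = 0) = True.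
  rewrite propeqE; split => // _ s; rewrite /Phi.
  under eq_Rintegral do rewrite mul1r.
  under [X in _ - X]eq_Rintegral do rewrite mul1r.
  by rewrite mom subrr.
move=> /(_ Logic.I).
have E (m : borel_probability R n) : m S = 1%E ->
    (\int[m]_(x in S) (expR (w x) * (\1_B x * expR (- w x) * 1 * mono [::] x)))%R = fine (m B).
  move=> mS1; rewrite -(prob_full_setIr mB mS mS1).
  transitivity (\int[m]_(x in S) (\1_B x : R))%R.
    apply: eq_Rintegral => x _; rewrite /mono big_nil !mulr1 mulrCA -expRD subrr expR0.
    by rewrite mulr1.
  by rewrite /Rintegral integral_indic// setIC.
rewrite /Phi !E// => /eqP; rewrite subr_eq0 => /eqP H.
by rewrite -(@fineK _ (mu B)) ?fin_num_measure// H fineK ?fin_num_measure.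
Qed.

End moment_determinacy.

(** * Gaussian energies as sums of products of moments *)

Section gaussian_energy.
Context {R : realType} {n : nat}.
Local Notation T := (g_sigma_algebraType (@open 'rV[R]_n)).
Variables (M a : R).
Hypothesis a0 : 0 < a.
Local Notation S := (eball M : set T).
Implicit Types (mu la : borel_probability R n).

Let mS : measurable S.
Proof. by apply: closed_measurable_rV; exact: closed_eball. Qed.

Definition gauss_weight (x : T) : R := - (a ^+ 2 * dot (x : 'rV[R]_n) x).

Definition gauss_mom mu (s : seq 'I_n) : R :=
  (\int[mu]_(x in S) (expR (gauss_weight x) * mono s x))%R.

Definition gauss_energy mu la : R :=
  (\int[la]_(x in S) \int[mu]_(y in S) expR (- (a * enorm ((x : 'rV[R]_n) - (y : 'rV[R]_n))) ^+ 2))%R.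

Definition gauss_coef (k : nat) : R := (2 * a ^+ 2) ^+ k * (k`!%:R)^-1.

Lemma gauss_coef_gt0 k : 0 < gauss_coef k.
Proof. by rewrite mulr_gt0 ?exprn_gt0 ?invr_gt0 ?ltr0n ?fact_gt0// mulr_gt0// exprn_gt0. Qed.

Definition gauss_partial N mu la : R :=
  \sum_(k < N) gauss_coef k *
    \sum_(f : {ffun 'I_k -> 'I_n}) gauss_mom mu (codom f) * gauss_mom la (codom f).

Lemma mono_codom k (f : {ffun 'I_k -> 'I_n}) (x : T) :
  mono (codom f) x = \prod_(j < k) (x : 'rV[R]_n) ord0 (f j).
Proof. by rewrite /mono /codom big_image. Qed.

(** Distributing a power of the dot product gives one term for each word in the coordinates, so no
    multinomial coefficients occur; this is why moments are indexed by sequences. *)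
Lemma exp_sum_dot N (x y : T) : exp_sum N (2 * a ^+ 2 * dot (x : 'rV[R]_n) y) =
  \sum_(k < N) gauss_coef k *
    \sum_(f : {ffun 'I_k -> 'I_n}) mono (codom f) x * mono (codom f) y.
Proof.
apply: eq_bigr => k _; rewrite exprMn /gauss_coef mulrAC; congr (_ * _).
rewrite -[X in dot _ _ ^+ X]card_ord -prodr_const /dot bigA_distr_bigA/=.
by apply: eq_bigr => f _; rewrite !mono_codom -big_split.
Qed.

Lemma expR_gauss (x y : T) : expR (- (a * enorm ((x : 'rV[R]_n) - (y : 'rV[R]_n))) ^+ 2) =
  expR (gauss_weight x) * (expR (gauss_weight y) * expR (2 * a ^+ 2 * dot (x : 'rV[R]_n) y)).
Proof.
rewrite -!expRD; congr expR; rewrite exprMn sqr_enorm /gauss_weight.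
rewrite dotDl !dotDr !dotNl !dotNr (dotC (y : 'rV[R]_n) x); ring.
Qed.

Lemma bounded_gauss_weight : bounded_mfun S (fun x => expR (gauss_weight x)).
Proof.
split.
  apply: measurableT_comp => //; apply: measurableT_comp => //.
  apply: measurable_funM => //; apply: measurable_sum => i.
  by apply: measurable_funM; exact: measurable_coord.
exists 1 => x _; rewrite ger0_norm ?expR_ge0// expR_le1 oppr_le0.
by rewrite mulr_ge0 ?sqr_ge0// dot_ge0.
Qed.

Lemma bounded_gauss_mono s : bounded_mfun S (fun x => expR (gauss_weight x) * mono s x).
Proof. by apply: bounded_mfunM; [exact: bounded_gauss_weight|exact: bounded_mono]. Qed.

Lemma prob_Rintegral_cst mu (c : R) : mu S = 1%E -> (\int[mu]_(x in S) c)%R = c.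
Proof. by move=> mu1; rewrite /Rintegral integral_cst// [X in (_ * X)%E](_ : _ = 1%E)// mule1. Qed.

Lemma abs_dot_le (x y : T) : S x -> S y -> `|dot (x : 'rV[R]_n) y| <= M ^+ 2.
Proof.
move=> xM yM.
have key (u v : 'rV[R]_n) : enorm u <= M -> enorm v <= M -> dot u v <= M ^+ 2.
  move=> uM vM; rewrite (le_trans (dot_le_enorm u v))// expr2 ler_pM// enorm_ge0//.
rewrite ler_norml key// andbT lerNl -dotNl key// enormN//.
Qed.

(** Dominated convergence is used once for each integral; by Cauchy-Schwarz, [C] bounds all partial
    sums of the exponential on the ball. *)
Lemma gauss_partial_cvg mu la : mu S = 1%E ->
  gauss_partial N mu la @[N --> \oo] --> gauss_energy mu la.
Proof.
move=> mu1.
pose q N (x : T) := expR (gauss_weight x) * (\sum_(k < N) gauss_coef k *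
    \sum_(f : {ffun 'I_k -> 'I_n}) mono (codom f) x * gauss_mom mu (codom f)).
pose C := expR (2 * a ^+ 2 * M ^+ 2).
have bq (N : nat) : bounded_mfun S (q N).
  apply: bounded_mfunM; first exact: bounded_gauss_weight.
  apply: bounded_mfun_sum => k; apply: bounded_mfunM; first exact: bounded_mfun_cst.
  apply: bounded_mfun_sum => f; apply: bounded_mfunM; first exact: bounded_mono.
  exact: bounded_mfun_cst.
pose F N (x y : T) := expR (gauss_weight x) * (expR (gauss_weight y) *
  exp_sum N (2 * a ^+ 2 * dot (x : 'rV[R]_n) y)).
have bF (N : nat) x : measurable_fun setT (F N x).
  apply: measurable_funM => //; apply: measurable_funM; first by case: bounded_gauss_weight.
  apply: measurable_sum => k; apply: measurable_funM => //; apply: measurable_funX.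
  apply: measurable_funM => //; apply: measurable_sum => i.
  by apply: measurable_funM => //; exact: measurable_coord.
have FC N x y : S x -> S y -> `|F N x y| <= C.
  move=> Sx Sy; rewrite !normrM.
  have wle (z : T) : `|expR (gauss_weight z)| <= 1.
    rewrite ger0_norm ?expR_ge0// expR_le1 oppr_le0.
    by rewrite mulr_ge0 ?sqr_ge0// dot_ge0.
  rewrite -[leRHS]mul1r ler_pM// -[leRHS]mul1r ler_pM//.
  rewrite (le_trans (exp_sum_bound _ _))// ler_expR normrM ger0_norm; last first.
    by rewrite mulr_ge0// sqr_ge0.
  by rewrite ler_wpM2l ?abs_dot_le// mulr_ge0// sqr_ge0.
have qE N x : q N x = (\int[mu]_(y in S) F N x y)%R.
  transitivity (\int[mu]_(y in S) (\sum_(k < N) (expR (gauss_weight x) * gauss_coef k) *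
      \sum_(f : {ffun 'I_k -> 'I_n}) mono (codom f) x *
        (expR (gauss_weight y) * mono (codom f) y)))%R.
    have b1 k : bounded_mfun S (fun y => \sum_(f : {ffun 'I_k -> 'I_n}) mono (codom f) x *
        (expR (gauss_weight y) * mono (codom f) y)).
      apply: bounded_mfun_sum => f; apply: bounded_mfunM; first exact: bounded_mfun_cst.
      exact: bounded_gauss_mono.
    rewrite bounded_Rintegral_sum//; last first.
      by move=> k; apply: bounded_mfunM; [exact: bounded_mfun_cst|exact: b1].
    rewrite /q mulr_sumr; apply: eq_bigr => k _; rewrite bounded_RintegralZ//.
    rewrite mulrA; congr (_ * _); rewrite bounded_Rintegral_sum//; last first.
      by move=> f; apply: bounded_mfunM; [exact: bounded_mfun_cst|exact: bounded_gauss_mono].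
    apply: eq_bigr => f _; rewrite bounded_RintegralZ//; exact: bounded_gauss_mono.
  apply: eq_Rintegral => y _; rewrite /F exp_sum_dot !mulr_sumr.
  apply: eq_bigr => k _; move: (gauss_coef k) => c.
  rewrite -!mulrA; congr (_ * _); rewrite [RHS]mulrCA; congr (_ * _).
  by rewrite mulr_sumr; apply: eq_bigr => f _; ring.
have qC N x : S x -> `|q N x| <= C.
  move=> Sx; rewrite qE.
  have bFx : bounded_mfun S (F N x) by split => //; exists C => y Sy; exact: FC.
  rewrite (le_trans (le_normr_Rintegral _ _))//; first exact: bounded_mfun_integrable.
  rewrite (@le_trans _ _ (\int[mu]_(y in S) C)%R)//; last first.
    by rewrite prob_Rintegral_cst.
  apply: le_Rintegral => //.
  - apply: bounded_mfun_integrable => //; split; first exact: measurableT_comp.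
    by exists C => y Sy; rewrite normr_id FC.
  - by apply: bounded_mfun_integrable => //; exact: bounded_mfun_cst.
  - by move=> y Sy; exact: FC.
rewrite (_ : (fun N => _) = (fun N => (\int[la]_(x in S) q N x)%R)); last first.
  apply/funext => N; rewrite /q.
  transitivity (\int[la]_(x in S) (\sum_(k < N) gauss_coef k *
      \sum_(f : {ffun 'I_k -> 'I_n}) gauss_mom mu (codom f) *
        (expR (gauss_weight x) * mono (codom f) x)))%R.
    have b1 k : bounded_mfun S (fun x => \sum_(f : {ffun 'I_k -> 'I_n})
        gauss_mom mu (codom f) * (expR (gauss_weight x) * mono (codom f) x)).
      apply: bounded_mfun_sum => f; apply: bounded_mfunM; first exact: bounded_mfun_cst.
      exact: bounded_gauss_mono.
    rewrite bounded_Rintegral_sum//; last first.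
      by move=> k; apply: bounded_mfunM; [exact: bounded_mfun_cst|exact: b1].
    apply: eq_bigr => k _; rewrite bounded_RintegralZ//; congr (_ * _).
    rewrite bounded_Rintegral_sum//; last first.
      by move=> f; apply: bounded_mfunM; [exact: bounded_mfun_cst|exact: bounded_gauss_mono].
    by apply: eq_bigr => f _; rewrite bounded_RintegralZ//; exact: bounded_gauss_mono.
  apply: eq_Rintegral => x _; rewrite mulr_sumr; apply: eq_bigr => k _.
  rewrite mulrCA; congr (_ * _); rewrite mulr_sumr; apply: eq_bigr => f _; ring.
apply: (@bounded_cvg_Rintegral _ _ _ S mS la q _ C) => //.
  by move=> N; case: (bq N).
move=> x Sx; under eq_fun do rewrite qE.
apply: (@bounded_cvg_Rintegral _ _ _ S mS mu (fun N => F N x) _ C) => //.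
  by move=> N y Sy; exact: FC.
move=> y Sy; rewrite expR_gauss /F.
by do !(apply: cvgM; first exact: cvg_cst); exact: exp_sum_cvg.
Qed.

(** The discrepancy is a series whose terms are positive multiples of sums of squared differences of
    moments, so it can be nonpositive only if every difference vanishes. *)
Lemma gauss_energy_diff mu la : mu S = 1%E -> la S = 1%E ->
  0 <= gauss_energy mu mu + gauss_energy la la - 2 * gauss_energy mu la /\
  (gauss_energy mu mu + gauss_energy la la - 2 * gauss_energy mu la <= 0 ->
   forall s, gauss_mom mu s = gauss_mom la s).
Proof.
move=> mu1 la1.
pose d N := gauss_partial N mu mu + gauss_partial N la la - 2 * gauss_partial N mu la.
pose e (k : nat) := gauss_coef k *
  \sum_(f : {ffun 'I_k -> 'I_n}) (gauss_mom mu (codom f) - gauss_mom la (codom f)) ^+ 2.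
have dE N : d N = \sum_(k < N) e k.
  rewrite /d mulr_sumr -big_split -sumrB/=; apply: eq_bigr => k _.
  rewrite mulrCA -mulrDr -mulrBr; congr (_ * _).
  rewrite mulr_sumr -big_split -sumrB/=; apply: eq_bigr => f _; ring.
have e0 k : 0 <= e k.
  rewrite mulr_ge0 ?(ltW (gauss_coef_gt0 _))//; apply: sumr_ge0 => f _; exact: sqr_ge0.
set D := gauss_energy mu mu + gauss_energy la la - 2 * gauss_energy mu la.
have dD : d N @[N --> \oo] --> D.
  apply: cvgB; first by apply: cvgD; exact: gauss_partial_cvg.
  by apply: cvgM; [exact: cvg_cst|exact: gauss_partial_cvg].
have dle N : d N <= D.
  rewrite -(cvg_lim (@norm_hausdorff R R) dD); apply: nondecreasing_cvgn_le.
    by apply/nondecreasing_seqP => k; rewrite !dE big_ord_recr/= lerDl.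
  by apply/cvg_ex; exists D.
split; first by rewrite (le_trans _ (dle 0%N))// dE big_ord0.
move=> D0 s; have := le_trans (dle (size s).+1) D0.
rewrite dE big_ord_recr/= => H.
have : e (size s) <= 0.
  by rewrite (le_trans _ H)// lerDr sumr_ge0.
rewrite pmulr_rle0 ?gauss_coef_gt0// => {}H.
(* The word [s] is one of the words counted in the term of index [size s]. *)
pose f : {ffun 'I_(size s) -> 'I_n} := [ffun j => tnth (in_tuple s) j].
have fE : codom f = s.
  rewrite -[RHS](@map_tnth_enum _ _ (in_tuple s)) /codom /image_mem.
  by apply: eq_map => j; rewrite ffunE.
have : (gauss_mom mu (codom f) - gauss_mom la (codom f)) ^+ 2 <= 0.
  rewrite (le_trans _ H)// (bigD1 f)//= lerDl sumr_ge0// => g _; exact: sqr_ge0.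
by rewrite fE real_exprn_even_le0 ?num_real//= subr_eq0 => /eqP.
Qed.

Lemma gauss_energy_determines mu la : mu S = 1%E -> la S = 1%E ->
  gauss_energy mu mu + gauss_energy la la - 2 * gauss_energy mu la <= 0 ->
  forall B : set T, measurable B -> mu B = la B.
Proof.
move=> mu1 la1 D0; have [_ /(_ D0) mom] := gauss_energy_diff mu1 la1.
have pd : poly_closure M (fun x : T => a ^+ 2 * dot (x : 'rV[R]_n) x).
  apply: pc_mul; first exact: pc_cst; apply: poly_closure_sum => i.
  by apply: pc_mul; exact: pc_coord.
apply: (@moment_determinacy _ _ M mu la gauss_weight) => //.
- apply: poly_closure_exp; rewrite /gauss_weight.
  by under eq_fun do rewrite -mulN1r; apply: pc_mul => //; exact: pc_cst.
- apply: poly_closure_exp; rewrite /gauss_weight.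
  by under eq_fun do rewrite opprK.
Qed.

End gaussian_energy.

(** * The energy principle and uniqueness of minimizers *)

Section energy_principle.
Local Open Scope ereal_scope.
Context {R : realType} {n : nat}.
Local Notation T := (g_sigma_algebraType (@open 'rV[R]_n)).
Local Notation leb := (@lebesgue_measure R).
Variables (p : nat) (D M : R).
Hypotheses (D0 : (0 < D)%R) (MD : (2 * M <= D)%R).
Local Notation S := (eball M : set T).
Implicit Types (mu la : borel_probability R n).

Let mS : measurable S.
Proof. by apply: closed_measurable_rV; exact: closed_eball. Qed.

Definition gauss_kernel (a t : R) : R := mixing_weight p a *
  (expR (- (a * Num.min D t) ^+ 2) - expR (- (a * D) ^+ 2)).

Lemma gauss_kernel_ge0 a t : (0 <= t)%R -> (0 <= gauss_kernel a t)%R.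
Proof.
move=> t0; rewrite mulr_ge0 ?mixing_weight_ge0// subr_ge0 ler_expR lerN2.
rewrite !exprMn ler_wpM2l ?sqr_ge0// lerXn2r// ?nnegrE ?(ltW D0) ?ge_min ?lexx//.
by rewrite le_min (ltW D0).
Qed.

Definition gauss_mutual (a : R) mu la : \bar R :=
  \int[la]_x \int[mu]_y (gauss_kernel a (enorm ((x : 'rV[R]_n) - (y : 'rV[R]_n))))%:E.

Lemma measurable_gauss_kernel3 : measurable_fun setT
  (fun z : (T * R) * T => (gauss_kernel z.1.2 (enorm ((z.1.1 : 'rV[R]_n) - (z.2 : 'rV[R]_n))))%:E).
Proof.
have m12 : measurable_fun setT (fun z : (T * R) * T => z.1.2).
  exact: (measurableT_comp measurable_snd measurable_fst).
have mc i : measurable_fun setT (fun z : (T * R) * T =>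
    ((z.1.1 : 'rV[R]_n) - (z.2 : 'rV[R]_n))%R ord0 i).
  rewrite (_ : (fun _ => _) = (fun z : (T * R) * T =>
      (z.1.1 : 'rV[R]_n) ord0 i - (z.2 : 'rV[R]_n) ord0 i)%R); last first.
    by apply/funext => z; rewrite !mxE.
  apply: measurable_funB.
    apply: (measurableT_comp (measurable_coord i)).
    exact: (measurableT_comp measurable_fst measurable_fst).
  exact: (measurableT_comp (measurable_coord i) measurable_snd).
have md : measurable_fun setT (fun z : (T * R) * T =>
    enorm ((z.1.1 : 'rV[R]_n) - (z.2 : 'rV[R]_n))).
  exact: measurable_enorm_comp.
apply/measurable_EFinP; apply: measurable_funM.
  exact: (measurableT_comp (measurable_mixing_weight p) m12).
apply: measurable_funB.
  apply: measurableT_comp => //; apply: measurableT_comp => //.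
  apply: measurable_funX; apply: measurable_funM => //.
  by apply: measurable_minr.
apply: measurableT_comp => //; apply: measurableT_comp => //.
by apply: measurable_funX; apply: measurable_funM.
Qed.

Lemma measurable_gauss_kernel2 a : measurable_fun setT
  (fun z : T * T => (gauss_kernel a (enorm ((z.1 : 'rV[R]_n) - (z.2 : 'rV[R]_n))))%:E).
Proof.
have m1 : measurable_fun setT (fun z : T * T => ((z.1, a), z.2)).
  exact: measurable_fun_pair (measurable_fun_pair measurable_fst (measurable_cst _)) measurable_snd.
exact: (measurableT_comp measurable_gauss_kernel3 m1).
Qed.

(** In the ball distances are at most [2 * M <= D], so the cap is inactive. The subtracted Gaussian
    then contributes the same constant for every pair of probability measures and cancels in the
    discrepancy. *)
Lemma gauss_mutualE a mu la : mu S = 1 -> la S = 1 ->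
  gauss_mutual a mu la =
  (mixing_weight p a * (gauss_energy M a mu la - expR (- (a * D) ^+ 2)))%:E.
Proof.
move=> mu1 la1; set w := mixing_weight p a; set e := expR (- (a * D) ^+ 2).
pose G (x y : T) := expR (- (a * enorm ((x : 'rV[R]_n) - (y : 'rV[R]_n))%R) ^+ 2)%R.
have mG : measurable_fun setT (fun z : T * T => (G z.1 z.2)%:E).
  apply/measurable_EFinP; apply: measurableT_comp => //; apply: measurableT_comp => //.
  by apply: measurable_funX; apply: measurable_funM => //; exact: measurable_dist2.
have bG x : bounded_mfun S (G x).
  split; last first.
    exists 1%R => y _; rewrite ger0_norm ?expR_ge0// expR_le1 oppr_le0; exact: sqr_ge0.
  apply: measurableT_comp => //; apply: measurableT_comp => //.
  by apply: measurable_funX; apply: measurable_funM => //; exact: measurable_dist.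
pose g (x : T) := (\int[mu]_(y in S) G x y)%R.
have gE x : (g x)%:E = \int[mu]_y (G x y)%:E.
  rewrite -bounded_mfun_EFin// integral_prob_full//.
  by apply/measurable_EFinP; case: (bG x).
have bg : bounded_mfun S g.
  split.
    apply/measurable_EFinP; rewrite (_ : EFin \o g = fun x => \int[mu]_y (G x y)%:E); last first.
      by apply/funext => x; rewrite /= gE.
    apply: (@measurable_fun_fubini_tonelli_F _ _ T T R mu _ mG) => z.
    by rewrite lee_fin expR_ge0.
  exists 1%R => x _; rewrite ger0_norm; last first.
    by apply: Rintegral_ge0 => y _; exact: expR_ge0.
  rewrite -lee_fin gE -[leRHS](prob_integral_cst mu); apply: ge0_le_integral => //.
  - by move=> y _; rewrite lee_fin expR_ge0.
  - by apply/measurable_EFinP; case: (bG x).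
  - by move=> y _; rewrite lee_fin expR_le1 oppr_le0; exact: sqr_ge0.
have affine (m : borel_probability R n) (h : T -> R) : m S = 1 -> bounded_mfun S h ->
    (\int[m]_(x in S) (w * (h x - e)) = w * ((\int[m]_(x in S) h x) - e))%R.
  move=> m1 bh; rewrite RintegralZl//; last first.
    apply: bounded_mfun_integrable => //; apply: bounded_mfunD => //.
    exact: bounded_mfun_cst.
  rewrite RintegralB//; last 2 first.
  - exact: bounded_mfun_integrable.
  - by apply: bounded_mfun_integrable => //; exact: bounded_mfun_cst.
  by rewrite prob_Rintegral_cst.
have baff (h : T -> R) : bounded_mfun S h -> bounded_mfun S (fun x => w * (h x - e))%R.
  move=> bh; apply: bounded_mfunM; first exact: bounded_mfun_cst.
  by apply: bounded_mfunD => //; exact: bounded_mfun_cst.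
rewrite /gauss_mutual -(integral_prob_full mS la1); last first.
  apply: (@measurable_fun_fubini_tonelli_F _ _ T T R mu _ (measurable_gauss_kernel2 a)) => z.
  by rewrite lee_fin gauss_kernel_ge0// enorm_ge0.
transitivity (\int[la]_(x in S) (w * (g x - e))%:E).
  apply: eq_integral => x /set_mem xM.
  rewrite -(integral_prob_full mS mu1); last first.
    exact: (measurable_fun_pair2 (x : T) (measurable_gauss_kernel2 a)).
  transitivity (\int[mu]_(y in S) (w * (G x y - e))%:E).
    apply: eq_integral => y /set_mem yM; rewrite /gauss_kernel (min_idPr _)//.
    rewrite (le_trans _ MD)// (le_trans (ler_enormD _ _))// enormN.
    have := xM; have := yM; rewrite /eball/= => h1 h2.
    by rewrite mulr2n mulrDl !mul1r lerD.
  by rewrite bounded_mfun_EFin ?affine//; exact: baff.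
by rewrite bounded_mfun_EFin ?affine//; exact: baff.
Qed.

Lemma mutual_gauss_mixture : exists2 c : R, (0 < c)%R & forall mu la,
  c%:E * mutual p D mu la = \int[leb]_a gauss_mutual a mu la /\
  measurable_fun setT (fun a : measurableTypeR R => gauss_mutual a mu la).
Proof.
have [c c0 cE] := kap_mixture p D0; exists c => // mu la.
have k0 (z : (T * R) * T) : 0 <= (gauss_kernel z.1.2
    (enorm ((z.1.1 : 'rV[R]_n) - (z.2 : 'rV[R]_n))%R))%:E.
  by rewrite lee_fin gauss_kernel_ge0// enorm_ge0.
have mF := @measurable_fun_fubini_tonelli_F _ _ _ T R mu _ measurable_gauss_kernel3 k0.
have F0 (z : T * R) : 0 <= fubini_F mu (fun z : (T * R) * T => (gauss_kernel z.1.2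
    (enorm ((z.1.1 : 'rV[R]_n) - (z.2 : 'rV[R]_n))%R))%:E) z.
  by apply: integral_ge0 => y _; exact: (k0 (z, y)).
have swap1 x : \int[mu]_y \int[leb]_a
    (gauss_kernel a (enorm ((x : 'rV[R]_n) - (y : 'rV[R]_n))%R))%:E =
    \int[leb]_a \int[mu]_y (gauss_kernel a (enorm ((x : 'rV[R]_n) - (y : 'rV[R]_n))%R))%:E.
  have m1 : measurable_fun setT (fun z : T * R => (((x : T), z.2), z.1)).
    exact: measurable_fun_pair (measurable_fun_pair (measurable_cst _) measurable_snd) measurable_fst.
  have m2 := measurableT_comp measurable_gauss_kernel3 m1.
  apply: (@fubini_tonelli _ _ T _ R mu leb _ m2) => z.
  exact: (k0 (((x : T), z.2), z.1)).
split; last first.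
  exact: (@measurable_fun_fubini_tonelli_G _ _ T _ R la _ mF F0).
rewrite -[RHS](@fubini_tonelli _ _ T _ R la leb _ mF F0) /mutual.
rewrite -ge0_integralZl_EFin//; last 3 first.
- by move=> x _; exact: pot_ge0.
- exact: measurable_pot.
- exact: ltW.
apply: eq_integral => x _; rewrite /pot -ge0_integralZl_EFin//; last 3 first.
- by move=> y _; exact: kap_ge0.
- exact: measurable_kap_dist.
- exact: ltW.
rewrite -[RHS]swap1; apply: eq_integral => y _; rewrite cE//; exact: enorm_ge0.
Qed.

Lemma gauss_mutual_ge0 a mu la : 0 <= gauss_mutual a mu la.
Proof.
apply: integral_ge0 => x _; apply: integral_ge0 => y _.
by rewrite lee_fin gauss_kernel_ge0// enorm_ge0.
Qed.

Lemma gauss_mutual_le a mu la : mu S = 1 -> la S = 1 ->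
  2%:E * gauss_mutual a mu la <= gauss_mutual a mu mu + gauss_mutual a la la.
Proof.
move=> mu1 la1; rewrite !gauss_mutualE// -EFinM -EFinD lee_fin.
have [a0|a0] := ltP 0%R a; last first.
  have -> : mixing_weight p a = 0%R by rewrite /mixing_weight ltNge a0.
  by rewrite !mul0r addr0 mulr0.
have [D1 _] := gauss_energy_diff a0 mu1 la1.
have := mulr_ge0 (mixing_weight_ge0 p a) D1; lra.
Qed.

(** The inequality holds for each Gaussian width and is integrated over the mixture. No difference
    is formed because energies may be infinite. *)
Lemma mutual_le mu la : mu S = 1 -> la S = 1 ->
  2%:E * mutual p D mu la <= mutual p D mu mu + mutual p D la la.
Proof.
move=> mu1 la1; have [c c0 cE] := mutual_gauss_mixture.
have c0' : (0 <= c)%R by exact: ltW.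
rewrite -(@lee_pmul2l _ c%:E)// (muleCA c%:E).
rewrite [leRHS](ge0_muleDr _ (mutual_ge0 _ D0 mu mu) (mutual_ge0 _ D0 la la)).
have [E1 m1] := cE mu la; have [E2 m2] := cE mu mu; have [E3 m3] := cE la la.
rewrite E1 E2 E3 -ge0_integralD//; last 2 first.
- by move=> a _; exact: gauss_mutual_ge0.
- by move=> a _; exact: gauss_mutual_ge0.
rewrite -ge0_integralZl_EFin//; last by move=> a _; exact: gauss_mutual_ge0.
apply: ge0_le_integral => //.
- by move=> a _; rewrite mule_ge0// gauss_mutual_ge0.
- exact: measurable_funeM.
- exact: emeasurable_funD.
- by move=> a _; exact: gauss_mutual_le.
Qed.

(** Equality after integration forces equality for almost every width, hence for some [a > 0], and a
    single width already determines the measure. *)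
Lemma mutual_determines mu la : mu S = 1 -> la S = 1 ->
  mutual p D mu la < +oo ->
  mutual p D mu mu + mutual p D la la <= 2%:E * mutual p D mu la ->
  forall B : set T, measurable B -> mu B = la B.
Proof.
move=> mu1 la1 mloo; have [c c0 cE] := mutual_gauss_mixture.
have c0' : (0 <= c)%R by exact: ltW.
rewrite -(@lee_pmul2l _ c%:E)// (muleCA c%:E) ge0_muleDr ?mutual_ge0//.
have [E1 m1] := cE mu la; have [E2 m2] := cE mu mu; have [E3 m3] := cE la la.
have fin1 : \int[leb]_a gauss_mutual a mu la < +oo.
  by rewrite -E1 lte_mul_pinfty// ge0_fin_numE ?mutual_ge0.
rewrite E1 E2 E3 -ge0_integralD//; last 2 first.
- by move=> a _; exact: gauss_mutual_ge0.
- by move=> a _; exact: gauss_mutual_ge0.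
rewrite -ge0_integralZl_EFin//; last by move=> a _; exact: gauss_mutual_ge0.
set f := (fun a => 2%:E * _); set g := (fun a => _ + _) => gf.
have f0 a : 0 <= f a by rewrite mule_ge0// gauss_mutual_ge0.
have g0 a : 0 <= g a by rewrite adde_ge0// gauss_mutual_ge0.
have mf : measurable_fun setT f by exact: measurable_funeM.
have mg : measurable_fun setT g by exact: emeasurable_funD.
have foo : \int[leb]_a f a < +oo.
  rewrite ge0_integralZl_EFin//; last by move=> a _; exact: gauss_mutual_ge0.
  by rewrite lte_mul_pinfty// ge0_fin_numE// integral_ge0// => a _; exact: gauss_mutual_ge0.
have i1 : leb.-integrable setT f.
  by apply/integrableP; split => //; under eq_integral do rewrite gee0_abs//.
have i2 : leb.-integrable setT g.
  apply/integrableP; split => //; under eq_integral do rewrite gee0_abs//.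
  exact: le_lt_trans foo.
have fg : {ae leb, forall a, setT a -> f a <= g a}.
  by apply: aeW => a _; exact: gauss_mutual_le.
have [N [mN N0 NH]] := ae_eq_of_le measurableT i1 i2 fg gf.
have [a [a0 aE]] : exists a, (0 < a)%R /\ f a = g a.
  apply: contrapT => /forallNP H.
  have : leb `]0%R, 1%R[ <= 0.
    rewrite -N0 le_measure ?inE//= => a /=; rewrite in_itv/= => /andP[a0 _].
    by apply: NH => /= /(_ Logic.I) E; apply: (H a).
  by rewrite lebesgue_measure_itv/= lte_fin ltr01 -EFinB lee_fin subr0 ler10.
apply: (@gauss_energy_determines _ _ M a a0 mu la mu1 la1).
move: aE; rewrite /f /g !gauss_mutualE// -EFinM -EFinD => -[] {}aE.
rewrite -(@ler_pM2l _ (mixing_weight p a)) ?mixing_weight_gt0// mulr0.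
lra.
Qed.

End energy_principle.

Section uniqueness.
Local Open Scope ereal_scope.
Context {R : realType} {n : nat}.
Local Notation T := (g_sigma_algebraType (@open 'rV[R]_n)).
Variables (p : nat) (D M : R).
Hypotheses (D0 : (0 < D)%R) (MD : (2 * M <= D)%R).

(** The variational inequality bounds the mutual energy below by the common energy of both
    minimizers, which is the equality case of [mutual_le]. *)
Lemma minimizer_unique (K : set T) (mu nu : borel_probability R n) :
  measurable K -> K `<=` eball M -> minimizer p D K mu -> minimizer p D K nu ->
  mutual p D mu mu < +oo ->
  forall B : set T, measurable B -> mu B = nu B.
Proof.
move=> mK KM muP nuP fin.
have mS : measurable (eball M : set T).
  by apply: closed_measurable_rV; exact: closed_eball.
have mu1 := prob_full_sub mK mS KM muP.1.
have nu1 := prob_full_sub mK mS KM nuP.1.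
have E : mutual p D nu nu = mutual p D mu mu.
  by apply/eqP; rewrite eq_le nuP.2 ?muP.2 ?muP.1 ?nuP.1.
have ge : mutual p D mu mu <= mutual p D mu nu.
  by apply: (minimizer_mutual_ge D0 muP nuP.1) => //; rewrite E.
have /fineK aE : mutual p D mu mu \is a fin_num by exact: fin_num_mutual.
have le2 := mutual_le p D0 MD mu1 nu1.
have boo : mutual p D mu nu < +oo.
  move: le2; rewrite E -aE -EFinD; case: (mutual p D mu nu) => [b| |]//.
    by rewrite ltey.
  by rewrite mulry gtr0_sg ?mul1e.
have /fineK bE : mutual p D mu nu \is a fin_num by exact: fin_num_mutual.
apply: (mutual_determines D0 MD mu1 nu1 boo).
by move: ge; rewrite E -aE -bE -EFinD -EFinM !lee_fin; lra.
Qed.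

End uniqueness.

(** * Truncated potentials *)

Section truncated_potential.
Context {R : realType} {n : nat}.
Local Notation T := (g_sigma_algebraType (@open 'rV[R]_n)).
Variables (p : nat) (D : R).
Hypothesis D0 : 0 < D.
Variables (mu : borel_probability R n).
Implicit Types (i j : nat) (F : set T) (x : 'rV[R]_n).

Lemma kapt_le0 j t : 0 <= t -> kapt p D j t <= kapt p D j 0.
Proof. exact: kapt_nincr. Qed.

Lemma bounded_kapt_dist j F x :
  bounded_mfun F (fun y : T => kapt p D j (enorm (x - (y : 'rV[R]_n)))).
Proof.
split.
  exact: (measurableT_comp (measurable_kapt p D0 j) (measurable_dist x)).
exists (kapt p D j 0) => y _; rewrite ger0_norm ?kapt_ge0//.
by rewrite kapt_le0// enorm_ge0.
Qed.

(** The restriction to [F] allows mass to be discarded outside a set on whose points the truncation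
    error is uniformly small. *)
Definition tpot j F x : R :=
  (\int[mu]_(y in F) kapt p D j (enorm (x - (y : 'rV[R]_n))))%R.

Lemma EFin_tpot j F x : measurable F ->
  ((tpot j F x)%:E = \int[mu]_(y in F) (kapt p D j (enorm (x - (y : 'rV[R]_n))))%:E)%E.
Proof. by move=> mF; rewrite bounded_mfun_EFin//; exact: bounded_kapt_dist. Qed.

Lemma tpot_le_pot j F x : measurable F -> ((tpot j F x)%:E <= pot p D mu x)%E.
Proof.
move=> mF; rewrite EFin_tpot//.
apply: (@le_trans _ _ (\int[mu]_(y in F) kap p D (enorm (x - (y : 'rV[R]_n))))%E).
  apply: ge0_le_integral => //.
  - by move=> y _; rewrite lee_fin kapt_ge0.
  - by apply/measurable_EFinP; apply: measurable_funTS; case: (bounded_kapt_dist j F x).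
  - by apply: measurable_funTS; exact: measurable_kap_dist.
  - by move=> y _; exact: kapt_le_kap.
apply: ge0_subset_integral => //; first exact: measurable_kap_dist.
by move=> y _; exact: kap_ge0.
Qed.

Lemma tpot_nd i j F x : measurable F -> (i <= j)%N -> tpot i F x <= tpot j F x.
Proof.
move=> mF ij; apply: bounded_Rintegral_le => //; try exact: bounded_kapt_dist.
by move=> y _; exact: kapt_nd.
Qed.

Lemma tpot_cvg x : (tpot j setT x)%:E @[j --> \oo] --> pot p D mu x.
Proof.
under eq_fun do rewrite EFin_tpot//.
have -> : pot p D mu x = (\int[mu]_y lim ((kapt p D j (enorm (x - (y : 'rV[R]_n))))%:E @[j --> \oo]))%E.
  by apply: eq_integral => y _; apply/esym/cvg_lim => //; exact: kapt_cvg.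
apply: cvg_monotone_convergence => //.
- by move=> j; apply/measurable_EFinP; case: (bounded_kapt_dist j setT x).
- by move=> j y _; rewrite lee_fin kapt_ge0.
- by move=> y _ i j ij; rewrite lee_fin kapt_nd.
Qed.

Lemma tpot_lipschitz j F x x' : measurable F ->
  `|tpot j F x - tpot j F x'| <= newton_lip p (radius D j) * enorm (x - x').
Proof.
move=> mF; rewrite -bounded_RintegralB//; try exact: bounded_kapt_dist.
have L0 : 0 <= newton_lip p (radius D j) by exact/newton_lip_ge0/radius_gt0.
apply: norm_Rintegral_le => //.
- by rewrite mulr_ge0// enorm_ge0.
- by apply: bounded_mfunB => //; exact: bounded_kapt_dist.
move=> y _; rewrite (le_trans (kapt_lipschitz _ _ _ _ _))// ler_wpM2l//.
rewrite ler_norml lerBlDr lerNl opprB lerBlDr ler_enorm_dist/=.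
by rewrite [enorm (x - x')]enormB ler_enorm_dist.
Qed.

Lemma continuous_tpot j F : measurable F -> continuous (tpot j F).
Proof.
move=> mF x; apply/(@cvgrPdist_le _ _ _ (nbhs x) (nbhs_filter x)) => /= eps eps0.
set L := newton_lip p (radius D j).
have L0 : 0 <= L by exact/newton_lip_ge0/radius_gt0.
have : enorm (x - x') @[x' --> x] --> enorm (x - x) by exact: continuous_enormB.
rewrite subrr enorm0 => /(@cvgrPdist_le _ _ _ (nbhs x) (nbhs_filter x))/(_ (eps / (L + 1))).
have L1 : 0 < L + 1 by rewrite ltr_pwDr.
move=> /(_ (divr_gt0 eps0 L1)); apply: filterS => x'.
rewrite sub0r normrN ger0_norm ?enorm_ge0// ler_pdivlMr// => H.
rewrite (le_trans (tpot_lipschitz _ _ _ mF))// (le_trans _ H)// mulrC ler_wpM2l ?enorm_ge0//.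
by rewrite lerDl.
Qed.

Lemma tpot_diff_le i j F x : measurable F -> (j <= i)%N ->
  tpot i F x - tpot j F x <= tpot i setT x - tpot j setT x.
Proof.
move=> mF ji; rewrite -!bounded_RintegralB//; try exact: bounded_kapt_dist.
have b G : bounded_mfun G (fun y : T => kapt p D i (enorm (x - (y : 'rV[R]_n))) -
    kapt p D j (enorm (x - (y : 'rV[R]_n)))).
  by apply: bounded_mfunB => //; exact: bounded_kapt_dist.
rewrite -lee_fin -!bounded_mfun_EFin//; apply: ge0_subset_integral => //.
  by apply/measurable_EFinP; case: (b setT).
by move=> y _; rewrite lee_fin subr_ge0 kapt_nd.
Qed.

(** Carries a truncation error from [x'] to points within two radii, at the price of one level and a
    factor [3 ^+ p]: there [enorm (x' - y)] is at most three times the larger of [enorm (x - y)] and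
    [radius D i.+1]. *)
Lemma tpot_scale i j F x x' : measurable F -> (j <= i)%N ->
  enorm (x - x') <= 2 * radius D i.+1 ->
  tpot i.+1 F x - tpot j.+1 F x <= 3 ^+ p * (tpot i F x' - tpot j F x').
Proof.
move=> mF ji xx'; rewrite -!bounded_RintegralB//; try exact: bounded_kapt_dist.
rewrite -bounded_RintegralZ//; last by apply: bounded_mfunB => //; exact: bounded_kapt_dist.
apply: bounded_Rintegral_le => //.
- by apply: bounded_mfunB => //; exact: bounded_kapt_dist.
- by apply: bounded_mfunZ => //; apply: bounded_mfunB => //; exact: bounded_kapt_dist.
move=> y _; apply: kapt_scale => //.
rewrite (le_trans (ler_enorm_dist _ x _))// enormB.
set m := Num.max _ _.
have h1 : enorm (x - (y : 'rV[R]_n)) <= m by rewrite le_max lexx.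
have h2 : radius D i.+1 <= m by rewrite le_max lexx orbT.
lra.
Qed.

Lemma tpot_splitT j F x : measurable F ->
  tpot j setT x <= tpot j F x + kapt p D j 0 * fine (mu (~` F)).
Proof.
move=> mF.
have -> : tpot j setT x = tpot j F x + tpot j (~` F) x.
  apply: EFin_inj; rewrite EFinD !EFin_tpot//; last exact: measurableC.
  rewrite -(setUv F) ge0_integral_setU//.
  - exact: measurableC.
  - by rewrite setUv; apply/measurable_EFinP; case: (bounded_kapt_dist j setT x).
  - by move=> y _; rewrite lee_fin kapt_ge0.
  - exact/disj_setPCl.
rewrite lerD2l; apply: Rintegral_le_cst.
- exact: measurableC.
- exact: bounded_kapt_dist.
- by move=> y _; rewrite kapt_le0// enorm_ge0.
Qed.

End truncated_potential.

(** * The maximum principle for potentials *)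

Lemma ae_and d (T : measurableType d) (R : realType) (mu : probability T R)
    (P Q : T -> Prop) : {ae mu, forall x, P x} -> {ae mu, forall x, Q x} ->
  {ae mu, forall x, P x /\ Q x}.
Proof. by apply: filterS2 => x. Qed.

Lemma prob_exhaustion d (T : measurableType d) (R : realType) (mu : probability T R)
    (F : nat -> set T) (eta : R) : (forall N, measurable (F N)) ->
  nondecreasing_seq F -> mu (\bigcup_N F N) = 1%E -> 0 < eta ->
  exists N, fine (mu (~` F N)) <= eta.
Proof.
move=> mF nd cov eta0.
have := nondecreasing_cvg_mu (mu := mu) mF (bigcupT_measurable _ mF) nd.
rewrite [X in _ --> X]cov => /fine_cvgP[_] /cvgrPdist_le/(_ _ eta0)[N _ /(_ N (leqnn N))/=].
rewrite ler_norml => /andP[_ h]; exists N.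
by rewrite probability_setC// fineB ?fin_num_measure.
Qed.

Section truncated_potential_jets.
Context {R : realType} {n : nat}.
Local Notation T := (g_sigma_algebraType (@open 'rV[R]_n)).
Local Notation p := (n - 2)%N.
Variables (D : R) (mu : borel_probability R n).
Hypotheses (n1 : (1 < n)%N) (D0 : 0 < D).
Implicit Types (j : nat) (F : set T) (x : 'rV[R]_n).

Local Notation e i := (delta_mx ord0 i : 'rV[R]_n).

Lemma enorm_addZ_delta x h i : 0 <= h -> enorm (x + h *: e i) <= enorm x + h.
Proof. by move=> h0; rewrite (le_trans (ler_enormD _ _))// enormZ enorm_delta mulr1 ger0_norm. Qed.

Lemma enorm_subZ_delta x h i : 0 <= h -> enorm (x - h *: e i) <= enorm x + h.
Proof.
by move=> h0; rewrite (le_trans (ler_enormD _ _))// enormN enormZ enorm_delta mulr1 ger0_norm.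
Qed.

(** Both hypotheses on distances keep the clamp inactive at [x] and at the shifted points, so only
    the exact kernel is seen and its discrete harmonicity is integrated. *)
Lemma tpot_second_diff j F x (d : R) : measurable F -> 0 < d ->
  (forall y, F y -> 2 * radius D j <= enorm (x - (y : 'rV[R]_n))) ->
  (forall y, F y -> enorm (x - (y : 'rV[R]_n)) + d <= D) ->
  exists2 C, 0 <= C & exists2 d', 0 < d' & forall h, 0 < h -> h < d' ->
    `|second_diff (tpot p D mu j F) x h| <= C * h ^+ 3.
Proof.
move=> mF d0 far near; set rho := radius D j.
have rho0 : 0 < rho by exact: radius_gt0.
have [|C C0 HC] := @newton_second_diff R n (2 * rho) n1; first by rewrite mulr_gt0.
(* A step below [rho / 3] leaves distances of at least [2 * rho] above [rho], and meets the
   condition [6 * h <= 2 * rho] of the kernel estimate. *)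
exists C => //; exists (Num.min d (rho / 3)); first by rewrite lt_min d0 divr_gt0.
move=> h h0; rewrite lt_min => /andP[hd hrho].
pose g (y : T) := second_diff (fun x => kapt p D j (enorm (x - (y : 'rV[R]_n)))) x h.
have bk z := bounded_kapt_dist p D0 j F z.
have bi i : bounded_mfun F (fun y : T =>
    kapt p D j (enorm (x + h *: e i - (y : 'rV[R]_n))) +
    kapt p D j (enorm (x - h *: e i - (y : 'rV[R]_n))) -
    2 * kapt p D j (enorm (x - (y : 'rV[R]_n)))).
  by apply: bounded_mfunB => //; [exact: bounded_mfunD|exact: bounded_mfunZ].
have bg : bounded_mfun F g by exact: bounded_mfun_sum.
have -> : second_diff (tpot p D mu j F) x h = (\int[mu]_(y in F) g y)%R.
  rewrite [RHS]bounded_Rintegral_sum//; apply: eq_bigr => i _.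
  rewrite bounded_RintegralB//; last 2 first.
  - exact: bounded_mfunD.
  - exact: bounded_mfunZ.
  by rewrite bounded_RintegralD// bounded_RintegralZ.
apply: norm_Rintegral_le => //; first by rewrite mulr_ge0// exprn_ge0// ltW.
move=> y Fy; set z := x - (y : 'rV[R]_n).
have h0' := ltW h0.
have zD := near _ Fy; have zrho := far _ Fy.
rewrite -/z in zD zrho; rewrite -/rho in zrho.
have -> : g y = second_diff (fun z => newton p (enorm z)) z h.
  apply: eq_bigr => i _.
  have -> : x + h *: e i - (y : 'rV[R]_n) = z + h *: e i by rewrite addrAC.
  have -> : x - h *: e i - (y : 'rV[R]_n) = z - h *: e i by rewrite addrAC.
  have lo1 : enorm z <= enorm (z + h *: e i) + h.
    by rewrite -[X in enorm X <= _](addrK (h *: e i)) enorm_subZ_delta.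
  have lo2 : enorm z <= enorm (z - h *: e i) + h.
    by rewrite -[X in enorm X <= _](subrK (h *: e i)) enorm_addZ_delta.
  have up1 := enorm_addZ_delta z i h0'.
  have up2 := enorm_subZ_delta z i h0'.
  rewrite !kaptE -/rho; [ring|lra..].
by apply: HC => //; lra.
Qed.

Lemma second_diffN (f : 'rV[R]_n -> R) x h :
  second_diff (fun x => - f x) x h = - second_diff f x h.
Proof. by rewrite /second_diff -sumrN; apply: eq_bigr => i _; ring. Qed.

Lemma asymp_subharmonic_tpot j F x (d : R) : measurable F -> 0 < d ->
  (forall y, F y -> 2 * radius D j <= enorm (x - (y : 'rV[R]_n))) ->
  (forall y, F y -> enorm (x - (y : 'rV[R]_n)) + d <= D) ->
  asymp_subharmonic (tpot p D mu j F) x /\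
  asymp_subharmonic (fun x => - tpot p D mu j F x) x.
Proof.
move=> mF d0 far near; have [C C0 [d' d'0 H]] := tpot_second_diff mF d0 far near.
suff key f : (forall h, 0 < h -> h < d' -> `|second_diff f x h| <= C * h ^+ 3) ->
    asymp_subharmonic f x.
  by split; apply: key => // h h0 hd; rewrite ?second_diffN ?normrN H.
move=> {}H eps eps0.
exists (Num.min d' (eps / (C + 1))); first by rewrite lt_min d'0 divr_gt0// ltr_pwDr.
move=> h h0; rewrite lt_min => /andP[hd].
rewrite ltr_pdivlMr ?ltr_pwDr// => heps.
have := H _ h0 hd; rewrite ler_norml => /andP[H1 _]; apply: le_trans H1.
rewrite mulNr lerN2 exprS mulrA ler_wpM2r ?sqr_ge0//; nra.
Qed.

End truncated_potential_jets.

Section potential_maximum_principle.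
Local Open Scope ereal_scope.
Context {R : realType} {n : nat}.
Local Notation T := (g_sigma_algebraType (@open 'rV[R]_n)).
Local Notation p := (n - 2)%N.
Variables (M : R) (K : set T) (mu : borel_probability R n) (v : R).
Hypotheses (n1 : (1 < n)%N) (M0 : (0 < M)%R).
Hypotheses (mK : measurable K) (KM : K `<=` eball M) (muK : mu K = 1).
Local Notation D := (4 * M)%R.

Let D0 : (0 < D)%R. Proof. by rewrite mulr_gt0. Qed.

Hypothesis muv : {ae mu, forall x, pot p D mu x <= v%:E}.

(** An Egorov set: a single level [N] approximates the potential within [theta] at all of its
    points. *)
Let good (theta : R) (N : nat) : set T :=
  K `&` [set x | pot p D mu x <= v%:E /\ pot p D mu x <= (tpot p D mu N setT x + theta)%:E].

Let measurable_good theta N : measurable (good theta N).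
Proof.
apply: measurableI => //.
have mpot := measurable_pot p D0 mu.
have mt : measurable_fun setT (fun x : T => (tpot p D mu N setT x + theta)%:E).
  apply/measurable_EFinP; apply: measurable_funD => //.
  by apply: continuous_measurable_rV; exact: continuous_tpot.
apply: measurableI.
  by rewrite -[X in measurable X]setTI; exact: (measurable_lee measurableT mpot (measurable_cst _)).
by rewrite -[X in measurable X]setTI; exact: (measurable_lee measurableT mpot mt).
Qed.

Let good_measure theta eta : (0 < theta)%R -> (0 < eta)%R ->
  exists N, (fine (mu (~` good theta N)) <= eta)%R.
Proof.
move=> th0 eta0.
have nd : nondecreasing_seq (good theta).
  move=> i j ij; apply/subsetPset => x [Kx [h1 h2]]; split => //; split => //.
  by rewrite (le_trans h2)// lee_fin lerD2r tpot_nd.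
have cov : mu (\bigcup_N good theta N) = 1.
  apply: ae_prob_full; first by apply: bigcupT_measurable => N; exact: measurable_good.
  have := ae_and muv (prob_full_ae mK muK); apply: filterS => x [xv Kx].
  have xfin : pot p D mu x \is a fin_num.
    by rewrite ge0_fin_numE ?pot_ge0// (le_lt_trans xv)// ltry.
  have := @tpot_cvg R n p D D0 mu x; rewrite -(fineK xfin) => /fine_cvgP[_].
  move=> /cvgrPdist_le/(_ _ th0)[N _ /(_ N (leqnn N))/=].
  rewrite ler_norml => /andP[_ h]; exists N => //; split => //; split => //.
  by rewrite -(fineK xfin) lee_fin -lerBlDl.
apply: (@prob_exhaustion _ _ R mu (good theta) eta _ nd cov eta0) => N.
exact: measurable_good.
Qed.

(** Provides the boundary values of the maximum principle: points of norm [3 * M] are at distance at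
    least [2 * M] from [K], while points of [K] are at most [2 * M] apart. *)
Let kap_le : kap p D (2 * M) <= v%:E.
Proof.
have [x [Kx xv]] : exists x, K x /\ pot p D mu x <= v%:E.
  apply: contrapT => /forallNP H.
  have [N [mN N0 NH]] : {ae mu, forall x, pot p D mu x <= v%:E /\ K x}.
    exact: ae_and muv (prob_full_ae mK muK).
  have : mu setT <= 0.
    rewrite -N0 le_measure ?inE// => x _; apply: NH => /= -[h1 h2].
    by apply: (H x).
  by rewrite probability_setT lee_fin ler10.
apply: le_trans xv; rewrite /pot -(integral_prob_full mK muK); last exact: measurable_kap_dist.
have -> : kap p D (2 * M) = \int[mu]_(y in K) (cst (kap p D (2 * M))) y.
  by rewrite (integral_prob_full mK muK)// prob_integral_cst.
apply: ge0_le_integral => //.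
- by move=> y _; exact: kap_ge0.
- by apply: measurable_funTS; exact: measurable_kap_dist.
move=> y /KM yM; apply: kap_nincr => //.
rewrite (le_trans (ler_enormD _ _))// enormN.
by have := KM Kx; move: yM; rewrite /eball/=; lra.
Qed.

(** The maximum principle is applied to the truncated potential of the mass in [F]. Two radii or
    more away from [F] this potential is harmonic. A point closer to some [y] in [F] inherits the
    bound at [y] by scaling, up to [(3 ^+ p + 1) * theta]. The discarded mass costs at most
    [kapt p D i 0 * eta], and [i] is fixed before [theta] and [eta]. *)
Lemma tpot_le_of_ae i x : (enorm x <= 3 * M)%R -> (tpot p D mu i setT x <= v)%R.
Proof.
move=> xM.
have P0 : (0 < (3 : R) ^+ p + 1)%R by rewrite ltr_pwDr// exprn_ge0.
suff H theta eta : (0 < theta)%R -> (0 < eta)%R ->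
    (tpot p D mu i setT x <= v + (3 ^+ p + 1) * theta + kapt p D i 0 * eta)%R.
  apply/ler_addgt0Pr => eps eps0.
  have k0 : (0 <= kapt p D i 0)%R by exact: kapt_ge0.
  have k1 : (0 < kapt p D i 0 + 1)%R by rewrite ltr_pwDr.
  have := H (eps / 2 / (3 ^+ p + 1))%R (eps / 2 / (kapt p D i 0 + 1))%R.
  rewrite !divr_gt0// => /(_ isT isT) h; rewrite (le_trans h)// -addrA lerD2l.
  rewrite mulrC divfK ?gt_eqF// [leRHS](splitr eps) lerD2l mulrCA ger_pMr ?divr_gt0//.
  by rewrite ler_pdivrMr// mul1r lerDl.
move=> th0 eta0.
have combine (a b b' s t u v' e : R) : (0 <= 3 ^+ p + 1 :> R)%R ->
    (a - b <= 3 ^+ p * (s - t))%R -> (s - t <= u - e)%R -> (u <= e + theta)%R ->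
    (b - b' <= theta)%R -> (b' <= v')%R -> (a <= v' + (3 ^+ p + 1) * theta)%R.
  move=> _ h1 h2 h3 h4 h5.
  have st : (s - t <= theta)%R by lra.
  have : (3 ^+ p * (s - t) <= 3 ^+ p * theta)%R by rewrite ler_wpM2l ?exprn_ge0.
  lra.
have [N HN] := good_measure th0 eta0.
set F := good theta N in HN.
have mF : measurable F by exact: measurable_good.
set L := newton_lip p (radius D N.+1).
have L0 : (0 <= L)%R by exact/newton_lip_ge0/radius_gt0.
have L1 : (0 < 2 * (L + 1))%R by rewrite mulr_gt0// ltr_pwDr.
have [I HI] := @radius_cvg R D D0 (theta / (2 * (L + 1)))%R (divr_gt0 th0 L1).
(* [F] fixes [N] and with it the Lipschitz constant [L]. Only then is [j] taken so fine that a move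
   by two radii changes the potential of level [N.+1] by at most [theta]. *)
pose j := maxn i (maxn N I).
have ij : (i <= j)%N by rewrite leq_max leqnn.
have Nj : (N <= j)%N by rewrite !leq_max leqnn orbT.
have Ij : (I <= j.+1)%N by rewrite leqW// !leq_max leqnn !orbT.
have rj : (2 * radius D j.+1 * L <= theta)%R.
  have := HI _ Ij; rewrite ler_pdivlMr//.
  have := @radius_gt0 R D D0 j.+1; nra.
set c := (v + (3 ^+ p + 1) * theta)%R.
have main : (tpot p D mu j.+1 F x <= c)%R.
  apply: (@maximum_principle R n (tpot p D mu j.+1 F) (3 * M)%R c (ltnW n1) (continuous_tpot D0 mF) _ _ x xM).
    move=> z zM; apply: (@le_trans _ _ v); last by rewrite lerDl mulr_ge0 ?ltW.
    rewrite -lee_fin; apply: le_trans kap_le; apply: le_trans (kapt_le_kap p D0 j.+1 _).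
    have /andP[m0 m1] := fine_prob_le1 mu mF.
    rewrite lee_fin (@le_trans _ _ (kapt p D j.+1 (2 * M) * fine (mu F))%R)//; last first.
      by rewrite ler_piMr// kapt_ge0.
    apply: Rintegral_le_cst => //; first exact: bounded_kapt_dist.
    move=> y [/KM yM _]; apply: kapt_nincr => //.
    have := ler_enorm_dist z (y : 'rV[R]_n) 0; move: yM.
    by rewrite /eball/= !subr0 zM; lra.
  move=> z zM cz.
  (* Points of [F] have norm at most [M], so adding [3 * M - enorm z] to their distance from [z]
     stays within [D = 4 * M]. *)
  have [| | |h _] := @asymp_subharmonic_tpot R n D mu n1 D0 j.+1 F z (3 * M - enorm z) mF _ _ _ => //.
  - by rewrite subr_gt0.
  - move=> y Fy; rewrite leNgt; apply/negP => /ltW zy; move: cz; apply/negP; rewrite -leNgt.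
    have [_ [yv yN]] := Fy.
    have h1 := tpot_scale p D0 mu mF Nj zy.
    have h2 := tpot_diff_le p D0 mu (y : 'rV[R]_n) mF Nj.
    have h3 : (tpot p D mu j setT (y : 'rV[R]_n) <= tpot p D mu N setT (y : 'rV[R]_n) + theta)%R.
      by rewrite -lee_fin (le_trans _ yN)// tpot_le_pot.
    have h4 : (tpot p D mu N.+1 F (y : 'rV[R]_n) <= v)%R.
      by rewrite -lee_fin (le_trans _ yv)// tpot_le_pot.
    have h5 := tpot_lipschitz p D0 mu N.+1 z (y : 'rV[R]_n) mF.
    have h6 : (newton_lip p (radius D N.+1) * enorm (z - (y : 'rV[R]_n)) <= theta)%R.
      by rewrite (le_trans _ rj)// mulrC ler_wpM2r.
    have := le_trans h5 h6; rewrite ler_norml => /andP[_ h7].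
    rewrite /c.
    have X1 := combine _ _ _ _ _ _ _ _ (ltW P0) h1.
    have X2 := X1 _ _ _ _ h2 h3 h7 h4.
    exact: X2.
  - move=> y [/KM yM _]; have := ler_enormD z (- (y : 'rV[R]_n))%R; move: yM.
    by rewrite /eball/= enormN; lra.
have h := tpot_splitT p D0 mu i x mF.
have h' := tpot_nd p D0 mu x mF (leqW ij).
have h'' : (kapt p D i 0 * fine (mu (~` F)) <= kapt p D i 0 * eta)%R.
  by rewrite ler_wpM2l// kapt_ge0.
lra.
Qed.

Lemma pot_le_of_ae x : (enorm x <= 3 * M)%R -> pot p D mu x <= v%:E.
Proof.
move=> xM; have tc := @tpot_cvg R n p D D0 mu x.
rewrite -(cvg_lim _ tc)//; apply: lime_le; first by apply/cvg_ex; exists (pot p D mu x).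
by apply: nearW => i; rewrite lee_fin tpot_le_of_ae.
Qed.

End potential_maximum_principle.

(** * Radial measures and the equilibrium measure of a ball *)

Lemma eq_prob_integral d (T : measurableType d) (R : realType) (mu la : probability T R)
    (D : set T) (f : T -> \bar R) : (forall A, measurable A -> mu A = la A) ->
  (\int[mu]_(x in D) f x = \int[la]_(x in D) f x)%E.
Proof. by move=> mula; apply: eq_measure_integral => A mA _; exact: mula. Qed.

Lemma pushforward_ex d (T : measurableType d) (R : realType) (mu : probability T R)
    (f : T -> T) : measurable_fun setT f ->
  exists la : probability T R, (forall A, la A = mu (f @^-1` A)) /\
    (forall g : T -> \bar R, measurable_fun setT g -> (forall x, 0 <= g x)%E ->
      (\int[la]_x g x = \int[mu]_x g (f x))%E).
Proof.
move=> mf.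
pose X := mfun_Sub (mem_set mf : f \in mfun).
exists (distribution mu X); split => [A//|g mg g0].
by rewrite ge0_integral_distribution.
Qed.

Section reflections.
Context {R : realType} {n : nat}.
Implicit Types (x y v : 'rV[R]_n).

(** For [v = 0] the division yields 0 and the map is the identity, so [reflection_swap] covers
    [x = y]. Reflections act transitively on each sphere, so invariance under them is enough to
    express radial symmetry. *)
Definition reflection v x := x - (2 * dot x v / dot v v) *: v.

Lemma dot_eq0 v : dot v v = 0 -> v = 0.
Proof. by move=> v0; apply: enorm_eq0; rewrite enormE v0 sqrtr0. Qed.

Lemma reflectionB v x y : reflection v (x - y) = reflection v x - reflection v y.
Proof.
rewrite /reflection dotDl dotNl mulrBr mulrBl scalerBl.
by rewrite !opprD !opprK addrACA.
Qed.

Lemma reflectionZ v a x : reflection v (a *: x) = a *: reflection v x.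
Proof. by rewrite /reflection dotZl scalerBr scalerA; congr (_ - _ *: _); ring. Qed.

Lemma enorm_reflection v x : enorm (reflection v x) = enorm x.
Proof.
rewrite !enormE; congr Num.sqrt; rewrite /reflection.
have [v0|v0] := eqVneq (dot v v) 0.
  by rewrite (dot_eq0 v0) scaler0 subr0.
rewrite dotDl !dotDr !dotNl !dotNr !dotZl !dotZr (dotC v x); field.
exact: v0.
Qed.

Lemma reflection_swap x y : enorm x = enorm y -> reflection (x - y) x = y.
Proof.
move=> xy; have E : dot x x = dot y y by rewrite -!sqr_enorm xy.
rewrite /reflection; have [v0|v0] := eqVneq (dot (x - y) (x - y)) 0.
  by move: (dot_eq0 v0) => /subr0_eq ->; rewrite subrr scaler0 subr0.
rewrite (_ : 2 * dot x (x - y) / dot (x - y) (x - y) = 1).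
  by rewrite scale1r opprB addrC subrK.
apply: (mulIf v0); rewrite divfK// mul1r.
rewrite !dotDr !dotDl !dotNl !dotNr -E (dotC y x); ring.
Qed.

Lemma reflection_swap_dist x y z : enorm x = enorm y ->
  enorm (y - reflection (x - y) z) = enorm (x - z).
Proof.
move=> xy; rewrite -(enorm_reflection (x - y) (x - z)) reflectionB.
by rewrite reflection_swap.
Qed.

Local Notation T := (g_sigma_algebraType (@open 'rV[R]_n)).

Lemma measurable_reflection v : measurable_fun setT (reflection v : T -> T).
Proof.
apply: measurable_rVP => i.
rewrite (_ : (fun x => _) = (fun x : T => (x : 'rV[R]_n) ord0 i -
    2 * dot (x : 'rV[R]_n) v / dot v v * v ord0 i)); last first.
  by apply/funext => x; rewrite !mxE.
apply: measurable_funB; first exact: measurable_coord.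
apply: measurable_funM => //; apply: measurable_funM => //; apply: measurable_funM => //.
apply: measurable_sum => j; apply: measurable_funM => //; exact: measurable_coord.
Qed.

Definition rescale (b : R) x := (b / enorm x) *: x.

Lemma enorm_rescale b x : 0 <= b -> x != 0 -> enorm (rescale b x) = b.
Proof.
move=> b0 x0; rewrite enormZ ger0_norm ?divr_ge0 ?enorm_ge0// divfK//.
by apply: contra x0 => /eqP/enorm_eq0 ->.
Qed.

Lemma measurable_rescale b : measurable_fun setT (rescale b : T -> T).
Proof.
apply: measurable_rVP => i.
rewrite (_ : (fun x => _) = (fun x : T => b * (enorm (x : 'rV[R]_n))^-1 * (x : 'rV[R]_n) ord0 i)); last first.
  by apply/funext => x; rewrite !mxE.
apply: measurable_funM; last exact: measurable_coord.
apply: measurable_funM => //.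
under eq_fun do rewrite -powR_inv1 ?enorm_ge0//.
exact: (measurableT_comp (measurable_powR _) measurable_enorm).
Qed.

Lemma rescale_reflection b v x : rescale b (reflection v x) = reflection v (rescale b x).
Proof. by rewrite /rescale enorm_reflection reflectionZ. Qed.

End reflections.

Section radial_measures.
Local Open Scope ereal_scope.
Context {R : realType} {n : nat}.
Local Notation T := (g_sigma_algebraType (@open 'rV[R]_n)).
Variables (p : nat) (D : R).
Hypothesis D0 : (0 < D)%R.
Implicit Types (mu nu : borel_probability R n) (x y v : 'rV[R]_n).

Definition radial nu := forall v (A : set T), measurable A ->
  nu (reflection v @^-1` A) = nu A.

Definition on_sphere (b : R) nu := nu [set x : T | enorm (x : 'rV[R]_n) = b] = 1.

Lemma measurable_sphere (b : R) : measurable [set x : T | enorm (x : 'rV[R]_n) = b].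
Proof.
rewrite -[X in measurable X]setTI.
exact: (measurable_enorm measurableT (measurable_set1 b)).
Qed.

Lemma radial_integral nu (f : T -> \bar R) v : radial nu ->
  measurable_fun setT f -> (forall x, 0 <= f x) ->
  \int[nu]_x f x = \int[nu]_x f (reflection v (x : 'rV[R]_n)).
Proof.
move=> rad mf f0; have [la [laE laI]] := pushforward_ex nu (measurable_reflection v).
rewrite -laI//; apply: eq_prob_integral => A mA.
by rewrite laE; exact/esym/rad.
Qed.

Lemma radial_pot nu x y : radial nu -> enorm x = enorm y -> pot p D nu x = pot p D nu y.
Proof.
move=> rad xy; have f0 (z : T) := kap_ge0 p D0 (enorm (y - (z : 'rV[R]_n))).
have E := @radial_integral nu _ (x - y) rad (measurable_kap_dist p D0 y) f0.
rewrite /pot [RHS]E; apply: eq_integral => z _.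
by rewrite reflection_swap_dist.
Qed.

Lemma radial_tpot nu j x y : radial nu -> enorm x = enorm y ->
  tpot p D nu j setT x = tpot p D nu j setT y.
Proof.
move=> rad xy; apply: EFin_inj; rewrite !EFin_tpot//.
pose f (z : T) := (kapt p D j (enorm (y - (z : 'rV[R]_n))))%:E.
have mf : measurable_fun setT f.
  by apply/measurable_EFinP; case: (bounded_kapt_dist p D0 j setT y).
have f0 z : 0 <= f z by rewrite lee_fin kapt_ge0.
rewrite [RHS](@radial_integral nu f (x - y) rad mf f0); apply: eq_integral => z _.
by rewrite /f reflection_swap_dist.
Qed.

(** A reflection preserves the ball and all distances, so it carries the minimizer to a minimizer,
    and uniqueness applies. *)
Lemma minimizer_radial (M r : R) nu : (2 * M <= D)%R -> (r <= M)%R ->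
  minimizer p D (eball r) nu -> mutual p D nu nu < +oo -> radial nu.
Proof.
move=> MD rM [nu1 numin] fin v A mA.
have mB : measurable (eball r : set T) by apply: closed_measurable_rV; exact: closed_eball.
have BM : (eball r : set T) `<=` eball M by move=> x; rewrite /eball/= => /le_trans; apply.
have [la [laE laI]] := pushforward_ex nu (measurable_reflection v).
have la1 : la (eball r) = 1.
  rewrite laE -nu1; congr (nu _); apply/seteqP; split => x;
    by rewrite /eball/= enorm_reflection.
have potla x : pot p D la (reflection v x) = pot p D nu x.
  rewrite /pot laI; last 2 first.
  - exact: measurable_kap_dist.
  - by move=> z; exact: kap_ge0.
  by apply: eq_integral => z _; rewrite -reflectionB enorm_reflection.
have E : mutual p D la la = mutual p D nu nu.
  rewrite /mutual laI; last 2 first.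
  - exact: measurable_pot.
  - by move=> z; exact: pot_ge0.
  by apply: eq_integral => z _; rewrite potla.
have lamin : minimizer p D (eball r) la by split => // rho; rewrite E; exact: numin.
have lafin : mutual p D la la < +oo by rewrite E.
have U := minimizer_unique D0 MD mB BM lamin (conj nu1 numin) lafin.
by transitivity (la A); [rewrite laE|exact: U].
Qed.

(** An atom makes the potential infinite at a point of positive mass. *)
Lemma finite_energy_set1 nu : mutual p D nu nu < +oo -> nu [set (0%R : 'rV[R]_n)] = 0.
Proof.
move=> fin; apply/eqP; rewrite -measure_le0 leNgt; apply/negP => pos.
have m0 : measurable ([set (0%R : 'rV[R]_n)] : set T).
  rewrite (_ : [set _] = [set x : T | enorm (x : 'rV[R]_n) = 0%R]); first exact: measurable_sphere.
  by apply/seteqP; split => x /=; [move=> ->; exact: enorm0|exact: enorm_eq0].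
have ge (mu : borel_probability R n) (f : T -> \bar R) : measurable_fun setT f -> (forall x, 0 <= f x) ->
    f 0%R * mu [set (0%R : 'rV[R]_n)] <= \int[mu]_x f x.
  move=> mf f0; rewrite -integral_cst//.
  apply: (@le_trans _ _ (\int[mu]_(x in [set (0%R : 'rV[R]_n)]) f x)).
    rewrite (eq_integral (fun x : T => f x)) // => x.
    by rewrite inE/= => ->.
  exact: ge0_subset_integral.
have p0 : pot p D nu 0%R = +oo.
  apply/eqP; rewrite -leye_eq.
  have := ge nu _ (measurable_kap_dist p D0 0%R) (fun x => kap_ge0 p D0 _).
  rewrite /= subrr enorm0 {1}/kap lexx gt0_mulye//.
have := ge nu _ (measurable_pot p D0 nu) (fun x => pot_ge0 p D0 nu x).
by rewrite p0 gt0_mulye// leye_eq => /eqP E; move: fin; rewrite /mutual E.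
Qed.

(** Rescaling commutes with reflections, and the origin, the only point it fails to send to the
    sphere, carries no mass when the energy is finite. *)
Lemma radial_sphere_ex (b : R) nu : (0 <= b)%R -> radial nu -> mutual p D nu nu < +oo ->
  exists2 sigma : borel_probability R n, radial sigma & on_sphere b sigma.
Proof.
move=> b0 rad fin; have [la [laE _]] := pushforward_ex nu (measurable_rescale b).
exists la => [v A mA|].
  rewrite !laE; transitivity (nu (reflection v @^-1` (rescale b @^-1` A))).
    by congr (nu _); apply/seteqP; split => x /=; rewrite rescale_reflection.
  apply: rad; rewrite -[X in measurable X]setTI; exact: measurable_rescale.
have m0 : measurable ([set (0%R : 'rV[R]_n)] : set T).
  rewrite (_ : [set _] = [set x : T | enorm (x : 'rV[R]_n) = 0%R]); first exact: measurable_sphere.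
  by apply/seteqP; split => x /=; [move=> ->; exact: enorm0|exact: enorm_eq0].
rewrite /on_sphere laE; apply: (@prob_full_sub _ _ R nu (~` [set (0%R : 'rV[R]_n)])).
- exact: measurableC.
- rewrite -[X in measurable X]setTI; apply: measurable_rescale => //; exact: measurable_sphere.
- by move=> x /= /eqP x0; rewrite enorm_rescale.
- by rewrite probability_setC// finite_energy_set1// sube0.
Qed.

End radial_measures.

Lemma ae_sub d (T : measurableType d) (R : realType) (mu : probability T R)
    (P Q : T -> Prop) : {ae mu, forall x, P x} -> (forall x, P x -> Q x) ->
  {ae mu, forall x, Q x}.
Proof. by move=> aP PQ; apply: filterS aP. Qed.

Lemma kap_decr (R : realType) p (s t : R) : s < t -> forall D, 0 < t -> t <= D ->
  (kap p D t < kap p D s)%E.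
Proof.
move=> st D t0 tD; rewrite kapE//.
have [s0|s0] := leP s 0; first by rewrite /kap s0 ltry.
rewrite kapE ?(le_trans (ltW st))// lte_fin ltrD2r.
exact: newton_decr.
Qed.

(** The maximum principle applies to both [u] and [- u], whose boundary values are constant. *)
Lemma radial_harmonic_center (R : realType) n (u : 'rV[R]_n -> R) a x :
  (0 < n)%N -> continuous u -> (forall z z', enorm z = enorm z' -> u z = u z') ->
  (forall z, enorm z < a ->
    asymp_subharmonic u z /\ asymp_subharmonic (fun z => - u z) z) ->
  enorm x = a -> u x = u 0.
Proof.
move=> n0 cu uE us xa.
have za : enorm (0 : 'rV[R]_n) <= a by rewrite enorm0 -xa enorm_ge0.
apply/eqP; rewrite eq_le; apply/andP; split.
  rewrite -lerN2; apply: (@maximum_principle R n (fun z => - u z) a (- u x) n0 _ _ _ 0 za).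
  - exact: continuous_oppr cu.
  - by move=> z zr; rewrite (uE z x)// xa.
  - by move=> z zr _; have [] := us z zr.
apply: (@maximum_principle R n u a (u x) n0 cu _ _ 0 za).
- by move=> z zr; rewrite (uE z x)// xa.
- by move=> z zr _; have [] := us z zr.
Qed.

(** * Newton's theorem on spherical shells *)

Section sphere_potentials.
Local Open Scope ereal_scope.
Context {R : realType} {n : nat}.
Local Notation T := (g_sigma_algebraType (@open 'rV[R]_n)).
Local Notation p := (n - 2)%N.
Variables (D : R).
Hypotheses (n1 : (1 < n)%N) (D0 : (0 < D)%R).
Implicit Types (nu sigma : borel_probability R n) (x y : 'rV[R]_n).

Local Notation sphere b := [set x : T | enorm (x : 'rV[R]_n) = b].

Lemma pot_sphereE (b : R) sigma x : on_sphere b sigma ->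
  pot p D sigma x = \int[sigma]_(y in sphere b) kap p D (enorm (x - (y : 'rV[R]_n))).
Proof.
move=> sb; rewrite (integral_prob_full _ sb)//; first exact: measurable_sphere.
exact: measurable_kap_dist.
Qed.

Lemma integral_sphere_cst (b : R) sigma (f : T -> \bar R) (c : \bar R) : on_sphere b sigma ->
  (forall y, sphere b y -> f y = c) -> \int[sigma]_(y in sphere b) f y = c.
Proof.
move=> sb fc; transitivity (\int[sigma]_(y in sphere b) (fun=> c) y).
  by apply: eq_integral => y; rewrite inE => /fc.
rewrite (integral_prob_full (@measurable_sphere R n b) sb)//.
exact: prob_integral_cst.
Qed.

Lemma pot_center_sphere (b : R) sigma : on_sphere b sigma ->
  pot p D sigma 0%R = kap p D b.
Proof.
move=> sb; rewrite (pot_sphereE _ sb); apply: (integral_sphere_cst sb) => y yb.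
by rewrite sub0r enormN yb.
Qed.

Lemma tpot_sphereT (b : R) sigma j x : on_sphere b sigma ->
  tpot p D sigma j (sphere b) x = tpot p D sigma j setT x.
Proof.
move=> sb; apply: EFin_inj; rewrite !EFin_tpot//; last exact: measurable_sphere.
rewrite (integral_prob_full _ sb)//; first exact: measurable_sphere.
by apply/measurable_EFinP; case: (bounded_kapt_dist p D0 j setT x).
Qed.

(* Newton's theorem inside the sphere: the potential is harmonic and constant on
   concentric spheres, hence equal to its value at the center. *)
Lemma pot_inside (b : R) sigma x : (0 < b)%R -> (2 * b <= D)%R ->
  on_sphere b sigma -> radial sigma -> (enorm x < b)%R -> pot p D sigma x = kap p D b.
Proof.
move=> b0 bD sb rad xb; have mS := @measurable_sphere R n b.
set a := enorm x; have a0 : (0 <= a)%R by exact: enorm_ge0.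
have ab : (a < b)%R by [].
(* Points of the sphere are at least [b - a], hence two truncation radii, away from the ball of
   radius [a], where this level is therefore exact. *)
have [j Hj] := @radius_cvg R D D0 ((b - a) / 2)%R ltac:(by rewrite divr_gt0// subr_gt0).
have rj : (radius D j <= (b - a) / 2)%R by exact: Hj (leqnn j).
have rj0 : (0 < radius D j)%R by exact: radius_gt0.
pose u := tpot p D sigma j (sphere b).
have uE z z' : enorm z = enorm z' -> u z = u z'.
  by move=> zz'; rewrite /u !tpot_sphereT//; exact: radial_tpot.
have exact_pot z : (enorm z <= a)%R -> pot p D sigma z = (u z)%:E.
  move=> za; rewrite (pot_sphereE _ sb) /u EFin_tpot//.
  apply: eq_integral => y; rewrite inE => /= yb; apply: (kap_kapt p D0).
  have := ler_enormD (z - (y : 'rV[R]_n)) (- z).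
  by rewrite addrAC subrr add0r !enormN yb; lra.
have asub : forall z, (enorm z < a)%R ->
    asymp_subharmonic u z /\ asymp_subharmonic (fun y => - u y)%R z.
  move=> z za; apply: (@asymp_subharmonic_tpot R n D sigma n1 D0 j (sphere b) z (b - a)) => //.
  - by rewrite subr_gt0.
  - move=> y yb; have := ler_enormD (z - (y : 'rV[R]_n)) (- z).
    by rewrite addrAC subrr add0r !enormN yb; lra.
  - move=> y yb; have := ler_enormD z (- (y : 'rV[R]_n)).
    by rewrite enormN yb; lra.
have cu : continuous u by exact: continuous_tpot.
have n0 : (0 < n)%N by exact: ltnW.
have xa : (enorm x <= a)%R by exact: lexx.
have za : (enorm (0%R : 'rV[R]_n) <= a)%R by rewrite enorm0.
rewrite (exact_pot x xa) -(pot_center_sphere sb) (exact_pot _ za); congr EFin.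
exact: (radial_harmonic_center n0 cu uE asub (erefl a)).
Qed.

(** Reciprocity: the mutual energy of two concentric shells can be computed from either one, and
    [sigma] lies inside the shell of [tau], where the potential is known. *)
Lemma pot_outside (b s : R) sigma (tau : borel_probability R n) x : (0 < b)%R -> (b < s)%R -> (2 * s <= D)%R ->
  on_sphere b sigma -> radial sigma -> on_sphere s tau -> radial tau ->
  enorm x = s -> pot p D sigma x = kap p D s.
Proof.
move=> b0 bs sD sb rads ts radt xs.
have mS c := @measurable_sphere R n c.
transitivity (mutual p D sigma tau).
  rewrite /mutual -(integral_prob_full (mS s) ts); last exact: measurable_pot.
  apply/esym/(integral_sphere_cst ts) => y ys.
  by apply: (radial_pot p D0 rads); rewrite xs.
rewrite mutualC// /mutual -(integral_prob_full (mS b) sb); last exact: measurable_pot.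
apply: (integral_sphere_cst sb) => y /= yb.
have ys : (enorm (y : 'rV[R]_n) < s)%R by rewrite yb.
exact: (pot_inside (lt_trans b0 bs) sD ts radt ys).
Qed.

(** Each truncation is Lipschitz and is bounded just inside the sphere by the interior value; the
    bound passes to the sphere and then to the limit in the truncation. *)
Lemma pot_on_sphere_le (b : R) sigma x : (0 < b)%R -> (2 * b <= D)%R ->
  on_sphere b sigma -> radial sigma -> enorm x = b -> pot p D sigma x <= kap p D b.
Proof.
move=> b0 bD sb rad xb; have tc := @tpot_cvg R n p D D0 sigma x.
rewrite -(cvg_lim _ tc)//; apply: lime_le; first by apply/cvg_ex; exists (pot p D sigma x).
apply: nearW => j; have kfin : kap p D b \is a fin_num.
  by rewrite kapE//; lra.
rewrite -(fineK kfin) lee_fin; apply/ler_addgt0Pr => eps eps0.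
have L0 : (0 <= newton_lip p (radius D j))%R by exact/newton_lip_ge0/radius_gt0.
set L := newton_lip p (radius D j) in L0.
pose t := (Num.min (b / 2) (eps / (L + 1)))%R.
have L1 : (0 < L + 1)%R by rewrite ltr_pwDr.
have t0 : (0 < t)%R by rewrite lt_min !divr_gt0.
have tb : (t <= b / 2)%R by rewrite ge_min lexx.
have te : (t * (L + 1) <= eps)%R by rewrite -ler_pdivlMr// ge_min lexx orbT.
pose y := ((b - t) / b) *: x.
have yE : enorm y = (b - t)%R.
  by rewrite enormZ xb ger0_norm ?divr_ge0 ?divfK ?gt_eqF//; lra.
have xy : enorm (x - y) = t.
  rewrite /y -{1}[x]scale1r -scalerBl enormZ xb.
  have -> : (1 - (b - t) / b = t / b)%R by field; rewrite gt_eqF.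
  by rewrite ger0_norm ?divr_ge0 ?divfK ?gt_eqF//; lra.
have h1 : (tpot p D sigma j setT y <= fine (kap p D b))%R.
  have yb : (enorm y < b)%R by rewrite yE; lra.
  have := tpot_le_pot p D0 sigma j y measurableT.
  by rewrite (pot_inside b0 bD sb rad yb) -(fineK kfin) lee_fin.
have := tpot_lipschitz p D0 sigma j x y measurableT; rewrite xy -/L ler_norml => /andP[_ h2].
have Lt : (L * t <= eps)%R by move: te; rewrite mulrDr mulr1 mulrC; lra.
have abstract_le (A B : R) : (A - B <= L * t)%R -> (B <= fine (kap p D b))%R ->
    (A <= fine (kap p D b) + eps)%R by move=> *; lra.
exact: abstract_le h2 h1.
Qed.

End sphere_potentials.

Lemma minimizer_pot0_le (R : realType) n (M : R) (K : set (g_sigma_algebraType (@open 'rV[R]_n)))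
    (mu : borel_probability R n) :
  (1 < n)%N -> (0 < M)%R -> measurable K -> K `<=` eball M ->
  minimizer (n - 2) (4 * M) K mu -> (mutual (n - 2) (4 * M) mu mu < +oo)%E ->
  (pot (n - 2) (4 * M) mu 0%R <= mutual (n - 2) (4 * M) mu mu)%E.
Proof.
move=> n1 M0 mK KM muP mufin.
have D0 : (0 < 4 * M)%R by rewrite mulr_gt0.
have /fineK vE : mutual (n - 2) (4 * M) mu mu \is a fin_num by exact: fin_num_mutual.
apply: (@le_trans _ _ (fine (mutual (n - 2) (4 * M) mu mu))%:E); last by rewrite vE.
apply: (pot_le_of_ae n1 M0 mK KM muP.1); last by rewrite enorm0 mulr_ge0// ltW.
by apply: ae_sub (minimizer_pot_ae D0 mK muP mufin) _ => x /(_ Logic.I) ->; rewrite vE.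
Qed.

(** * The equilibrium measure of a ball *)

Section ball_minimizer.
Local Open Scope ereal_scope.
Context {R : realType} {n : nat}.
Local Notation T := (g_sigma_algebraType (@open 'rV[R]_n)).
Local Notation p := (n - 2)%N.
Variables (M r : R) (nu : borel_probability R n).
Local Notation D := (4 * M)%R.
Hypotheses (n1 : (1 < n)%N) (r0 : (0 < r)%R) (rM : (r <= M)%R).
Hypotheses (nuP : minimizer p D (eball r) nu) (nufin : mutual p D nu nu < +oo).

Let M0 : (0 < M)%R. Proof. exact: lt_le_trans rM. Qed.
Let D0 : (0 < D)%R. Proof. by rewrite mulr_gt0. Qed.
Let MD : (2 * M <= D)%R. Proof. by have := M0; lra. Qed.
Let r2D : (2 * r <= D)%R. Proof. by have := M0; have := rM; lra. Qed.
Let rD : (r <= D)%R. Proof. by have := r0; have := r2D; lra. Qed.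
Let mB : measurable (eball r : set T).
Proof. by apply: closed_measurable_rV; exact: closed_eball. Qed.

Lemma ball_minimizer_radial : radial nu.
Proof. exact: (minimizer_radial D0 MD rM nuP nufin). Qed.

Let kap_fin b : (0 < b)%R -> (b <= D)%R -> kap p D b \is a fin_num.
Proof. by move=> b0 bD; rewrite kapE. Qed.

Lemma ball_minimizer_energy_le : mutual p D nu nu <= kap p D r.
Proof.
have [sigma rad sb] := radial_sphere_ex D0 (ltW r0) ball_minimizer_radial nufin.
have sB : sigma (eball r) = 1.
  by apply: (prob_full_sub (measurable_sphere r) mB _ sb) => x /= xr; rewrite /eball/= xr.
apply: (le_trans (nuP.2 _ sB)).
have mS := @measurable_sphere R n r.
rewrite /mutual -(integral_prob_full mS sb); last exact: measurable_pot.
rewrite -(integral_sphere_cst (f := fun=> kap p D r) sb (fun _ _ => erefl)).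
apply: ge0_le_integral => //.
- by move=> x _; exact: pot_ge0.
- by apply: measurable_funTS; exact: measurable_pot.
- by move=> x xr; exact: (pot_on_sphere_le n1 D0 r0 r2D sb rad xr).
Qed.

Let pot0E (mu : borel_probability R n) : pot p D mu 0%R = \int[mu]_x kap p D (enorm (x : 'rV[R]_n)).
Proof. by apply: eq_integral => x _; rewrite sub0r enormN. Qed.

Let nu0 : pot p D nu 0%R <= kap p D r.
Proof.
have BM : (eball r : set T) `<=` eball M by move=> x; rewrite /eball/= => /le_trans; apply.
exact: le_trans (minimizer_pot0_le n1 M0 mB BM nuP nufin) ball_minimizer_energy_le.
Qed.

(** The potential at the center is the mean of the kernel at [enorm x]. It is at most [kap p D r],
    the least value of the kernel on the ball, so this value is attained almost everywhere, and the
    kernel is strictly decreasing. *)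
Lemma ball_minimizer_sphere : on_sphere r nu.
Proof.
apply: ae_prob_full; first exact: measurable_sphere.
have mk : measurable_fun setT (fun x : T => kap p D (enorm (x : 'rV[R]_n))).
  exact: (measurableT_comp (measurable_kap p D0) measurable_enorm).
have kf : kap p D r \is a fin_num by apply: kap_fin.
have i1 : nu.-integrable setT (fun=> kap p D r).
  by rewrite -(fineK kf); exact: prob_integrable_cst.
have i2 : nu.-integrable setT (fun x : T => kap p D (enorm (x : 'rV[R]_n))).
  apply/integrableP; split => //.
  under eq_integral do rewrite gee0_abs ?kap_ge0//.
  by rewrite -pot0E (le_lt_trans nu0)// -(fineK kf) ltry.
have le1 : {ae nu, forall x, setT x -> kap p D r <= kap p D (enorm (x : 'rV[R]_n))}.
  by apply: ae_sub (prob_full_ae mB nuP.1) _ => x xr _; exact: kap_nincr.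
have le2 : \int[nu]_x kap p D (enorm (x : 'rV[R]_n)) <= \int[nu]_x kap p D r.
  by rewrite -pot0E prob_integral_cst.
have := ae_and (ae_eq_of_le measurableT i1 i2 le1 le2) (prob_full_ae mB nuP.1).
move=> /ae_sub; apply=> x [/(_ Logic.I) E]; rewrite /eball/= => xr.
apply/eqP; rewrite eq_le xr/= leNgt; apply/negP => /(kap_decr (n - 2)) H.
by have := H D r0 rD; rewrite E ltxx.
Qed.

(** The lower bound comes from the center, where the potential of a measure on the sphere is
    [kap p D r] and does not exceed the energy. *)
Lemma ball_minimizer_energy : mutual p D nu nu = kap p D r.
Proof.
apply/eqP; rewrite eq_le ball_minimizer_energy_le/=.
have BM : (eball r : set T) `<=` eball M by move=> x; rewrite /eball/= => /le_trans; apply.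
rewrite -(pot_center_sphere D0 ball_minimizer_sphere).
exact: minimizer_pot0_le n1 M0 mB BM nuP nufin.
Qed.

Lemma ball_minimizer_pot_outside x : (r < enorm x)%R -> (enorm x <= M)%R ->
  pot p D nu x = kap p D (enorm x).
Proof.
move=> rx xM; have [tau radt ts] := radial_sphere_ex D0 (enorm_ge0 x) ball_minimizer_radial nufin.
apply: (pot_outside n1 D0 r0 rx _ ball_minimizer_sphere ball_minimizer_radial ts radt) => //.
by have := M0; lra.
Qed.

End ball_minimizer.

(** * Moments of equilibrium measures *)

Section riesz_kernel.
Context {R : realType}.
Implicit Types t q : R.

Lemma epow_pos t q : 0 < t -> epow t%:E q = (t `^ q)%:E.
Proof.
move=> t0; rewrite /epow; case: ifPn => _; last by rewrite poweR_EFin.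
by rewrite poweR_EFin inver gt_eqF ?powR_gt0// -powRN opprK.
Qed.

Lemma riesz_kernel_pos p t : 0 < t -> riesz_kernel p%:R t = (newton p t)%:E.
Proof.
move=> t0; rewrite /riesz_kernel /newton pnatr_eq0; case: ifPn => p0.
  by rewrite inver gt_eqF// lne_EFin ?invr_gt0// lnV.
by rewrite epow_pos// powRN powR_mulrn// ltW.
Qed.

Lemma riesz_kernel0 p : riesz_kernel p%:R 0 = +oo%E :> \bar R.
Proof.
rewrite /riesz_kernel pnatr_eq0; case: ifPn => p0; first by rewrite inve0.
rewrite /epow ltrNl oppr0 ltr0n lt0n p0 opprK poweR_EFin powR0 ?pnatr_eq0//.
by rewrite inve0.
Qed.

Lemma riesz_kernelE p (D : R) t : 0 <= t -> t <= D ->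
  riesz_kernel p%:R t = (kap p D t + (newton p D)%:E)%E.
Proof.
rewrite le_eqVlt => /orP[/eqP <- _|t0 tD].
  by rewrite riesz_kernel0 /kap lexx.
by rewrite riesz_kernel_pos// kapE// -EFinD subrK.
Qed.

End riesz_kernel.

Section energy_translation.
Local Open Scope ereal_scope.
Context {R : realType} {n : nat}.
Local Notation T := (g_sigma_algebraType (@open 'rV[R]_n)).
Variables (p : nat) (M : R).
Hypothesis M0 : (0 < M)%R.
Local Notation D := (4 * M)%R.
Implicit Types (K : set T) (mu : borel_probability R n) (x : 'rV[R]_n).

Let D0 : (0 < D)%R. Proof. by rewrite mulr_gt0. Qed.

(** [3 * M] plus the radius [M] of the support is [D], so the cap is inactive and the two kernels
    differ by a constant. *)
Lemma potentialE K mu x : measurable K -> K `<=` eball M -> mu K = 1 ->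
  (enorm x <= 3 * M)%R -> potential p%:R K mu x = pot p D mu x + (newton p D)%:E.
Proof.
move=> mK KM muK xM.
have mk := measurable_kap_dist p D0 x.
rewrite /pot -ge0_prob_integralD_cst//; last by move=> y; exact: kap_ge0.
rewrite -(integral_prob_full mK muK); last exact: emeasurable_funD.
apply: eq_integral => y /set_mem /KM; rewrite /eball/= => yM.
apply: riesz_kernelE; first exact: enorm_ge0.
by rewrite (le_trans (ler_enormD _ _))// enormN; lra.
Qed.

Lemma measure_energyE K mu : measurable K -> K `<=` eball M -> mu K = 1 ->
  measure_energy p%:R K mu = mutual p D mu mu + (newton p D)%:E.
Proof.
move=> mK KM muK; have mp := measurable_pot p D0 mu.
rewrite /mutual -ge0_prob_integralD_cst//; last by move=> y; exact: pot_ge0.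
rewrite -(integral_prob_full mK muK); last exact: emeasurable_funD.
apply: eq_integral => y /set_mem /KM; rewrite /eball/= => yM.
by apply: potentialE => //; have := M0; lra.
Qed.

Lemma equilibrium_minimizer K mu : measurable K -> K `<=` eball M ->
  equilibrium_measure p%:R K mu ->
  minimizer p D K mu /\ energy p%:R K = mutual p D mu mu + (newton p D)%:E.
Proof.
move=> mK KM [muK muE]; split; last by rewrite -muE measure_energyE.
split => // rho rhoK; rewrite -(@leeD2rE _ (newton p D)%:E)//.
rewrite -(measure_energyE mK KM muK) -(measure_energyE mK KM rhoK) muE.
by apply: ereal_inf_lbound; exists rho.
Qed.

Lemma energyE_infinite K : measurable K -> K `<=` eball M ->
  (forall mu, mu K = 1 -> mutual p D mu mu = +oo) -> energy p%:R K = +oo.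
Proof.
move=> mK KM H; apply/eqP; rewrite -leye_eq; apply: le_ereal_inf_tmp => _ [mu/= muK <-].
by rewrite measure_energyE// H.
Qed.

End energy_translation.

Section capacities.
Local Open Scope ereal_scope.
Context {R : realType} {n : nat}.
Variable (p : nat).
Implicit Types (K B : set 'rV[R]_n).

Lemma capacity0 K : energy p%:R K = +oo -> capacity p%:R K = 0.
Proof.
move=> E; rewrite /capacity E pnatr_eq0; case: ifPn => [//|p0].
rewrite /epow ltrNl oppr0 invr_gt0 ltr0n lt0n p0 opprK poweRyr ?invey//.
by rewrite invr_neq0// pnatr_eq0.
Qed.

Lemma capacity_gt0 K : 0 < capacity p%:R K -> energy p%:R K < +oo.
Proof. by move=> cK; rewrite ltey; apply: contraTneq cK => /capacity0 ->; rewrite ltxx. Qed.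

(** Positivity for [p > 0] places the energies where [epow] is an ordinary real power, which is
    injective. *)
Lemma capacity_inj K B (a b : R) : energy p%:R K = a%:E -> energy p%:R B = b%:E ->
  ((0 < p)%N -> (0 < a)%R /\ (0 < b)%R) ->
  capacity p%:R K = capacity p%:R B -> energy p%:R K = energy p%:R B.
Proof.
rewrite /capacity => -> -> ab; rewrite pnatr_eq0; case: ifPn => p0.
  by move=> /expeR_inj; case=> /oppr_inj ->.
have /ab[a0 b0] : (0 < p)%N by rewrite lt0n.
rewrite !epow_pos// !powRN => -[] /invr_inj H; congr EFin.
by apply: (powR_injective _ _ _ H); rewrite ?invr_gt0 ?ltr0n ?lt0n// nnegrE ltW.
Qed.

End capacities.

(** * Tangent inequalities for powers and the logarithm in terms of the kernel *)

Section tangent_inequalities.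
Context {R : realType}.
Implicit Types (p : nat) (q r s v al : R).

(** Bernoulli's inequality for the base [1 + y = expR v]; in this form it reduces to
    [1 + x < expR x]. *)
Lemma expR_bernoulli_gt al v : al < 0 \/ 1 < al -> v != 0 ->
  1 + al * (expR v - 1) < expR (al * v).
Proof.
move=> al01 v0; have h1 := expR_gt1Dx v0.
have [al0|al1] := al01.
  have h2 : 1 + al * v < expR (al * v) by rewrite expR_gt1Dx// mulf_neq0// lt_eqF.
  by nra.
have e0 := expR_gt0 v.
have h2 : 1 + (al - 1) * v < expR ((al - 1) * v).
  by rewrite expR_gt1Dx// mulf_neq0// subr_eq0 gt_eqF.
have h3 : 1 - v < expR (- v) by rewrite expR_gt1Dx// oppr_eq0.
have -> : expR (al * v) = expR v * expR ((al - 1) * v) by rewrite -expRD; congr expR; ring.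
have h4 : (1 - v) * expR v < 1.
  by rewrite -ltr_pdivlMr// mul1r -expRN.
have h5 : expR v * (1 + (al - 1) * v) < expR v * expR ((al - 1) * v) by rewrite ltr_pM2l.
by nra.
Qed.

Lemma expR_bernoulli_lt al v : 0 < al -> al < 1 -> v != 0 ->
  expR (al * v) < 1 + al * (expR v - 1).
Proof.
move=> al0 al1 v0; have e0 := expR_gt0 (al * v).
have h1 : expR (al * v) * (1 + (1 - al) * v) < expR v.
  have -> : expR v = expR (al * v) * expR ((1 - al) * v) by rewrite -expRD; congr expR; ring.
  by rewrite ltr_pM2l// expR_gt1Dx// mulf_neq0// subr_eq0 gt_eqF.
have h2 : expR (al * v) * (1 - al * v) < 1.
  have E : expR (al * v) * expR (- (al * v)) = 1 by rewrite -expRD subrr expR0.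
  rewrite -[X in _ < X]E.
  by rewrite ltr_pM2l// expR_gt1Dx// oppr_eq0 mulf_neq0// gt_eqF.
by nra.
Qed.

Lemma powR_expR q s r : 0 < s -> 0 < r -> s `^ q = r `^ q * expR (q * (ln s - ln r)).
Proof. by move=> s0 r0; rewrite /powR !gt_eqF// -expRD; congr expR; ring. Qed.

Lemma newton_expR p s r : 0 < s -> 0 < r -> (0 < p)%N ->
  newton p s = newton p r * expR (- p%:R * (ln s - ln r)).
Proof.
move=> s0 r0 p0; rewrite /newton gtn_eqF// -!powR_mulrn ?ltW//.
by rewrite -!powRN; exact: powR_expR.
Qed.

Lemma newton_gt0 p r : (0 < p)%N -> 0 < r -> 0 < newton p r.
Proof. by move=> p0 r0; rewrite /newton gtn_eqF// invr_gt0 exprn_gt0. Qed.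

Lemma ln_neq s r : 0 < s -> 0 < r -> s != r -> ln s - ln r != 0.
Proof. by move=> s0 r0; apply: contra; rewrite subr_eq0 => /eqP /ln_inj ->. Qed.

(* The slope of [s `^ q] as a function of [newton p s], up to sign, at [s = r]. *)
Definition tangent_coef p q r : R :=
  if p == 0%N then r `^ q * q else r `^ q * (q / p%:R) / newton p r.

Lemma tangent_coefM p q r c : 0 < r -> 0 <= q * c -> 0 <= tangent_coef p q r * c.
Proof.
move=> r0 qc; have rq := powR_ge0 r q; rewrite /tangent_coef; case: ifPn => p0.
  by rewrite -mulrA mulr_ge0.
rewrite -lt0n in p0.
rewrite (_ : _ * c = r `^ q / p%:R / newton p r * (q * c)); last by ring.
by rewrite mulr_ge0// divr_ge0// ?divr_ge0// ltW// newton_gt0.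
Qed.

(** For [p > 0] and [v = - p * (ln s - ln r)], the kernel is [newton p r * expR v] and the power of
    [s] is that of [r] times [expR (al * v)] with [al = - q / p]. The ranges [q > 0], [q < - p] and
    [- p < q < 0] become [al < 0], [al > 1] and [0 < al < 1], the cases of Bernoulli's
    inequality. *)
Lemma powR_gt_tangent p q r s : 0 < r -> 0 < s -> 0 < q \/ q < - p%:R -> s != r ->
  r `^ q - tangent_coef p q r * (newton p s - newton p r) < s `^ q.
Proof.
move=> r0 s0 hq sr; have u0 := ln_neq s0 r0 sr; have rq := powR_gt0 q r0.
rewrite (powR_expR q s0 r0) /tangent_coef; case: ifPn => [/eqP pE|p0].
  have q0 : q != 0 by move: hq; rewrite pE oppr0 => -[/gt_eqF ->|/lt_eqF ->].
  rewrite /newton pE eqxx -subr_gt0.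
  rewrite (_ : _ - _ = r `^ q * (expR (q * (ln s - ln r)) - (1 + q * (ln s - ln r)))); last by ring.
  by rewrite mulr_gt0// subr_gt0 expR_gt1Dx// mulf_neq0.
rewrite -lt0n in p0; have pR : 0 < p%:R :> R by rewrite ltr0n.
have N0 := newton_gt0 p0 r0.
rewrite (newton_expR s0 r0 p0) -subr_gt0.
set v := - p%:R * (ln s - ln r).
have -> : q * (ln s - ln r) = (- q / p%:R) * v by rewrite /v; field; rewrite gt_eqF.
rewrite (_ : _ - _ = r `^ q * (expR (- q / p%:R * v) - (1 + (- q / p%:R) * (expR v - 1)))); last first.
  by field; rewrite !gt_eqF.
rewrite mulr_gt0// subr_gt0 expR_bernoulli_gt//; last by rewrite mulf_neq0// oppr_eq0 gt_eqF.
case: hq => hq; [left|right]; first by rewrite pmulr_llt0 ?invr_gt0// oppr_lt0.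
by rewrite ltr_pdivlMr// mul1r; lra.
Qed.

Lemma powR_lt_tangent p q r s : 0 < r -> 0 < s -> - p%:R < q -> q < 0 -> s != r ->
  s `^ q < r `^ q - tangent_coef p q r * (newton p s - newton p r).
Proof.
move=> r0 s0 hq q0 sr; have u0 := ln_neq s0 r0 sr; have rq := powR_gt0 q r0.
have p0 : (0 < p)%N.
  by rewrite -(ltr0n R) -oppr_lt0 (lt_trans hq).
have pR : 0 < p%:R :> R by rewrite ltr0n.
have N0 := newton_gt0 p0 r0.
rewrite (powR_expR q s0 r0) /tangent_coef gtn_eqF//.
rewrite (newton_expR s0 r0 p0) -subr_gt0.
set v := - p%:R * (ln s - ln r).
have -> : q * (ln s - ln r) = (- q / p%:R) * v by rewrite /v; field; rewrite gt_eqF.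
rewrite (_ : _ - _ = r `^ q * ((1 + (- q / p%:R) * (expR v - 1)) - expR (- q / p%:R * v))); last first.
  by field; rewrite !gt_eqF.
rewrite mulr_gt0// subr_gt0 expR_bernoulli_lt//.
- by rewrite divr_gt0// oppr_gt0.
- by rewrite ltr_pdivrMr// mul1r; lra.
- by rewrite mulf_neq0// oppr_eq0 gt_eqF.
Qed.

Lemma ln_gt_tangent p r s : 0 < r -> 0 < s -> (0 < p)%N -> s != r ->
  ln r - (p%:R * newton p r)^-1 * (newton p s - newton p r) < ln s.
Proof.
move=> r0 s0 p0 sr; have u0 := ln_neq s0 r0 sr.
have pR : 0 < p%:R :> R by rewrite ltr0n.
have N0 := newton_gt0 p0 r0.
rewrite (newton_expR s0 r0 p0) -subr_gt0; set v := - p%:R * (ln s - ln r).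
have -> : ln s = ln r - v / p%:R by rewrite /v; field; rewrite gt_eqF.
rewrite (_ : _ - _ = (expR v - (1 + v)) / p%:R); last by field; rewrite !gt_eqF.
rewrite divr_gt0// subr_gt0 expR_gt1Dx//.
by rewrite mulf_neq0// oppr_eq0 gt_eqF.
Qed.

End tangent_inequalities.

Section tangent_integral.
Local Open Scope ereal_scope.
Context d (T : measurableType d) (R : realType) (mu : probability T R).
Variables (D : set T) (N : T -> R) (N0 m : R).
Hypotheses (mD : measurable D) (muD : mu D = 1).
Hypotheses (iN : mu.-integrable D (EFin \o N)) (Nm : \int[mu]_(x in D) (N x)%:E = m%:E).

Lemma integrable_tangent (f0 a : R) :
  mu.-integrable D (fun x => (f0 - a * (N x - N0))%:E) /\
  \int[mu]_(x in D) (f0 - a * (N x - N0))%:E = (f0 - a * (m - N0))%:E.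
Proof.
have ic c : mu.-integrable D (EFin \o fun=> c) by apply: integrableS (prob_integrable_cst mu c).
have E : (fun x => (f0 - a * (N x - N0))%:E) =
    (fun x => (f0 + a * N0)%:E + (- a)%:E * (EFin \o N) x).
  by apply/funext => x; rewrite -EFinM -EFinD; congr EFin; ring.
have iaN : mu.-integrable D (fun x => (- a)%:E * (EFin \o N) x) by exact: integrableZl.
split; first by rewrite E; exact: (integrableD mD (ic _) iaN).
rewrite [LHS](_ : _ = \int[mu]_(x in D) ((f0 + a * N0)%:E + (- a)%:E * (EFin \o N) x)); last first.
  by apply: eq_integral => x _; rewrite -EFinM -EFinD; congr EFin; ring.
rewrite (integralD mD (ic _) iaN) (integralZl mD iN) [X in _ * X]Nm.
have -> : \int[mu]_(x in D) (EFin \o fun=> (f0 + a * N0)%R) x = (f0 + a * N0)%:E.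
  rewrite -[RHS](prob_integral_cst mu); apply: (integral_prob_full mD muD).
  exact: measurable_cst.
by rewrite -EFinM -EFinD; congr EFin; ring.
Qed.

(** Integrating the tangent gives [f0 + a * (N0 - m)], whence the sign condition relating the slope
    to the side on which the mean lies. Equality of the integrals forces equality with the tangent
    almost everywhere. *)
Lemma tangent_integral_ge (f : T -> R) (f0 a : R) :
  mu.-integrable D (EFin \o f) -> (0 <= a * (N0 - m))%R ->
  (forall x, D x -> f0 - a * (N x - N0) <= f x)%R ->
  f0%:E <= \int[mu]_(x in D) (f x)%:E /\
  (\int[mu]_(x in D) (f x)%:E = f0%:E ->
    {ae mu, forall x, D x -> f x = f0 - a * (N x - N0)}%R).
Proof.
move=> iF aN fN; have [ig gE] := integrable_tangent f0 a.
have le0 : f0%:E <= \int[mu]_(x in D) (f0 - a * (N x - N0))%:E.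
  by rewrite gE lee_fin; lra.
split.
  by apply: (le_trans le0); apply: le_integral => // x /set_mem Dx; rewrite lee_fin fN.
move=> E; have fle : {ae mu, forall x, D x -> (f0 - a * (N x - N0))%:E <= (f x)%:E}.
  by apply: aeW => x Dx; rewrite lee_fin fN.
have := ae_eq_of_le mD ig iF fle; rewrite E => /(_ le0) H.
by apply: filterS H => x H /H[].
Qed.

Lemma tangent_integral_le (f : T -> R) (f0 a : R) :
  mu.-integrable D (EFin \o f) -> (a * (N0 - m) <= 0)%R ->
  (forall x, D x -> f x <= f0 - a * (N x - N0))%R ->
  \int[mu]_(x in D) (f x)%:E <= f0%:E /\
  (\int[mu]_(x in D) (f x)%:E = f0%:E ->
    {ae mu, forall x, D x -> f x = f0 - a * (N x - N0)}%R).
Proof.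
move=> iF aN fN; have [ig gE] := integrable_tangent f0 a.
have le0 : \int[mu]_(x in D) (f0 - a * (N x - N0))%:E <= f0%:E.
  by rewrite gE lee_fin; lra.
split.
  by apply: le_trans le0; apply: le_integral => // x /set_mem Dx; rewrite lee_fin fN.
move=> E; have fle : {ae mu, forall x, D x -> (f x)%:E <= (f0 - a * (N x - N0))%:E}.
  by apply: aeW => x Dx; rewrite lee_fin fN.
have := ae_eq_of_le mD iF ig fle; rewrite E => /(_ le0) H.
by apply: filterS H => x H /H[].
Qed.

End tangent_integral.

Section radial_integrals.
Local Open Scope ereal_scope.
Context {R : realType} {n : nat}.
Local Notation T := (g_sigma_algebraType (@open 'rV[R]_n)).
Implicit Types (K : set T) (mu : borel_probability R n) (q r : R).

Lemma measurable_epow q : measurable_fun setT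
  (fun x : T => epow (enorm (x : 'rV[R]_n))%:E q).
Proof.
have mp : measurable_fun setT (fun x : T => (enorm (x : 'rV[R]_n) `^ q)%:E).
  apply/measurable_EFinP; exact: (measurableT_comp (measurable_powR q) measurable_enorm).
have [q0|q0] := ltP q 0%R; last first.
  rewrite (_ : (fun _ => _) = (fun x : T => (enorm (x : 'rV[R]_n) `^ q)%:E))//.
  by apply/funext => x; rewrite /epow; case: ifPn => [|_]; [rewrite ltNge q0|rewrite poweR_EFin].
rewrite (_ : (fun _ => _) = (fun x : T => if (enorm (x : 'rV[R]_n) <= 0)%R then +oo
    else (enorm (x : 'rV[R]_n) `^ q)%:E)); last first.
  apply/funext => x; case: (leP (enorm (x : 'rV[R]_n)) 0%R) => x0; last exact: epow_pos.
  have -> : enorm (x : 'rV[R]_n) = 0%R by apply/eqP; rewrite eq_le x0 enorm_ge0.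
  rewrite /epow q0 poweR_EFin powR0 ?inve0//.
  by rewrite oppr_eq0 lt_eqF.
by apply: measurable_fun_ifT => //; apply: measurable_fun_ler => //; exact: measurable_enorm.
Qed.

Lemma measurable_lne_enorm : measurable_fun setT
  (fun x : T => lne (enorm (x : 'rV[R]_n))%:E).
Proof.
rewrite (_ : (fun _ => _) = (fun x : T => if (enorm (x : 'rV[R]_n) <= 0)%R then -oo
    else (ln (enorm (x : 'rV[R]_n)))%:E)); last by apply/funext.
apply: measurable_fun_ifT => //; first by apply: measurable_fun_ler => //; exact: measurable_enorm.
apply/measurable_EFinP; exact: (measurableT_comp (@measurable_ln R) measurable_enorm).
Qed.

Lemma on_sphere_integral K mu r (F : R -> \bar R) : measurable K -> mu K = 1 ->
  on_sphere r mu -> measurable_fun setT (fun x : T => F (enorm (x : 'rV[R]_n))) ->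
  \int[mu]_(x in K) F (enorm (x : 'rV[R]_n)) = F r.
Proof.
move=> mK muK mur mF; rewrite (integral_prob_full mK muK)//.
rewrite -(integral_prob_full (@measurable_sphere R n r) mur)//.
by apply: (integral_sphere_cst mur) => x /= ->.
Qed.

Lemma moment_on_sphere K mu r q : (0 < r)%R -> measurable K -> mu K = 1 ->
  on_sphere r mu -> moment q K mu = (r `^ q)%:E.
Proof.
move=> r0 mK muK mur.
rewrite /moment (on_sphere_integral (F := fun t => epow t%:E q) mK muK mur).
  exact: epow_pos.
exact: measurable_epow.
Qed.

Lemma log_moment_on_sphere K mu r : (0 < r)%R -> measurable K -> mu K = 1 ->
  on_sphere r mu -> log_moment K mu = (ln r)%:E.
Proof.
move=> r0 mK muK mur.
rewrite /log_moment (on_sphere_integral (F := fun t => lne t%:E) mK muK mur).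
  exact: lne_EFin.
exact: measurable_lne_enorm.
Qed.

End radial_integrals.

(** * Moments compared through the mean of the kernel *)

Section moment_inequalities.
Local Open Scope ereal_scope.
Context {R : realType} {n : nat}.
Local Notation T := (g_sigma_algebraType (@open 'rV[R]_n)).
Variables (p : nat) (M r : R) (K : set T) (mu : borel_probability R n).
Local Notation D := (4 * M)%R.
Hypotheses (r0 : (0 < r)%R) (rM : (r <= M)%R).
Hypotheses (mK : measurable K) (KM : K `<=` eball M) (muK : mu K = 1).
Hypotheses (mu0 : mu [set (0%R : 'rV[R]_n)] = 0) (pot0 : pot p D mu 0%R <= kap p D r).

Let M0 : (0 < M)%R. Proof. exact: lt_le_trans rM. Qed.
Let D0 : (0 < D)%R. Proof. by rewrite mulr_gt0. Qed.
Let MD : (M <= D)%R. Proof. by have := M0; lra. Qed.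

(** Away from the origin, which is null, the moments are integrals of real functions; at 0 the real
    logarithm and negative powers differ from the extended ones. *)
Definition punctured : set T := K `&` [set x | (0 < enorm (x : 'rV[R]_n))%R].

Lemma measurable_punctured : measurable punctured.
Proof.
apply: measurableI => //; rewrite -[X in measurable X]setTI.
rewrite (_ : [set x | _] = (@enorm R n : T -> R) @^-1` `]0%R, +oo[%classic); last first.
  by apply/seteqP; split => x /=; rewrite in_itv/= andbT.
exact: (measurable_enorm measurableT).
Qed.

Let mP := measurable_punctured.

Lemma punctured_full : mu punctured = 1.
Proof.
rewrite prob_full_setIr//; last first.
  rewrite -[X in measurable X]setTI.
  rewrite (_ : [set x | _] = (@enorm R n : T -> R) @^-1` `]0%R, +oo[%classic); last first.
    by apply/seteqP; split => x /=; rewrite in_itv/= andbT.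
  exact: (measurable_enorm measurableT).
have m0 : measurable ([set (0%R : 'rV[R]_n)] : set T).
  rewrite (_ : [set _] = [set x : T | enorm (x : 'rV[R]_n) = 0%R]); first exact: measurable_sphere.
  by apply/seteqP; split => x /=; [move=> ->; exact: enorm0|exact: enorm_eq0].
transitivity (mu (~` [set (0%R : 'rV[R]_n)])); last by rewrite probability_setC// mu0 sube0.
congr (mu _); apply/seteqP; split => x /=.
  by move=> x0 E; move: x0; rewrite E enorm0 ltxx.
by move=> x0; rewrite lt0r enorm_ge0 andbT; apply/eqP => /enorm_eq0.
Qed.

Let muP := punctured_full.

Let bnd x : punctured x -> (0 < enorm (x : 'rV[R]_n) <= M)%R.
Proof. by move=> [/KM + /= ->]. Qed.

Lemma moment_punctured q : moment q K mu =
  \int[mu]_(x in punctured) (enorm (x : 'rV[R]_n) `^ q)%:E.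
Proof.
have me := @measurable_epow R n q.
rewrite /moment (integral_prob_full mK muK)// -(integral_prob_full mP muP)//.
by apply: eq_integral => x /set_mem [_ /= x0]; exact: epow_pos.
Qed.

Lemma log_moment_punctured : log_moment K mu =
  \int[mu]_(x in punctured) (ln (enorm (x : 'rV[R]_n)))%:E.
Proof.
have me := @measurable_lne_enorm R n.
rewrite /log_moment (integral_prob_full mK muK)// -(integral_prob_full mP muP)//.
by apply: eq_integral => x /set_mem [_ /= x0]; exact: lne_EFin.
Qed.

Lemma newton_mean : exists m : R,
  [/\ mu.-integrable punctured (EFin \o fun x : T => newton p (enorm (x : 'rV[R]_n))),
    \int[mu]_(x in punctured) (newton p (enorm (x : 'rV[R]_n)))%:E = m%:E,
    (m <= newton p r)%R & pot p D mu 0%R = kap p D r <-> m = newton p r].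
Proof.
have mk : measurable_fun setT (fun x : T => kap p D (enorm (x : 'rV[R]_n))).
  exact: (measurableT_comp (measurable_kap p D0) measurable_enorm).
have kf : kap p D r = (newton p r - newton p D)%:E.
  by rewrite kapE// (le_trans rM).
pose g (x : T) : R := (newton p (enorm (x : 'rV[R]_n)) - newton p D)%R.
have pE : pot p D mu 0%R = \int[mu]_(x in punctured) (g x)%:E.
  transitivity (\int[mu]_x kap p D (enorm (x : 'rV[R]_n))).
    by apply: eq_integral => x _; rewrite sub0r enormN.
  rewrite -(integral_prob_full mP muP)//; apply: eq_integral => x /set_mem /bnd/andP[x0 xM].
  by rewrite kapE// (le_trans xM).
have pf : pot p D mu 0%R \is a fin_num.
  by rewrite ge0_fin_numE ?pot_ge0// (le_lt_trans pot0)// kf ltry.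
have ig : mu.-integrable punctured (EFin \o g).
  apply/integrableP; split.
    apply: (eq_measurable_fun (fun x : T => kap p D (enorm (x : 'rV[R]_n)))).
      by move=> x /set_mem /bnd/andP[x0 xM]; rewrite kapE// (le_trans xM).
    exact: measurable_funTS.
  rewrite (eq_integral (fun x => (g x)%:E)); last first.
    move=> x /set_mem /bnd/andP[x0 xM]; rewrite gee0_abs// lee_fin subr_ge0.
    by rewrite newton_nincr// (le_trans xM).
  by rewrite -pE ltey_eq pf.
have ic : mu.-integrable punctured (EFin \o fun=> newton p D).
  by apply: integrableS (prob_integrable_cst mu (newton p D)).
have E : (EFin \o fun x : T => newton p (enorm (x : 'rV[R]_n))) =
    (fun x => (EFin \o g) x + (EFin \o fun=> newton p D) x).
  by apply/funext => x /=; rewrite -EFinD subrK.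
have iN : mu.-integrable punctured (EFin \o fun x : T => newton p (enorm (x : 'rV[R]_n))).
  by rewrite E; exact: (integrableD mP ig ic).
exists (fine (pot p D mu 0%R) + newton p D)%R; split => //.
- transitivity (\int[mu]_(x in punctured) ((EFin \o g) x + (EFin \o fun=> newton p D) x)).
    by apply: eq_integral => x _ /=; rewrite -EFinD subrK.
  rewrite (integralD mP ig ic) EFinD fineK// pE; congr (_ + _).
  rewrite -[RHS](prob_integral_cst mu); apply: (integral_prob_full mP muP).
  exact: measurable_cst.
- by have := pot0; rewrite kf -(fineK pf) lee_fin; lra.
- rewrite kf -{1}(fineK pf); split => [[->]|H]; first by rewrite subrK.
  by congr EFin; rewrite -H addrK.
Qed.

Let sphere_of_strict (P : R -> Prop) :
  {ae mu, forall x, punctured x -> P (enorm (x : 'rV[R]_n))} ->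
  (forall s, (0 < s)%R -> s != r -> ~ P s) -> on_sphere r mu.
Proof.
move=> aP HP; apply: ae_prob_full; first exact: measurable_sphere.
apply: ae_sub (ae_and aP (prob_full_ae mP muP)) _ => x [xP Px] /=.
apply: contrapT => /eqP xr; have [x0 _] := andP (bnd Px).
exact: HP x0 xr (xP Px).
Qed.

Let mpow q : measurable_fun setT (fun x : T => enorm (x : 'rV[R]_n) `^ q)%R.
Proof. exact: (measurableT_comp (measurable_powR q) measurable_enorm). Qed.

(** The tangent coefficient has the sign of [q], and the mean of the kernel is at most [newton p r].
    This favors [q > 0]; for [q < - p] it works against the inequality, and regularity is what
    removes the linear term. *)
Lemma moment_ge q : (0 < q)%R \/ (q < - p%:R)%R /\ pot p D mu 0%R = kap p D r ->
  (r `^ q)%:E <= moment q K mu /\ (moment q K mu = (r `^ q)%:E -> on_sphere r mu).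
Proof.
move=> hq; have [m [iN Nm mr reg]] := newton_mean.
have hq' : (0 < q \/ q < - p%:R)%R by case: hq => [|[]]; [left|right].
have am : (0 <= tangent_coef p q r * (newton p r - m))%R.
  apply: tangent_coefM => //; case: hq => [q0|[_ /reg ->]]; last by rewrite subrr mulr0.
  by rewrite mulr_ge0 ?(ltW q0)// subr_ge0.
rewrite moment_punctured.
have tang (x : T) : punctured x -> (r `^ q - tangent_coef p q r *
    (newton p (enorm (x : 'rV[R]_n)) - newton p r) <= enorm (x : 'rV[R]_n) `^ q)%R.
  move=> /bnd/andP[x0 _]; have [->|xr] := eqVneq (enorm (x : 'rV[R]_n)) r.
    by rewrite subrr mulr0 subr0.
  by apply/ltW/powR_gt_tangent.
(* An infinite moment satisfies the inequality and cannot equal the finite value at [r]. *)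
have [inf|fin] := eqVneq (\int[mu]_(x in punctured) (enorm (x : 'rV[R]_n) `^ q)%:E) +oo.
  by rewrite inf leey; split.
have ip : mu.-integrable punctured (EFin \o (fun x : T => enorm (x : 'rV[R]_n) `^ q)%R).
  apply/integrableP; split; first by apply/measurable_EFinP; exact: measurable_funTS.
  rewrite (eq_integral (fun x : T => (enorm (x : 'rV[R]_n) `^ q)%:E)) ?ltey// => x _.
  by rewrite gee0_abs// lee_fin powR_ge0.
have [le eq] := tangent_integral_ge mP muP iN Nm ip am tang.
split => // Eq; apply: (@sphere_of_strict (fun s => s `^ q = r `^ q - tangent_coef p q r * (newton p s - newton p r))%R (eq Eq)) => s s0 sr E.
by have := powR_gt_tangent r0 s0 hq' sr; rewrite -E ltxx.
Qed.

Lemma moment_le q : (- p%:R < q)%R -> (q < 0)%R ->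
  moment q K mu <= (r `^ q)%:E /\ (moment q K mu = (r `^ q)%:E -> on_sphere r mu).
Proof.
move=> hq q0; have [m [iN Nm mr reg]] := newton_mean.
have am : (tangent_coef p q r * (newton p r - m) <= 0)%R.
  rewrite -oppr_ge0 -mulrN; apply: tangent_coefM => //.
  by rewrite mulrN -mulNr mulr_ge0 ?subr_ge0// oppr_ge0 ltW.
rewrite moment_punctured.
have tang (x : T) : punctured x -> (enorm (x : 'rV[R]_n) `^ q <= r `^ q - tangent_coef p q r *
    (newton p (enorm (x : 'rV[R]_n)) - newton p r))%R.
  move=> /bnd/andP[x0 _]; have [->|xr] := eqVneq (enorm (x : 'rV[R]_n)) r.
    by rewrite subrr mulr0 subr0.
  by apply/ltW/powR_lt_tangent.
have [ig _] := integrable_tangent (newton p r) mP muP iN Nm (r `^ q) (tangent_coef p q r).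
have ip : mu.-integrable punctured (EFin \o (fun x : T => enorm (x : 'rV[R]_n) `^ q)%R).
  apply: (le_integrable mP _ _ ig); first by apply/measurable_EFinP; exact: measurable_funTS.
  move=> x Px; rewrite /= lee_fin ger0_norm ?powR_ge0// (le_trans (tang x Px))//.
  exact: ler_norm.
have [le eq] := tangent_integral_le mP muP iN Nm ip am tang.
split => // Eq; apply: (@sphere_of_strict (fun s => s `^ q = r `^ q - tangent_coef p q r * (newton p s - newton p r))%R (eq Eq)) => s s0 sr E.
by have := powR_lt_tangent r0 s0 hq q0 sr; rewrite -E ltxx.
Qed.

Lemma moment_newton : (0 < p)%N ->
  moment (- p%:R) K mu <= (r `^ (- p%:R))%:E /\
  (moment (- p%:R) K mu = (r `^ (- p%:R))%:E <-> pot p D mu 0%R = kap p D r).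
Proof.
move=> p0; have [m [iN Nm mr reg]] := newton_mean.
have NE s : (0 < s)%R -> (s `^ (- p%:R) = newton p s)%R.
  by move=> s0; rewrite /newton gtn_eqF// powRN powR_mulrn// ltW.
have -> : moment (- p%:R) K mu = m%:E.
  rewrite moment_punctured -Nm; apply: eq_integral => x /set_mem /bnd/andP[x0 _].
  by rewrite NE.
rewrite NE// lee_fin; split => //; rewrite reg; split => [[]//|->//].
Qed.

Lemma log_moment_ge : (0 < p)%N ->
  (ln r)%:E <= log_moment K mu /\ (log_moment K mu = (ln r)%:E -> on_sphere r mu).
Proof.
move=> p0; have [m [iN Nm mr reg]] := newton_mean.
set a := ((p%:R * newton p r)^-1)%R.
have a0 : (0 <= a)%R by rewrite invr_ge0 mulr_ge0// ltW// newton_gt0.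
have am : (0 <= a * (newton p r - m))%R by rewrite mulr_ge0// subr_ge0.
rewrite log_moment_punctured.
have tang (x : T) : punctured x -> (ln r - a *
    (newton p (enorm (x : 'rV[R]_n)) - newton p r) <= ln (enorm (x : 'rV[R]_n)))%R.
  move=> /bnd/andP[x0 _]; have [->|xr] := eqVneq (enorm (x : 'rV[R]_n)) r.
    by rewrite subrr mulr0 subr0.
  by apply/ltW/ln_gt_tangent.
have [ig _] := integrable_tangent (newton p r) mP muP iN Nm (ln r) a.
(* The logarithm lies between its integrable tangent and the constant [ln M]. *)
have ip : mu.-integrable punctured (EFin \o fun x : T => ln (enorm (x : 'rV[R]_n))).
  have ic : mu.-integrable punctured (EFin \o (fun=> `|ln M|)%R).
    by apply: integrableS (prob_integrable_cst mu _).
  pose g (x : T) : R := (ln r - a * (newton p (enorm (x : 'rV[R]_n)) - newton p r))%R.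
  have ig2 : mu.-integrable punctured (EFin \o (fun x => `|g x| + `|ln M|)%R).
    exact: (integrableD mP (integrable_abse ig) ic).
  apply: (le_integrable mP _ _ ig2).
    apply/measurable_EFinP; apply: measurable_funTS.
    exact: (measurableT_comp (@measurable_ln R) measurable_enorm).
  move=> x Px; have /andP[x0 xM] := bnd Px; have h1 := tang x Px.
  have h2 : (ln (enorm (x : 'rV[R]_n)) <= ln M)%R by rewrite ler_ln.
  rewrite /= lee_fin [leRHS]ger0_norm ?addr_ge0// ler_norml.
  rewrite -/(g x) in h1.
  have h3 := ler_norm (ln M); have h4 := ler_norm (- g x); rewrite normrN in h4.
  have h5 := normr_ge0 (g x); have h6 := normr_ge0 (ln M); lra.
have [le eq] := tangent_integral_ge mP muP iN Nm ip am tang.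
split => // Eq; apply: (@sphere_of_strict (fun s => ln s = ln r - a * (newton p s - newton p r))%R (eq Eq)) => s s0 sr E.
by have := ln_gt_tangent r0 s0 p0 sr; rewrite -E ltxx.
Qed.

Lemma log_moment_log : p = 0%N ->
  (ln r)%:E <= log_moment K mu /\
  (log_moment K mu = (ln r)%:E <-> pot p D mu 0%R = kap p D r).
Proof.
move=> pE; have [m [iN Nm mr reg]] := newton_mean.
have NE s : (newton p s = - ln s)%R by rewrite /newton pE eqxx.
have -> : log_moment K mu = (- m)%:E.
  rewrite log_moment_punctured EFinN -Nm.
  rewrite -integralN; last exact: integrable_add_def.
  by apply: eq_integral => x _; rewrite NE/= opprK.
rewrite NE in mr reg; rewrite lee_fin; split; first by lra.
by rewrite reg; split => [[H]|->]; [lra|rewrite opprK].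
Qed.

End moment_inequalities.

Section euclidean_topology.
Context {R : realType} {n : nat}.
Implicit Types (x y : 'rV[R]_n) (r e : R).

Lemma open_enorm_ball x e : open [set y | enorm (y - x) < e].
Proof.
rewrite (_ : [set _ | _] = (fun y => enorm (x - y)) @^-1` [set t | t < e]).
  by apply: open_comp; [move=> y _; exact: continuous_enormB|exact: open_lt].
by apply/seteqP; split => y /=; rewrite enormB.
Qed.

Lemma nbhs_enorm_ball (A : set 'rV[R]_n) x : nbhs x A ->
  exists2 e, 0 < e & [set y | enorm (y - x) < e] `<=` A.
Proof.
move=> /nbhs_ballP[e e0 xA]; exists e => // y /= xy; apply: xA; split => // i j.
rewrite /ball/= ord1 (le_lt_trans _ xy)// enormB.
by have := coord_le_enorm (x - y) j; rewrite !mxE.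
Qed.

Lemma boundary_eball r : 0 < r -> boundary (@eball R n r) = [set x | enorm x = r].
Proof.
move=> r0; rewrite /boundary -(closure_id _).1; last exact: closed_eball.
apply/seteqP; split => x /=.
  move=> [xr xi]; apply/eqP; rewrite eq_le xr/= leNgt; apply/negP => xlt; apply: xi.
  have : nbhs x [set y | enorm (y - x) < r - enorm x].
    by apply: open_nbhs_nbhs; split; [exact: open_enorm_ball|rewrite /= subrr enorm0 subr_gt0].
  rewrite /interior; apply: filterS => y /= yx; rewrite /eball/=.
  have := ler_enormD (y - x) x; rewrite subrK => h; lra.
move=> xr; split; first by rewrite /eball/= xr.
rewrite /interior => /nbhs_enorm_ball[e e0 H].
(* A point outside the ball at distance [e / 2] from [x]. *)
have := H ((1 + e / (2 * r)) *: x); rewrite /eball/= enormZ xr.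
have er : 0 < e / (2 * r) by rewrite divr_gt0// mulr_gt0.
rewrite -[X in _ - X]scale1r -scalerBl enormZ xr addrAC subrr add0r.
have er1 : 0 < 1 + e / (2 * r) by rewrite addr_gt0.
rewrite (gtr0_norm er) (gtr0_norm er1).
have -> : e / (2 * r) * r = e / 2 by field; rewrite gt_eqF.
move=> /(_ ltac:(lra)); rewrite mulrDl mul1r.
have -> : e / (2 * r) * r = e / 2 by field; rewrite gt_eqF.
lra.
Qed.

Lemma compact_sub_eball (K : set 'rV[R]_n) : compact K -> exists M, K `<=` eball M.
Proof.
move=> cK; have : compact (enorm @` K).
  by apply: continuous_compact => //; apply: continuous_subspaceT; exact: continuous_enorm.
move=> /compact_bounded [M [_ HM]]; exists (M + 1) => x Kx.
rewrite /eball/= (le_trans (ler_norm _))//; apply: HM; first by rewrite ltrDl.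
by exists x.
Qed.

End euclidean_topology.

(** * Equality: containment of the sphere and capacity outside the ball *)

Section equality_case.
Local Open Scope ereal_scope.
Context {R : realType} {n : nat}.
Local Notation T := (g_sigma_algebraType (@open 'rV[R]_n)).
Local Notation p := (n - 2)%N.
Variables (M r : R) (K : set 'rV[R]_n) (mu nu : borel_probability R n).
Local Notation D := (4 * M)%R.
Hypotheses (n1 : (1 < n)%N) (r0 : (0 < r)%R) (rM : (r <= M)%R).
Hypotheses (cK : compact K) (KM : K `<=` eball M).
Hypotheses (muP : minimizer p D K mu) (nuP : minimizer p D (eball r) nu).
Hypotheses (munu : mutual p D mu mu = mutual p D nu nu) (nufin : mutual p D nu nu < +oo).

Let M0 : (0 < M)%R. Proof. exact: lt_le_trans rM. Qed.
Let D0 : (0 < D)%R. Proof. by rewrite mulr_gt0. Qed.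
Let MD : (2 * M <= D)%R. Proof. by have := M0; lra. Qed.
Let mK : measurable (K : set T). Proof. exact: compact_measurable_rV. Qed.
Let mB : measurable (eball r : set T).
Proof. by apply: closed_measurable_rV; exact: closed_eball. Qed.
Let BM : (eball r : set T) `<=` eball M.
Proof. by move=> x; rewrite /eball/= => /le_trans; apply. Qed.
Let radnu : radial nu. Proof. exact: (ball_minimizer_radial r0 rM nuP nufin). Qed.
Let spnu : on_sphere r nu. Proof. exact: (ball_minimizer_sphere n1 r0 rM nuP nufin). Qed.

(** Living on the sphere, [mu] becomes a competitor on the ball with the least energy there. *)
Lemma sphere_minimizer_eq : on_sphere r mu -> forall A : set T, measurable A -> mu A = nu A.
Proof.
move=> smu.
have muB : minimizer p D (eball r) mu.
  split; last by move=> rho rhoB; rewrite munu; exact: nuP.2.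
  by apply: (prob_full_sub (measurable_sphere r) mB _ smu) => x /= xr; rewrite /eball/= xr.
have mufin : mutual p D mu mu < +oo by rewrite munu.
exact: (minimizer_unique D0 MD mB BM muB nuP mufin).
Qed.

Lemma radial_sphere_null (x y : 'rV[R]_n) (e : R) : enorm x = enorm y ->
  nu [set z : T | (enorm ((z : 'rV[R]_n) - x) < e)%R] =
  nu [set z : T | (enorm ((z : 'rV[R]_n) - y) < e)%R].
Proof.
move=> xy; rewrite -[RHS](radnu (x - y)%R); last by apply: open_measurable_rV; exact: open_enorm_ball.
have E z : enorm (reflection (x - y)%R z - y)%R = enorm (z - x)%R.
  by rewrite enormB reflection_swap_dist// enormB.
by congr (nu _); apply/seteqP; split => z /=; rewrite E.
Qed.

(** A point of the sphere outside the closed set [K] has a neighborhood null for [mu = nu]. By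
    symmetry, balls of the same radius around all points of the sphere are null, and finitely many
    of them cover it, contradicting its full mass. *)
Lemma sphere_sub_minimizer_set : on_sphere r mu -> [set x | enorm x = r] `<=` K.
Proof.
move=> smu x0 x0r; apply: contrapT => nKx0.
have clK : closed K by apply: compact_closed => //; exact: norm_hausdorff.
have [e e0 He] : exists2 e, (0 < e)%R & [set y | enorm (y - x0) < e]%R `<=` ~` K.
  by apply: nbhs_enorm_ball; apply: open_nbhs_nbhs; split => //; exact: closed_openC.
pose U (x : 'rV[R]_n) : set 'rV[R]_n := [set y | enorm (y - x) < e]%R.
have mU x : measurable (U x : set T).
  by apply: open_measurable_rV; exact: open_enorm_ball.
have U0 x : enorm x = r -> nu (U x) = 0.
  move=> xr; rewrite /U (@radial_sphere_null x x0) ?xr//.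
  rewrite -sphere_minimizer_eq//; last exact: (mU x0).
  apply: (subset_measure0 _ (measurableC mK) He (prob_full_setC mK muP.1)).
  exact: (mU x0).
have : compact [set x : 'rV[R]_n | enorm x = r].
  apply: (@subclosed_compact _ _ (eball r)) => //; [|exact: compact_eball|].
    rewrite (_ : [set _ | _] = enorm @^-1` [set r]); last by [].
    apply: (@preimage_closed _ _ _ _ _ (@closed_eq _ r)).
    by move=> x _; exact: continuous_enorm.
  by move=> x /= xr; rewrite /eball/= xr.
rewrite compact_cover => /(_ _ [set x | enorm x = r] U) [x _||F FS cov].
- exact: open_enorm_ball.
- by move=> x xr; exists x => //; rewrite /U/= subrr enorm0.
have FS' x : x \in finmap.enum_fset F -> enorm x = r by move=> /FS; rewrite inE.
rewrite /cover bigcup_fset in cov.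
have N0 : nu (\big[setU/set0]_(i <- finmap.enum_fset F) U i) = 0.
  elim: (finmap.enum_fset F) FS' => [|x s ih] sub; first by rewrite big_nil measure0.
  have sub' y : y \in s -> enorm y = r by move=> ys; apply: sub; rewrite inE ys orbT.
  rewrite big_cons measureU0//.
  - by apply: U0; apply: sub; exact: mem_head.
  - by apply: bigsetU_measurable => i _.
  - exact: ih.
have : nu [set x : T | enorm (x : 'rV[R]_n) = r] <= 0.
  rewrite -N0 le_measure ?inE//; first exact: measurable_sphere.
  by apply: bigsetU_measurable => i _.
by rewrite [X in X <= _]spnu lee_fin ler10.
Qed.

(** A measure of finite energy on [Z] may be tested in the variational inequality for [mu]. It would
    have mean potential at least [kap p D r], whereas outside the ball the potential of [mu = nu] is
    [kap p D (enorm x)], strictly smaller. *)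
Lemma sphere_inner_capacity_zero : on_sphere r mu -> inner_capacity_zero p%:R (K `\` eball r).
Proof.
move=> smu Z cZ ZK; apply: capacity0.
have mZ : measurable (Z : set T) by exact: compact_measurable_rV.
have ZM : (Z : set T) `<=` eball M by move=> x /ZK[/KM].
apply: (energyE_infinite (p := p) M0 mZ ZM) => la laZ.
apply/eqP; rewrite -leye_eq leNgt; apply/negP => lafin.
have laK : la K = 1 by apply: (prob_full_sub mZ mK _ laZ) => x /ZK[].
have mufin : mutual p D mu mu < +oo by rewrite munu.
have ge := minimizer_mutual_ge D0 muP laK lafin mufin.
have E : mutual p D mu mu = kap p D r.
  by rewrite munu; exact: (ball_minimizer_energy n1 r0 rM nuP nufin).
have rD : (r <= D)%R by have := M0; have := rM; lra.
have kf : kap p D r = (fine (kap p D r))%:E by rewrite fineK// kapE.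
have potE x : Z x -> pot p D mu x = kap p D (enorm x).
  move=> Zx; have [Kx /negP] := ZK _ Zx; rewrite -ltNge => rx.
  transitivity (pot p D nu x).
    by apply: eq_prob_integral; exact: sphere_minimizer_eq.
  by apply: (ball_minimizer_pot_outside n1 r0 rM nuP nufin) => //; exact: KM.
have lt x : Z x -> kap p D (enorm x) < kap p D r.
  move=> Zx; have [/KM xM /negP] := ZK _ Zx; rewrite -ltNge => rx.
  apply: kap_decr => //; first exact: lt_trans rx.
  by rewrite (le_trans xM)//; have := M0; lra.
have ge' : kap p D r <= \int[la]_(x in Z) kap p D (enorm (x : 'rV[R]_n)).
  rewrite -E (le_trans ge)// /mutual -(integral_prob_full mZ laZ); last exact: measurable_pot.
  by rewrite le_eqVlt; apply/orP; left; apply/eqP; apply: eq_integral => x /set_mem /potE.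
have mk : measurable_fun setT (fun x : T => kap p D (enorm (x : 'rV[R]_n))).
  exact: (measurableT_comp (measurable_kap p D0) measurable_enorm).
have i2 : la.-integrable (Z : set T) (fun=> kap p D r).
  by rewrite kf; apply: integrableS (prob_integrable_cst la _).
have i1 : la.-integrable (Z : set T) (fun x : T => kap p D (enorm (x : 'rV[R]_n))).
  apply: (le_integrable mZ _ _ i2); first exact: measurable_funTS.
  by move=> x Zx /=; rewrite !gee0_abs ?kap_ge0// ltW// lt.
have le1 : {ae la, forall x, Z x -> kap p D (enorm (x : 'rV[R]_n)) <= kap p D r}.
  by apply: aeW => x /lt/ltW.
have le2 : \int[la]_(x in Z) kap p D r <= \int[la]_(x in Z) kap p D (enorm (x : 'rV[R]_n)).
  by rewrite (integral_prob_full mZ laZ)// prob_integral_cst.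
have H := ae_and (ae_eq_of_le mZ i1 i2 le1 le2) (prob_full_ae mZ laZ).
have : {ae la, forall x : T, set0 x}.
  apply: ae_sub H _ => x [Ex Zx]; have := lt x Zx.
  by rewrite Ex// ltxx.
by move=> /(ae_prob_full measurable0); rewrite measure0 => -[] /eqP; rewrite eq_sym oner_eq0.
Qed.

(** Once [K] contains the sphere, [nu] is admissible for [K] with the least energy, so it coincides
    with [mu]. *)
Lemma boundary_sub_on_sphere : boundary (@eball R n r) `<=` K -> on_sphere r mu.
Proof.
rewrite boundary_eball// => SK.
have nuK : nu K = 1 by apply: (prob_full_sub (measurable_sphere r) mK _ spnu).
have nuK' : minimizer p D K nu.
  by split => // rho rhoK; rewrite -munu muP.2.
have mufin : mutual p D mu mu < +oo by rewrite munu.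
have U := minimizer_unique D0 MD mK KM muP nuK' mufin.
by rewrite /on_sphere U//; exact: measurable_sphere.
Qed.

Lemma on_sphere_fills : on_sphere r mu <->
  boundary (@eball R n r) `<=` K /\ inner_capacity_zero p%:R (K `\` eball r).
Proof.
split => [smu|[SK _]]; last exact: boundary_sub_on_sphere.
split; last exact: sphere_inner_capacity_zero.
by rewrite boundary_eball//; exact: sphere_sub_minimizer_set.
Qed.

End equality_case.

(** * Comparison of moments for sets of equal capacity *)

Lemma adde_EFin_lty (R : realType) (a : \bar R) (c : R) :
  (a + c%:E < +oo -> a < +oo)%E.
Proof. by case: a => //= s; rewrite !ltry. Qed.

Lemma adde_EFin_inj (R : realType) (a b : \bar R) (c : R) :
  (a + c%:E = b + c%:E -> a = b)%E.
Proof. by case: a b => [a| |] [b| |]// [] /addIr ->. Qed.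

Unset Implicit Arguments.

Theorem theorem1p1 (R : realType) (n : nat) (hn : (2 <= n)%N)
    (K : set 'rV[R]_n) (hK : compact K) (r : R) (hr : 0 < r)
    (mu nu : borel_probability R n) :
  let p : R := (n - 2)%:R in
  let B : set 'rV[R]_n := eball r in
  let regular0 := regular_point p K mu 0 in
  let K_fills_B :=
    boundary B `<=` K /\ inner_capacity_zero p (K `\` B) in
  capacity p K = capacity p B -> (0 < capacity p B)%E ->
  equilibrium_measure p K mu -> equilibrium_measure p B nu ->
  [/\ (* (i) *)
      (forall q : R, 0 < q \/ (q < - p /\ regular0) ->
        (moment q B nu <= moment q K mu)%E),
      (* (ii) *)
      (log_moment B nu <= log_moment K mu)%E,
      (* (iii) *)
      (forall q : R, - p <= q -> q < 0 ->
        (moment q K mu <= moment q B nu)%E)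
    & (* (iv) *)
      [/\ (forall q : R, 0 < q \/ (q < - p /\ regular0) ->
            (moment q K mu = moment q B nu <-> K_fills_B)),
          ((3 <= n)%N -> (log_moment K mu = log_moment B nu <-> K_fills_B)),
          (forall q : R, - p < q -> q < 0 ->
            (moment q K mu = moment q B nu <-> K_fills_B)),
          (n = 2%N -> (log_moment K mu = log_moment B nu <-> regular0))
        & ((3 <= n)%N ->
            (moment (- p) K mu = moment (- p) B nu <-> regular0))]].

Proof.
move=> p B regular0 K_fills_B capKB capB muK nuB.
have n1 : (1 < n)%N by [].
have [M1 KM1] := compact_sub_eball hK.
(* A common radius for [K] and [B], so that both energies are shifted by the same constant
   [newton (n - 2) D]. *)
pose M := Num.max M1 r.
have rM : r <= M by rewrite le_max lexx orbT.
have M0 : 0 < M by exact: lt_le_trans rM.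
have KM : K `<=` eball M by move=> x /KM1; rewrite /eball/= le_max => ->.
have BM : B `<=` eball M by move=> x; rewrite /B /eball/= => /le_trans; apply.
pose D := 4 * M.
have D0 : 0 < D by rewrite mulr_gt0.
have mK : measurable (K : set (g_sigma_algebraType (@open 'rV[R]_n))).
  exact: compact_measurable_rV.
have mB : measurable (B : set (g_sigma_algebraType (@open 'rV[R]_n))).
  by apply: compact_measurable_rV; exact: compact_eball.
have [muP EK] := equilibrium_minimizer (p := (n - 2)%N) M0 mK KM muK.
have [nuP EB] := equilibrium_minimizer (p := (n - 2)%N) M0 mB BM nuB.
have finite (m : borel_probability R n) (A : set 'rV[R]_n) :
    energy p A = (mutual (n - 2) D m m + (newton (n - 2) D)%:E)%E ->
    (0 < capacity p A)%E ->
    (mutual (n - 2) D m m < +oo)%E.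
  by move=> EA /(@capacity_gt0 _ _ (n - 2) A); rewrite -/p EA; exact: adde_EFin_lty.
have nufin := finite _ _ EB capB.
have mufin : (mutual (n - 2) D mu mu < +oo)%E by apply: (finite _ _ EK); rewrite capKB.
have munu : mutual (n - 2) D mu mu = mutual (n - 2) D nu nu.
  have /fineK muE := fin_num_mutual D0 mufin.
  have /fineK nuE := fin_num_mutual D0 nufin.
  have EK' := EK; have EB' := EB; rewrite -muE -EFinD in EK'; rewrite -nuE -EFinD in EB'.
  (* The shift [newton (n - 2) D] is itself positive when [n > 2], which gives the positivity needed
     to recover the energies from the capacities. *)
  have pos (m : borel_probability R n) : (0 < n - 2)%N ->
      0 < fine (mutual (n - 2) D m m) + newton (n - 2) D.
    move=> p0; apply: ltr_wpDl; last exact: newton_gt0 p0 D0.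
    by apply: fine_ge0; exact: mutual_ge0.
  have := capacity_inj EK' EB' (fun p0 => conj (pos mu p0) (pos nu p0)) capKB.
  by rewrite EK EB; exact: adde_EFin_inj.
have V := ball_minimizer_energy n1 hr rM nuP nufin.
have pot0 : (pot (n - 2) D mu 0%R <= kap (n - 2) D r)%E.
  by rewrite -V -munu; exact: (minimizer_pot0_le n1 M0 mK KM muP mufin).
have mu0 := finite_energy_set1 D0 mufin.
have muK1 := muP.1; have nuB1 := nuP.1.
have regE : regular0 <-> pot (n - 2) D mu 0%R = kap (n - 2) D r.
  rewrite /regular0 /regular_point /p (potentialE _ M0 mK KM muK1); last first.
    by rewrite enorm0; exact: mulr_ge0 (ler0n _ 3) (ltW M0).
  rewrite EK munu V; split => [|->//].
  exact: adde_EFin_inj.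
have fills : on_sphere r mu <-> K_fills_B.
  exact: (on_sphere_fills n1 hr rM hK KM muP nuP munu nufin).
have nuS := ball_minimizer_sphere n1 hr rM nuP nufin.
have momB q : moment q B nu = (r `^ q)%:E by exact: moment_on_sphere.
have logB : log_moment B nu = (ln r)%:E by exact: log_moment_on_sphere.
have hge q : 0 < q \/ q < - p /\ regular0 ->
    0 < q \/ q < - (n - 2)%:R /\ pot (n - 2) D mu 0 = kap (n - 2) D r.
  by case=> [q0|[qp reg]]; [left; exact: q0|right; exact: (conj qp (regE.1 reg))].
have momK q : K_fills_B -> moment q K mu = (r `^ q)%:E.
  by move=> /fills muS; exact: moment_on_sphere.
have logK : K_fills_B -> log_moment K mu = (ln r)%:E.
  by move=> /fills muS; exact: log_moment_on_sphere.
have gt0p : (3 <= n)%N -> (0 < n - 2)%N by rewrite subn_gt0.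
have eq0p : (n <= 2)%N -> (n - 2 = 0)%N by move=> n2; apply/eqP; rewrite subn_eq0.
split.
- move=> q /hge hq; rewrite momB.
  by have [] := moment_ge hr rM mK KM muK1 mu0 pot0 hq.
- rewrite logB; have [/eq0p p0|/gt0p p0] := leqP n 2.
    by have [] := log_moment_log hr rM mK KM muK1 mu0 pot0 p0.
  by have [] := log_moment_ge hr rM mK KM muK1 mu0 pot0 p0.
- move=> q; rewrite momB le_eqVlt => /orP[/eqP <- q0|pq q0].
    (* At the endpoint [q = - p] the moment is the mean of the kernel itself, and [q < 0] excludes
       the logarithmic case. *)
    have p0 : (0 < n - 2)%N by move: q0; rewrite oppr_lt0 ltr0n.
    by have [] := moment_newton hr rM mK KM muK1 mu0 pot0 p0.
  by have [] := moment_le hr rM mK KM muK1 mu0 pot0 pq q0.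
- split.
  + move=> q /hge hq; rewrite momB; split; last exact: momK.
    by have [_ H] := moment_ge hr rM mK KM muK1 mu0 pot0 hq; move=> /H /fills.
  + move=> /gt0p p0; rewrite logB; split; last exact: logK.
    by have [_ H] := log_moment_ge hr rM mK KM muK1 mu0 pot0 p0; move=> /H /fills.
  + move=> q pq q0; rewrite momB; split; last exact: momK.
    by have [_ H] := moment_le hr rM mK KM muK1 mu0 pot0 pq q0; move=> /H /fills.
  + move=> n2; have p0 : (n - 2 = 0)%N by rewrite n2.
    rewrite logB; apply: iff_trans (iff_sym regE).
    by have [] := log_moment_log hr rM mK KM muK1 mu0 pot0 p0.
  + move=> /gt0p p0; rewrite momB; apply: iff_trans (iff_sym regE).
    by have [] := moment_newton hr rM mK KM muK1 mu0 pot0 p0.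
Qed.
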